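(* Let $M$ be a hypersurface of constant mean curvature $H$, immersed in $\mathcal N$. Then the following relation is satisfied at any point $p$ of $M$ and for any $\varepsilon>0$: $$|\phi|\Delta|\phi|+|\phi|^4+\frac{n(n-2)H}{\sqrt{n(n-1)}}|\phi|^3-nH^2|\phi|^2+|\phi|^2Ric(\nu,\nu)-nH\sum_{i=1}^nR(\nu,e_i,\nu,\phi(e_i))$$ $$-\sum_{i,k=1}^n\{2R(e_k,\phi(e_i),e_k,\phi(e_i))+2R(e_k,e_i,\phi(e_i),\phi(e_k))\}$$ $$-\sum_{i,k=1}^n\{\langle(\overline\nabla_{e_i}R)(e_k,\phi(e_i))e_k,\nu\rangle+\langle(\overline\nabla_{e_i}R)(e_i,\phi(e_k))e_k,\nu\rangle\}$$ $$\ge\frac{2}{n(1+\varepsilon)}|\nabla|\phi||^2-\frac2\varepsilon\sum_{i,j}R(\nu,e_i,e_i,e_j)^2,$$ where $\{e_i\}$ is a local orthonormal frame at $p$.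
   Context: $\mathcal N$ is an orientable Riemannian manifold of dimension $n+1$ with bounded sectional curvature and bounded covariant derivative of the curvature tensor; $\overline\nabla$ is its Levi-Civita connection, $R$ its curvature tensor, with $R(x,y)z=\overline\nabla_x\overline\nabla_yz-\overline\nabla_y\overline\nabla_xz-\overline\nabla_{[x,y]}z$ and $R(x,y,z,w)=\langle R(x,y)w,z\rangle$ (so $R(x,y,x,y)$ is the sectional curvature for orthonormal $x,y$), and $Ric$ is its Ricci curvature. $M$ is an orientable immersed hypersurface of dimension $n$ with unit normal $\nu$; if the mean curvature is nonzero, the orientation is chosen so that the mean curvature vector is $H\nu$ with $H>0$. $A$ is the shape operator, $\langle A(x),y\rangle=\langle\nu,B(x,y)\rangle$ with $B$ the second fundamental form, $H=\frac1n\mathrm{tr}A$, $\phi=A-H\,\mathrm{Id}$ is the endomorphism associated with the traceless part of $B$, and $|\phi|$ is its norm. $\nabla$ is the induced connection on $M$ and $\Delta$ is the trace of the Hessian on $M$.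
   Formalization: The local orthonormal frame at p is required to diagonalize φ (principal directions), because the sum of R(ν,e_i,e_i,e_j)² depends on the frame when n ≥ 3 and the inequality fails for some other orthonormal frames. *)

(* Defs.v *)
From HB Require Import structures.
From mathcomp Require Import all_boot all_order all_algebra.
From mathcomp Require Import all_classical all_reals topology normedtype derive.

Set Implicit Arguments.
Unset Strict Implicit.
Unset Printing Implicit Defensive.

Import Order.TTheory GRing.Theory Num.Theory.
Import numFieldNormedType.Exports.

Local Open Scope classical_set_scope.
Local Open Scope ring_scope.

(* Smooth manifolds are given by an atlas; tangent vectors at a point are given
   by their components (row vectors) in a chart, and a linear endomorphism of a
   tangent space by the matrix acting on these rows from the right. Geometric
   quantities are computed in charts. *)

Fixpoint iter_derive (R : realType) (V W : normedModType R) (s : seq V)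
    (f : V -> W) : V -> W :=
  if s is v :: s' then fun x => 'D_v (iter_derive s' f) x else f.

(* For open U and finite-dimensional V this is the class C^oo on U. *)
Definition smooth_on (R : realType) (V W : normedModType R) (U : set V)
    (f : V -> W) : Prop :=
  forall (s : seq V) (x : V), U x -> differentiable (iter_derive s f) x.

Record manifold (R : realType) (m : nat) := Manifold {
  space :> topologicalType;
  chart : Type;
  chart_dom : chart -> set space;
  chart_map : chart -> space -> 'rV[R]_m;
  chart_inv : chart -> 'rV[R]_m -> space;
  manifold_hausdorff : hausdorff_space space;
  manifold_second_countable : @second_countable space;
  dom_cover : forall p, exists i, chart_dom i p;
  dom_open : forall i, open (chart_dom i);
  img_open : forall i, open (chart_map i @` chart_dom i);
  chart_mapK : forall i p, chart_dom i p -> chart_inv i (chart_map i p) = p;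
  chart_map_continuous : forall i p, chart_dom i p -> {for p, continuous (chart_map i)};
  chart_inv_continuous : forall i p, chart_dom i p ->
    {for chart_map i p, continuous (chart_inv i)};
  transition_smooth : forall i j,
    smooth_on (chart_map i @` (chart_dom i `&` chart_dom j)) (chart_map j \o chart_inv i)
}.

Definition transition (R : realType) (m : nat) (X : manifold R m)
    (i j : chart X) : 'rV[R]_m -> 'rV[R]_m :=
  chart_map j \o chart_inv i.

(* An orientation is a locally constant choice of sign for each chart, such that
   the transition maps become orientation preserving after correction by these
   signs (chart domains need not be connected). *)
Definition orientable (R : realType) (m : nat) (X : manifold R m) : Prop :=
  exists o : chart X -> X -> bool,
    (forall i p, chart_dom i p -> \forall q \near p, o i q = o i p) /\
    (forall i j p, chart_dom i p -> chart_dom j p ->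
       0 < (-1) ^+ (o i p (+) o j p) *
           \det ('J (transition i j) (chart_map i p))).

Definition bil (R : realType) (m : nat) (G : 'M[R]_m) (u v : 'rV[R]_m) : R :=
  (u *m G *m v^T) 0 0.

Definition basis_vec (R : realType) (m : nat) (a : 'I_m) : 'rV[R]_m :=
  delta_mx 0 a.
Arguments basis_vec {R m} a.

Record riemannian_metric (R : realType) (m : nat) (X : manifold R m) := Metric {
  gmx : chart X -> 'rV[R]_m -> 'M[R]_m;
  gmx_smooth : forall i, smooth_on (chart_map i @` chart_dom i) (gmx i);
  gmx_sym : forall i p, chart_dom i p ->
    (gmx i (chart_map i p))^T = gmx i (chart_map i p);
  gmx_pos : forall i p (u : 'rV[R]_m), chart_dom i p -> u != 0 ->
    0 < bil (gmx i (chart_map i p)) u u;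
  gmx_compat : forall i j p (u v : 'rV[R]_m), chart_dom i p -> chart_dom j p ->
    bil (gmx j (chart_map j p)) ('D_u (transition i j) (chart_map i p))
                            ('D_v (transition i j) (chart_map i p))
    = bil (gmx i (chart_map i p)) u v
}.

Section Ambient.
Variables (R : realType) (m : nat) (g : 'rV[R]_m -> 'M[R]_m).
Notation field := ('rV[R]_m -> 'rV[R]_m).

(* Levi-Civita connection in a chart: Gamma(u, v) is determined by
   2 g(Gamma(u, v), w) = (D_u g)(v, w) + (D_v g)(u, w) - (D_w g)(u, v). *)
Definition christoffel (x u v : 'rV[R]_m) : 'rV[R]_m :=
  (2^-1 *: \row_a (bil ('D_u g x) v (basis_vec a)
                   + bil ('D_v g x) u (basis_vec a)
                   - bil ('D_(basis_vec a) g x) u v)) *m invmx (g x).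

Definition nabla (X Y : field) : field := fun x =>
  'D_(X x) Y x + christoffel x (X x) (Y x).

Definition lie_bracket (X Y : field) : field := fun x =>
  'D_(X x) Y x - 'D_(Y x) X x.

Definition curv_field (X Y Z : field) : field := fun x =>
  nabla X (nabla Y Z) x - nabla Y (nabla X Z) x - nabla (lie_bracket X Y) Z x.

Definition nabla_curv_field (W X Y Z : field) : field := fun x =>
  nabla W (curv_field X Y Z) x - curv_field (nabla W X) Y Z x
  - curv_field X (nabla W Y) Z x - curv_field X Y (nabla W Z) x.

(* These expressions are tensorial, so that their values on tangent vectors can
   be computed with constant extensions: R(u, v)w and (nabla_z R)(u, v)w. *)
Definition curv (x u v w : 'rV[R]_m) : 'rV[R]_m :=
  curv_field (cst u) (cst v) (cst w) x.

Definition nabla_curv (x z u v w : 'rV[R]_m) : 'rV[R]_m :=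
  nabla_curv_field (cst z) (cst u) (cst v) (cst w) x.

(* R(u, v, w, z) = <R(u, v)z, w> *)
Definition riem (x u v w z : 'rV[R]_m) : R := bil (g x) (curv x u v z) w.

(* Ric(u, v) is the trace of z |-> R(z, u)v *)
Definition ricci (x u v : 'rV[R]_m) : R :=
  \sum_a (curv x (basis_vec a) u v) 0 a.

End Ambient.

Definition bounded_sectional_curvature (R : realType) (m : nat)
    (X : manifold R m) (g : riemannian_metric X) : Prop :=
  exists C : R, forall i p (u v : 'rV[R]_m), chart_dom i p ->
    let x := chart_map i p in
    bil (gmx g i x) u u = 1 -> bil (gmx g i x) v v = 1 ->
    bil (gmx g i x) u v = 0 ->
    `|riem (gmx g i) x u v u v| <= C.

Definition bounded_nabla_curvature (R : realType) (m : nat)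
    (X : manifold R m) (g : riemannian_metric X) : Prop :=
  exists C : R, forall i p (z u v w y : 'rV[R]_m), chart_dom i p ->
    let x := chart_map i p in
    bil (gmx g i x) z z = 1 -> bil (gmx g i x) u u = 1 ->
    bil (gmx g i x) v v = 1 -> bil (gmx g i x) w w = 1 ->
    bil (gmx g i x) y y = 1 ->
    `|bil (gmx g i x) (nabla_curv (gmx g i) x z u v w) y| <= C.

Section Hypersurface.
(* Local data: the ambient metric g in a chart, the chart expression f of the
   immersion, and the chart expression nu of the unit normal along f. *)
Variables (R : realType) (n : nat).
Variables (g : 'rV[R]_n.+1 -> 'M[R]_n.+1).
Variables (f nu : 'rV[R]_n -> 'rV[R]_n.+1).

Definition induced_metric (x : 'rV[R]_n) : 'M[R]_n :=
  \matrix_(a, b) bil (g (f x)) ('D_(basis_vec a) f x) ('D_(basis_vec b) f x).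

(* Ambient covariant derivative of a vector field V along f *)
Definition nabla_along (u : 'rV[R]_n) (V : 'rV[R]_n -> 'rV[R]_n.+1)
    (x : 'rV[R]_n) : 'rV[R]_n.+1 :=
  'D_u V x + christoffel g (f x) ('D_u f x) (V x).

(* Induced connection: the tangential component of nabla_along u (df Y) *)
Definition nabla_induced (u : 'rV[R]_n) (Y : 'rV[R]_n -> 'rV[R]_n)
    (x : 'rV[R]_n) : 'rV[R]_n :=
  (\row_a bil (g (f x)) (nabla_along u (fun y => 'D_(Y y) f y) x)
                        ('D_(basis_vec a) f x))
  *m invmx (induced_metric x).

(* B(u, v), the normal component *)
Definition second_form (x u v : 'rV[R]_n) : 'rV[R]_n.+1 :=
  nabla_along u (fun y => 'D_v f y) x - 'D_(nabla_induced u (cst v) x) f x.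

(* The matrix with <u *m A, v> = <nu, B(u, v)> *)
Definition shape_operator (x : 'rV[R]_n) : 'M[R]_n :=
  (\matrix_(a, b) bil (g (f x)) (nu x)
                      (second_form x (basis_vec a) (basis_vec b)))
  *m invmx (induced_metric x).

Definition mean_curvature (x : 'rV[R]_n) : R :=
  n%:R^-1 * \tr (shape_operator x).

Definition traceless_shape (x : 'rV[R]_n) : 'M[R]_n :=
  shape_operator x - (mean_curvature x)%:M.

(* |phi|^2 = tr (phi phi^* ), where the adjoint for the induced metric G is
   phi^* = G phi^T G^-1 in the row-vector convention. *)
Definition norm_traceless (x : 'rV[R]_n) : R :=
  Num.sqrt (\tr (traceless_shape x *m (induced_metric x *m
    (traceless_shape x)^T *m invmx (induced_metric x)))).

Definition grad (h : 'rV[R]_n -> R) (x : 'rV[R]_n) : 'rV[R]_n :=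
  (\row_a 'D_(basis_vec a) h x) *m invmx (induced_metric x).

Definition hessian (h : 'rV[R]_n -> R) (x u v : 'rV[R]_n) : R :=
  'D_u (fun y => 'D_v h y) x - 'D_(nabla_induced u (cst v) x) h x.

Definition laplacian (h : 'rV[R]_n -> R) (x : 'rV[R]_n) : R :=
  \tr ((\matrix_(a, b) hessian h x (basis_vec a) (basis_vec b))
       *m invmx (induced_metric x)).

End Hypersurface.

Section Immersion.
Variables (R : realType) (n : nat).
Variables (M : manifold R n) (N : manifold R n.+1).

Definition local_map (F : M -> N) (i : chart M) (j : chart N) :
    'rV[R]_n -> 'rV[R]_n.+1 :=
  chart_map j \o F \o chart_inv i.

Definition immersion (F : M -> N) : Prop :=
  continuous F /\
  forall i j,
    smooth_on (chart_map i @` (chart_dom i `&` F @^-1` chart_dom j)) (local_map F i j) /\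
    forall p, chart_dom i p -> chart_dom j (F p) -> forall u : 'rV[R]_n,
      'D_u (local_map F i j) (chart_map i p) = 0 -> u = 0.

(* nu j p: components in the chart j of N of a vector tangent to N at F p *)
Definition unit_normal (gN : riemannian_metric N) (F : M -> N)
    (nu : chart N -> M -> 'rV[R]_n.+1) : Prop :=
  [/\ forall j j' p, chart_dom j (F p) -> chart_dom j' (F p) ->
        'D_(nu j p) (transition j j') (chart_map j (F p)) = nu j' p,
      forall i j, smooth_on (chart_map i @` (chart_dom i `&` F @^-1` chart_dom j))
                            (nu j \o chart_inv i),
      forall j p, chart_dom j (F p) ->
        bil (gmx gN j (chart_map j (F p))) (nu j p) (nu j p) = 1 &
      forall i j p (u : 'rV[R]_n), chart_dom i p -> chart_dom j (F p) ->
        bil (gmx gN j (chart_map j (F p))) (nu j p)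
            ('D_u (local_map F i j) (chart_map i p)) = 0].

Definition constant_mean_curvature (gN : riemannian_metric N) (F : M -> N)
    (nu : chart N -> M -> 'rV[R]_n.+1) (H : R) : Prop :=
  forall i j p, chart_dom i p -> chart_dom j (F p) ->
    mean_curvature (gmx gN j) (local_map F i j) (nu j \o chart_inv i) (chart_map i p)
    = H.

End Immersion.

(* Main.v *)
(**
Near p, work in a chart z of M in which G(0) = 1, dG(0) = 0 for the induced metric G and
the second form h(0) is diagonal with entries lam_a; it is the given chart composed with a
quadratic map whose second derivatives are minus the Christoffel symbols. Along the
immersion, the ambient covariant derivative is metric and torsion free, and its commutator
is the ambient curvature. Differentiating the Codazzi equation and using that the
trace of h G^-1 is constant yields Simons' identity for the Laplacian of |A|^2, hence of
|phi|^2 = |A|^2 - n H^2. The cubic term is bounded by Okumura's inequality. For the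
gradient term, Codazzi compares the components phi_(ab,a) with phi_(aa,b) up to a
curvature component, and (u + v)^2 >= u^2 / (1 + eps) - v^2 / eps gives the refined Kato
inequality. Where |phi| vanishes, phi = 0 and the gradient of |phi| is 0 (at a minimum,
[derive] is 0 whether or not the limit exists), so the left-hand side is 0.
*)

Require Import Defs.
From HB Require Import structures.
From mathcomp Require Import all_boot all_order all_algebra.
From mathcomp Require Import all_classical all_reals topology normedtype landau derive realfun.
From mathcomp Require Import ring lra.
Import Order.TTheory GRing.Theory Num.Theory.
Import numFieldNormedType.Exports.
Local Open Scope classical_set_scope.
Local Open Scope ring_scope.

Set Implicit Arguments.
Unset Strict Implicit.
Unset Printing Implicit Defensive.

(** * Smooth functions *)

(** At the origin of such a chart first covariant derivatives reduce to partial ones, but the second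
    derivatives of G survive. They contain tangential parts of third derivatives of the immersion,
    which the two fundamental forms at the point do not determine. These cancel because only h_ii,kk
    - lam_i G_ii,kk occurs, the second derivative of a diagonal entry of h G^-1. No intrinsic
    curvature of M is computed: the expression of Gauss' equation comes out of this cancellation.
    The constants come from the principal frame, in which the gradient of |phi| sees only the
    components phi_(aa,c), so that its square is at most the sum of their squares. For b different
    from a, phi_(ab,a) occurs twice in the squared norm of the derivative of phi, whence the 2;
    tracelessness bounds phi_(cc,c) by the other phi_(aa,c), whence the 1/n. The Kato estimate must
    gain one more full copy of the squared gradient of |phi|, because half the Laplacian of |phi|^2
    is |phi| times the Laplacian of |phi| plus that square. *)

Section Smoothness.
Variable R : realType.

Section General.
Variables V W : normedModType R.
Implicit Types (f g : V -> W) (x v : V) (U : set V).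

(** The difference [g - f] vanishes near [x], so its differential is 0 by uniqueness of the
    differential, and [g] is the sum of [f] and this difference. *)
Lemma near_eq_differentiable f g x :
  (\near x, f x = g x) -> differentiable f x -> differentiable g x.
Proof.
move=> fg df.
have fgx : f x = g x by apply: nbhs_singleton fg.
suff H : differentiable (g - f) x.
  by rewrite -(subrKC f g); exact: differentiableD.
have E : (g - f) \o shift x = cst ((g - f) x) + (\0 : V -> W) +o_ 0 id.
  apply/eqaddoP => e e0; near=> y.
  rewrite /= !fctE /= addr0 fgx subrr subr0.
  have -> : g (y + x) = f (y + x).
    by rewrite addrC; near: y; move/nbhs0P: fg; apply: filterS => y /= ->.
  by rewrite subrr normr0 mulr_ge0// ltW.
apply/diff_locallyP.
have c0 : continuous (\0 : V -> W) by exact: cst_continuous.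
rewrite (_ : ('d _ _ : V -> W) = \0); first by [].
exact: (@diff_unique _ _ _ _ \0).
Unshelve. all: by end_near. Qed.

Lemma open_eq_near f g U x : open U -> U x -> (forall y, U y -> f y = g y) ->
  \near x, f x = g x.
Proof.
move=> oU Ux fg; have := open_nbhs_nbhs (conj oU Ux).
by apply: filterS => y /fg.
Qed.

Lemma eq_derive_open f g U x v : open U -> U x -> (forall y, U y -> f y = g y) ->
  'D_v f x = 'D_v g x.
Proof. by move=> oU Ux fg; apply: near_eq_derive; exact: open_eq_near fg. Qed.

Lemma derive_dirD f x u v : differentiable f x ->
  'D_(u + v) f x = 'D_u f x + 'D_v f x.
Proof. by move=> df; rewrite !deriveE// linearD. Qed.

Lemma derive_dirZ f x (a : R) u : differentiable f x ->
  'D_(a *: u) f x = a *: 'D_u f x.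
Proof. by move=> df; rewrite !deriveE// linearZ. Qed.

Lemma derive_dir_sum f x (I : finType) (a : I -> R) (u : I -> V) : differentiable f x ->
  'D_(\sum_i a i *: u i) f x = \sum_i a i *: 'D_(u i) f x.
Proof.
move=> df; rewrite deriveE// linear_sum; apply: eq_bigr => i _.
by rewrite linearZ deriveE.
Qed.

(* [Ck 0] already asks for differentiability: [Ck k] means [k.+1] times differentiable. *)
Fixpoint Ck (k : nat) (U : set V) (f : V -> W) : Prop :=
  (forall x, U x -> differentiable f x) /\
  (if k is k'.+1 then forall v, Ck k' U (fun x => 'D_v f x) else True).

Lemma Ck_differentiable k U f x : Ck k U f -> U x -> differentiable f x.
Proof. by case: k => [|k] [+ _]; apply. Qed.

Lemma CkS k U f : Ck k.+1 U f -> Ck k U f.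
Proof.
elim: k f => [|k IH] f [df Df]; split=> // v.
exact/IH/Df.
Qed.

Lemma Ck_derive k U f v : Ck k.+1 U f -> Ck k U (fun x => 'D_v f x).
Proof. by case=> _; apply. Qed.

Lemma Ck_ext k U f g : open U -> (forall x, U x -> f x = g x) -> Ck k U f -> Ck k U g.
Proof.
move=> oU; elim: k f g => [|k IH] f g fg [df Df].
  split=> // x Ux; apply: near_eq_differentiable (df _ Ux).
  exact: open_eq_near fg.
split=> [x Ux|v].
  apply: near_eq_differentiable (df _ Ux); exact: open_eq_near fg.
by apply: (IH _ _ _ (Df v)) => x Ux; exact: eq_derive_open fg.
Qed.

Lemma Ck_sub k U U' f : U' `<=` U -> Ck k U f -> Ck k U' f.
Proof.
move=> UU; elim: k f => [|k IH] f [df Df]; split; try by move=> x /UU/df.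
  by [].
by move=> v; exact/IH/Df.
Qed.

Lemma smooth_onP U f : smooth_on U f <-> forall k, Ck k U f.
Proof.
split=> [+ k|].
  elim: k f => [|k IH] f fs; split=> //; try by move=> x; exact: (fs [::]).
  (* [iter_derive] adds derivatives on the outside and [Ck] on the inside; a direction appended at
     the end of the list is the innermost one. *)
  move=> v; apply: IH => s x Ux; have := fs (rcons s v) x Ux.
  rewrite (_ : iter_derive (rcons s v) f = iter_derive s (fun x => 'D_v f x))//.
  by elim: s {x Ux} => //= w s ->.
move=> fk s x Ux.
suff H : forall k, Ck k U (iter_derive s f) by exact: Ck_differentiable (H 0%N) Ux.
elim: s {x Ux} => [|v s IH] k /=; first exact: fk.
exact: Ck_derive (IH k.+1).
Qed.

Lemma Ck_cst k U (a : W) : Ck k U (fun=> a).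
Proof.
elim: k a => [|k IH] a; split=> //; try by move=> x _; exact: differentiable_cst.
move=> v; rewrite (_ : (fun x : V => 'D_v _ x) = fun=> 0); first exact: IH.
by apply/funext => x; exact: derive_cst.
Qed.

Lemma CkD k U f g : open U -> Ck k U f -> Ck k U g -> Ck k U (fun x => f x + g x).
Proof.
move=> oU; elim: k f g => [|k IH] f g [df Df] [dg Dg].
  by split=> // x Ux; apply: differentiableD; [exact: df|exact: dg].
split=> [x Ux|v]; first by apply: differentiableD; [exact: df|exact: dg].
apply: (Ck_ext oU _ (IH _ _ (Df v) (Dg v))) => x Ux.
by rewrite deriveD//; apply: diff_derivable; [exact: df|exact: dg].
Qed.

Lemma CkZ k U (a : R) f : open U -> Ck k U f -> Ck k U (fun x => a *: f x).
Proof.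
move=> oU; elim: k f => [|k IH] f [df Df].
  by split=> // x Ux; apply: differentiableZ; exact: df.
split=> [x Ux|v]; first by apply: differentiableZ; exact: df.
apply: (Ck_ext oU _ (IH _ (Df v))) => x Ux.
by rewrite deriveZ//; apply: diff_derivable; exact: df.
Qed.

Lemma Ck_sum k U (I : Type) (r : seq I) (P : pred I) (F : I -> V -> W) : open U ->
  (forall i, P i -> Ck k U (F i)) -> Ck k U (fun x => \sum_(i <- r | P i) F i x).
Proof.
move=> oU kF; elim: r => [|i r IH].
  by under eq_fun do rewrite big_nil; exact: Ck_cst.
case Pi: (P i); under eq_fun do rewrite big_cons Pi; last exact: IH.
by apply: CkD => //; exact: kF.
Qed.

End General.

Lemma derive_sum_fct (V W : normedModType R) n (F : 'I_n -> V -> W) x v :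
  (forall i, differentiable (F i) x) ->
  'D_v (fun y => \sum_i F i y) x = \sum_i 'D_v (F i) x.
Proof.
move=> dF; rewrite -derive_sum => [|i]; last exact: diff_derivable.
by congr ('D_v _ x); apply/funext => y; rewrite fct_sumE.
Qed.

Lemma differentiable_sum_fct (V W : normedModType R) n (F : 'I_n -> V -> W) x :
  (forall i, differentiable (F i) x) -> differentiable (fun y => \sum_i F i y) x.
Proof.
move=> dF; rewrite (_ : (fun y => _) = \sum_i F i); first exact: differentiable_sum.
by apply/funext => y; rewrite fct_sumE.
Qed.

Section Scalar.
Variable V : normedModType R.
Implicit Types (f g : V -> R) (x v : V) (U : set V).

Lemma derive_mul f g x v : differentiable f x -> differentiable g x ->
  'D_v (fun y => f y * g y) x = 'D_v f x * g x + f x * 'D_v g x.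
Proof.
move=> df dg; rewrite (@deriveM _ _ f g x v); [|exact: diff_derivable..].
by rewrite -[_ *: _]/(_ * _) -[X in _ + X]/(_ * _) addrC [X in X + _]mulrC.
Qed.

Lemma differentiable_mul f g x : differentiable f x -> differentiable g x ->
  differentiable (fun y => f y * g y) x.
Proof. exact: differentiableM. Qed.

Lemma CkM k U f g : open U -> Ck k U f -> Ck k U g -> Ck k U (fun x => f x * g x).
Proof.
move=> oU; elim: k f g => [|k IH] f g.
  move=> [df _] [dg _]; split=> // x Ux.
  by apply: differentiable_mul; [exact: df|exact: dg].
move=> fC gC; have [df Df] := fC; have [dg Dg] := gC.
split=> [x Ux|v]; first by apply: differentiable_mul; [exact: df|exact: dg].
apply: (@Ck_ext _ _ _ _ (fun x => 'D_v f x * g x + f x * 'D_v g x)) => //.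
  by move=> x Ux; rewrite derive_mul//; [exact: df|exact: dg].
by apply: CkD => //; apply: IH; do [exact: CkS|exact: Df|exact: Dg].
Qed.

Lemma Ck_prod k U (I : Type) (r : seq I) (P : pred I) (F : I -> V -> R) : open U ->
  (forall i, P i -> Ck k U (F i)) -> Ck k U (fun x => \prod_(i <- r | P i) F i x).
Proof.
move=> oU kF; elim: r => [|i r IH].
  by under eq_fun do rewrite big_nil; exact: Ck_cst.
case Pi: (P i); under eq_fun do rewrite big_cons Pi; last exact: IH.
by apply: CkM => //; exact: kF.
Qed.

Lemma CkV k U f : open U -> (forall x, U x -> f x != 0) -> Ck k U f ->
  Ck k U (fun x => (f x)^-1).
Proof.
move=> oU f0; elim: k f f0 => [|k IH] f f0 fC.
  split=> // x Ux; apply: differentiableV (f0 _ Ux); exact: Ck_differentiable fC Ux.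
have [df Df] := fC.
split=> [x Ux|v]; first by apply: differentiableV (f0 _ Ux); exact: df.
apply: (@Ck_ext _ _ _ _ (fun x => (-1) *: ((f x)^-1 * (f x)^-1 * 'D_v f x))) => //.
  move=> x Ux; rewrite (@deriveV _ _ f x v (f0 _ Ux)); last exact/diff_derivable/df.
  by rewrite scaleN1r scaleNr -expr2 exprVn.
have fV := IH _ f0 (CkS fC).
by apply: CkZ => //; apply: CkM; [|exact: CkM|exact: Df].
Qed.

End Scalar.

Section Matrix.
Variable V : normedModType R.
Implicit Types (x v : V) (U : set V).

Lemma differentiable_entry m n (F : V -> 'M[R]_(m, n)) i j x :
  differentiable F x -> differentiable (fun y => F y i j) x.
Proof.
move=> dF.
exact: (differentiable_comp dF (differentiable_coord (F x) i j)).
Qed.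

Lemma differentiable_mxP m n (F : V -> 'M[R]_(m, n)) x :
  differentiable F x <-> forall i j, differentiable (fun y => F y i j) x.
Proof.
split=> [dF i j|dF]; first exact: differentiable_entry.
rewrite (_ : F = fun y => \sum_i \sum_j F y i j *: delta_mx i j).
  apply: differentiable_sum_fct => i; apply: differentiable_sum_fct => j.
  exact: differentiableZl.
by apply/funext => y; exact: matrix_sum_delta.
Qed.

Lemma derive_entry m n (F : V -> 'M[R]_(m, n)) i j x v : differentiable F x ->
  ('D_v F x) i j = 'D_v (fun y => F y i j) x.
Proof. by move=> dF; rewrite derive_mx ?mxE//; exact: diff_derivable. Qed.

Lemma Ck_mxP k m n (F : V -> 'M[R]_(m, n)) U : open U ->
  Ck k U F <-> forall i j, Ck k U (fun y => F y i j).
Proof.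
move=> oU; split.
  elim: k F => [|k IH] F [dF DF] i j; split=> //;
    try by move=> x /dF; exact: differentiable_entry.
  move=> v; apply: (Ck_ext oU _ (IH _ (DF v) i j)) => x Ux.
  by rewrite derive_entry//; exact: dF.
elim: k F => [|k IH] F FC; split=> //;
  try by move=> x Ux; apply/differentiable_mxP => i j; exact: Ck_differentiable (FC i j) Ux.
move=> v; apply: IH => i j; apply: (Ck_ext oU _ (Ck_derive v (FC i j))) => x Ux.
rewrite derive_entry//; apply/differentiable_mxP => {}i {}j.
exact: Ck_differentiable (FC i j) Ux.
Qed.

Lemma differentiable_scale m n (a : V -> R) (F : V -> 'M[R]_(m, n)) x :
  differentiable a x -> differentiable F x -> differentiable (fun y => a y *: F y) x.
Proof.
move=> da dF; apply/differentiable_mxP => i j.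
under eq_fun do rewrite mxE; apply: differentiable_mul => //.
exact: differentiable_entry.
Qed.

Lemma derive_scale m n (a : V -> R) (F : V -> 'M[R]_(m, n)) x v :
  differentiable a x -> differentiable F x ->
  'D_v (fun y => a y *: F y) x = 'D_v a x *: F x + a x *: 'D_v F x.
Proof.
move=> da dF; apply/matrixP => i j.
rewrite derive_entry; last exact: differentiable_scale.
under eq_fun do rewrite mxE.
by rewrite derive_mul ?mxE// ?derive_entry//; exact: differentiable_entry.
Qed.

Lemma Ck_scale k m n (a : V -> R) (F : V -> 'M[R]_(m, n)) U : open U ->
  Ck k U a -> Ck k U F -> Ck k U (fun y => a y *: F y).
Proof.
move=> oU aC /(Ck_mxP _ _ oU) FC; apply/Ck_mxP => // i j.
by under eq_fun do rewrite mxE; exact: CkM.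
Qed.

Lemma differentiable_mulmx m n p (A : V -> 'M[R]_(m, n)) (B : V -> 'M[R]_(n, p)) x :
  differentiable A x -> differentiable B x -> differentiable (fun y => A y *m B y) x.
Proof.
move=> dA dB; apply/differentiable_mxP => i j.
under eq_fun do rewrite mxE; apply: differentiable_sum_fct => l.
by apply: differentiable_mul; exact: differentiable_entry.
Qed.

Lemma derive_mulmx m n p (A : V -> 'M[R]_(m, n)) (B : V -> 'M[R]_(n, p)) x v :
  differentiable A x -> differentiable B x ->
  'D_v (fun y => A y *m B y) x = 'D_v A x *m B x + A x *m 'D_v B x.
Proof.
move=> dA dB; apply/matrixP => i j.
rewrite derive_entry; last exact: differentiable_mulmx.
under eq_fun do rewrite mxE.
have dAe l := differentiable_entry i l dA; have dBe l := differentiable_entry l j dB.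
rewrite derive_sum_fct => [|l]; last exact: differentiable_mul.
rewrite !mxE -big_split; apply: eq_bigr => l _ /=.
by rewrite derive_mul// !derive_entry.
Qed.

Lemma Ck_mulmx k m n p (A : V -> 'M[R]_(m, n)) (B : V -> 'M[R]_(n, p)) U : open U ->
  Ck k U A -> Ck k U B -> Ck k U (fun y => A y *m B y).
Proof.
move=> oU /(Ck_mxP _ _ oU) AC /(Ck_mxP _ _ oU) BC; apply/Ck_mxP => // i j.
under eq_fun do rewrite mxE; apply: Ck_sum => // l _; exact: CkM.
Qed.

Lemma Ck_trmx k m n (A : V -> 'M[R]_(m, n)) U : open U ->
  Ck k U A -> Ck k U (fun y => (A y)^T).
Proof.
move=> oU /(Ck_mxP _ _ oU) AC; apply/Ck_mxP => // i j.
by under eq_fun do rewrite mxE; exact: AC.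
Qed.

Lemma Ck_det k n (A : V -> 'M[R]_n) U : open U -> Ck k U A -> Ck k U (fun y => \det (A y)).
Proof.
move=> oU /(Ck_mxP _ _ oU) AC; rewrite /determinant.
apply: Ck_sum => // s _; apply: CkM => //; first exact: Ck_cst.
by apply: Ck_prod => // l _; exact: AC.
Qed.

(** Cramer's rule: the inverse is the adjugate over the determinant, both polynomial in the
    entries. *)
Lemma Ck_invmx k n (A : V -> 'M[R]_n) U : open U -> (forall y, U y -> A y \in unitmx) ->
  Ck k U A -> Ck k U (fun y => invmx (A y)).
Proof.
move=> oU uA AC.
apply: (@Ck_ext _ _ _ _ (fun y => (\det (A y))^-1 *: \adj (A y))) => //.
  by move=> y Uy; rewrite /invmx uA.
apply: Ck_scale => //.
  by apply: CkV; [|move=> y /uA; rewrite unitmxE unitfE|exact: Ck_det].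
apply/Ck_mxP => // i j; under eq_fun do rewrite mxE /cofactor.
apply: CkM; [by []|exact: Ck_cst|]; apply: Ck_det => //; apply/Ck_mxP => // a b.
under eq_fun do rewrite !mxE; move/(Ck_mxP _ _ oU): AC; exact.
Qed.

End Matrix.

Section Composition.

Lemma derive_comp (V W X : normedModType R) (f : V -> W) (h : W -> X) x v :
  differentiable f x -> differentiable h (f x) ->
  'D_v (fun y => h (f y)) x = 'D_('D_v f x) h (f x).
Proof.
move=> df dh; rewrite deriveE; last exact: differentiable_comp df dh.
by rewrite (diff_comp df dh) /= !deriveE.
Qed.

Lemma row_sum_basis m (u : 'rV[R]_m) : u = \sum_a u 0 a *: basis_vec a.
Proof. exact: row_sum_delta. Qed.

Lemma derive_dir_basis m (W : normedModType R) (f : 'rV[R]_m -> W) x u :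
  differentiable f x -> 'D_u f x = \sum_a u 0 a *: 'D_(basis_vec a) f x.
Proof. by move=> df; rewrite {1}(row_sum_basis u) derive_dir_sum. Qed.

(** In the chain rule the direction in which [h] is differentiated moves with [x]. Expanded over the
    basis, it leaves derivatives of [h] in fixed directions, to which the induction hypothesis
    applies. *)
Lemma Ck_comp k (V : normedModType R) m (f : V -> 'rV[R]_m) (h : 'rV[R]_m -> R) U U' :
  open U -> (forall x, U x -> U' (f x)) -> Ck k U f -> Ck k U' h ->
  Ck k U (fun x => h (f x)).
Proof.
move=> oU UU; elim: k h => [|k IH] h.
  move=> [df _] [dh _]; split=> // x Ux.
  exact: differentiable_comp (df _ Ux) (dh _ (UU _ Ux)).
move=> fC hC; split=> [x Ux|v].
  have df := Ck_differentiable fC Ux.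
  exact: differentiable_comp df (Ck_differentiable hC (UU _ Ux)).
apply: (@Ck_ext _ _ _ _ (fun x => \sum_a ('D_v f x) 0 a * 'D_(basis_vec a) h (f x))) => //.
  move=> x Ux; have df := Ck_differentiable fC Ux.
  have dh := Ck_differentiable hC (UU _ Ux).
  by rewrite [RHS](derive_comp _ df dh) (derive_dir_basis _ dh).
apply: Ck_sum => // a _; apply: CkM => //.
  by have /(Ck_mxP _ _ oU) := Ck_derive v fC.
exact: (IH (fun y => 'D_(basis_vec a) h y) (CkS fC) (Ck_derive _ hC)).
Qed.

Lemma Ck_comp_mx k (V : normedModType R) m p q (f : V -> 'rV[R]_m)
    (h : 'rV[R]_m -> 'M[R]_(p, q)) U U' :
  open U -> open U' -> (forall x, U x -> U' (f x)) -> Ck k U f -> Ck k U' h ->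
  Ck k U (fun x => h (f x)).
Proof.
move=> oU oU' UU fC /(Ck_mxP _ _ oU') hC; apply/Ck_mxP => // i j.
exact: (@Ck_comp _ _ _ f (fun y => h y i j) _ _ oU UU).
Qed.

Lemma differentiable_sqrt (x : R) : 0 < x -> differentiable (@Num.sqrt R) x.
Proof.
by move=> x0; apply/derivable1_diffP; have [] := is_derive1_sqrt x0.
Qed.

Lemma derive_sqrt_comp (V : normedModType R) (f : V -> R) x v :
  differentiable f x -> 0 < f x ->
  'D_v (fun y => Num.sqrt (f y)) x = (2 * Num.sqrt (f x))^-1 * 'D_v f x.
Proof.
move=> df f0; rewrite derive_comp//; last exact: differentiable_sqrt.
set d := 'D_v f x; have -> : d = d *: (1 : R) by rewrite -[RHS]/(d * 1) mulr1.
rewrite derive_dirZ; last exact: differentiable_sqrt.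
by rewrite derive_sqrt// -[d *: _ in RHS]/(d * 1) mulr1 -[LHS]/(_ * _) mulrC.
Qed.

Lemma Ck_sqrt k (V : normedModType R) (f : V -> R) U : open U ->
  (forall x, U x -> 0 < f x) -> Ck k U f -> Ck k U (fun x => Num.sqrt (f x)).
Proof.
move=> oU f0; elim: k => [|k IH] fC; have dc x (Ux : U x) :=
  differentiable_comp (Ck_differentiable fC Ux) (differentiable_sqrt (f0 x Ux)); split=> // v.
apply: (@Ck_ext _ _ _ _ (fun x => (2 * Num.sqrt (f x))^-1 * 'D_v f x)) => //.
  by move=> x Ux; rewrite derive_sqrt_comp//; [exact: Ck_differentiable fC Ux|exact: f0].
apply: CkM; [by []| |exact: Ck_derive].
apply: CkV; [by [] | |].
  by move=> x Ux; rewrite mulf_neq0 ?pnatr_eq0// sqrtr_eq0 -ltNge; exact: f0.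
apply: (@CkM _ _ _ (fun=> 2)); [by []|exact: Ck_cst|exact/IH/CkS].
Qed.

End Composition.

(** * Linear maps depending on a point, applied to a moving vector *)

Section Apply.
Variables (V : normedModType R) (m p q : nat).
Variables (L : V -> 'rV[R]_m -> 'M[R]_(p, q)) (X : V -> 'rV[R]_m) (U : set V).
Hypothesis oU : open U.
Hypothesis Llin : forall y, U y -> linear (L y).

Lemma lin_basis y u : U y -> L y u = \sum_a u 0 a *: L y (basis_vec a).
Proof.
move=> Uy; have Ll := Llin Uy.
pose LM := GRing.isLinear.Build _ _ _ _ _ Ll.
pose LL : {linear _ -> _} := HB.pack (L y) LM.
by rewrite {1}(row_sum_basis u) -[L y]/(LL : _ -> _) linear_sum; under eq_bigr do rewrite linearZ.
Qed.

Lemma Ck_apply k : (forall a, Ck k U (fun y => L y (basis_vec a))) -> Ck k U X ->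
  Ck k U (fun y => L y (X y)).
Proof.
move=> LC XC; apply: (@Ck_ext _ _ _ _ (fun y => \sum_a X y 0 a *: L y (basis_vec a))) => //.
  by move=> y /lin_basis ->.
apply: Ck_sum => // a _; apply: Ck_scale => //.
by move/Ck_mxP : XC; exact.
Qed.

(** Leibniz rule for the pairing of a field of linear maps with a vector field. Smoothness of [L] is
    only known for fixed arguments, so both sides are expanded over the basis. *)
Lemma derive_apply x v : U x -> (forall a, differentiable (fun y => L y (basis_vec a)) x) ->
  differentiable X x ->
  'D_v (fun y => L y (X y)) x = 'D_v (fun y => L y (X x)) x + L x ('D_v X x).
Proof.
move=> Ux dL dX; have dXe a := differentiable_entry 0 a dX.
rewrite (@eq_derive_open _ _ _ (fun y => \sum_a X y 0 a *: L y (basis_vec a)) U)//; last first.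
  by move=> y /lin_basis ->.
rewrite (@eq_derive_open _ _ (fun y => L y (X x)) (fun y => \sum_a X x 0 a *: L y (basis_vec a)) U)//; last first.
  by move=> y /lin_basis ->.
rewrite !derive_sum_fct; [|by move=> a; do [exact: differentiableZ|exact: differentiable_scale]..].
rewrite (lin_basis _ Ux) -big_split; apply: eq_bigr => a _ /=.
rewrite derive_scale// deriveZ; last exact: diff_derivable.
by rewrite addrC derive_entry.
Qed.

End Apply.
End Smoothness.

(** * Symmetry of second derivatives *)

Section Schwarz.
Variables (R : realType) (V : normedModType R).
Implicit Types (f : V -> R) (x u v w : V) (U : set V).

Lemma derive_line f w u (t : R) : differentiable f (w + t *: u) ->
  is_derive t (1 : R) (fun t => f (w + t *: u)) ('D_u f (w + t *: u)).
Proof.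
move=> df.
have dl : differentiable (fun t : R => w + t *: u) t.
  by apply: differentiableD; [exact: differentiable_cst|exact: differentiableZl].
have Dl : 'D_1 (fun t : R => w + t *: u) t = u.
  rewrite (@deriveD _ _ _ (fun=> w) (fun t : R => t *: u)); [|exact/diff_derivable/differentiable_cst|exact/diff_derivable/differentiableZl].
  rewrite derive_cst add0r deriveE; last exact: differentiableZl.
  by rewrite diffZl// diff_val scale1r.
split; first exact/diff_derivable/(differentiable_comp dl df).
by rewrite (derive_comp _ dl df) Dl.
Qed.

Lemma diff_approx f x (e : R) : differentiable f x -> 0 < e ->
  exists2 d : R, 0 < d & forall w, `|w| < d -> `|f (x + w) - f x - 'D_w f x| <= e * `|w|.
Proof.
move=> df e0; have /eqaddoP /(_ _ e0) := diff_locally df.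
move=> /nbhs_ballP[d /= d0 H]; exists d => // w wd.
have := H w; rewrite -ball_normE /= sub0r normrN => /(_ wd).
by rewrite !fctE /= deriveE// [w + x]addrC opprD addrA.
Qed.

(** The mean value theorem, applied to t -> f(x + s v + t u) - f(x + t u) on [0, s], turns the
    second difference into s times a difference of two values of ['D_u f]; each of them is compared
    with its first order expansion at [x]. Only differentiability of ['D_u f] at [x] is used for
    this, not continuity of second derivatives. *)
Lemma second_difference f U x u v (e : R) : open U -> U x -> Ck 1 U f -> 0 < e ->
  exists2 d : R, 0 < d & forall s, 0 < s < d ->
  `|f (x + s *: u + s *: v) - f (x + s *: u) - f (x + s *: v) + f x
    - s ^+ 2 * 'D_v (fun y => 'D_u f y) x| <= e * (2 * `|u| + `|v|) * s ^+ 2.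
Proof.
move=> oU Ux [df Df] e0.
have [r /= r0 rU] : exists2 r : R, 0 < r & forall w, `|w| < r -> U (x + w).
  have /nbhs_ballP[r /= r0 H] := open_nbhs_nbhs (conj oU Ux).
  exists r => // w wr; apply: H; rewrite -ball_normE /=.
  by rewrite opprD addrA subrr sub0r normrN.
have dG : differentiable (fun y => 'D_u f y) x by exact: (proj1 (Df u) x Ux).
have [d0 d00 Hd] := diff_approx dG e0.
pose d := Num.min r d0; have dpos : 0 < d by rewrite lt_min r0.
(* Every c u + b v with 0 <= c, b <= s has norm at most s M, so s < d / M keeps all points in play
   inside [U] and within the range of the expansion. The 1 keeps [M] positive when both vectors
   vanish. *)
pose M := `|u| + `|v| + 1.
have M0 : 0 < M by rewrite ltr_wpDl// addr_ge0.
exists (d / M); first by rewrite divr_gt0.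
move=> s /andP[s0]; rewrite ltr_pdivlMr// => sM.
have small c b : 0 <= c <= s -> 0 <= b <= s -> `|c *: u + b *: v| < d.
  move=> /andP[c0 cs] /andP[b0 bs]; apply: le_lt_trans sM.
  rewrite (le_trans (ler_normD _ _))// !normrZ !ger0_norm// /M !mulrDr mulr1.
  by rewrite -[leLHS]addr0 !lerD// ?ler_wpM2r// ltW.
have inU c b : 0 <= c <= s -> 0 <= b <= s -> U (x + (c *: u + b *: v)).
  by move=> cs bs; apply: rU; apply: lt_le_trans (small _ _ cs bs) _; rewrite ge_min lexx.
have ss : 0 <= s <= s by rewrite lexx ltW.
have z0 : 0 <= (0 : R) <= s by rewrite lexx ltW.
pose a t := f ((x + s *: v) + t *: u) - f (x + t *: u).
have da t : 0 <= t <= s -> is_derive t (1:R) a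
    ('D_u f ((x + s *: v) + t *: u) - 'D_u f (x + t *: u)).
  move=> ts; apply: is_deriveB; apply: derive_line; apply: df.
    by rewrite -addrA [_ + t *: u]addrC; exact: inU.
  by rewrite -[t *: u]addr0 -(scale0r v); exact: inU.
have [] := @MVT _ a (fun t => 'D_u f ((x + s *: v) + t *: u) - 'D_u f (x + t *: u)) 0 s s0.
- by move=> t; rewrite in_itv /= => /andP[t0 ts]; apply: da; rewrite !ltW.
- apply: derivable_within_continuous => t; rewrite in_itv /= => ts.
  by have [] := da t ts.
move=> c; rewrite in_itv /= => /andP[c0 cs].
have cs' : 0 <= c <= s by rewrite !ltW.
rewrite /a scale0r !addr0 subr0 => E.
have -> : f (x + s *: u + s *: v) - f (x + s *: u) - f (x + s *: v) + f x =
   ('D_u f (x + s *: v + c *: u) - 'D_u f (x + c *: u)) * s.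
  by rewrite -E [x + s *: u + s *: v]addrAC; ring.
set G := fun y => 'D_u f y.
have H1 := Hd (c *: u + s *: v) (lt_le_trans (small _ _ cs' ss) _).
have H2 := Hd (c *: u + 0 *: v) (lt_le_trans (small _ _ cs' z0) _).
have dd : d <= d0 by rewrite ge_min lexx orbT.
have {}H1 := H1 dd; have {}H2 := H2 dd.
rewrite scale0r addr0 in H2.
rewrite derive_dirD// !derive_dirZ// -!/(G _) in H1 H2 *.
rewrite -[x + s *: v + c *: u]addrA [s *: v + c *: u]addrC.
set p := G _ in H1 *; set q := G (x + c *: u) in H2 *.
set Gu := 'D_u G x in H1 H2; set Gv := 'D_v G x in H1 *; set g0 := G x in H1 H2.
rewrite -[c *: Gu]/(c * Gu) -?[s *: Gv]/(s * Gv) in H1 H2.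
have -> : (p - q) * s - s ^+ 2 * Gv =
   s * ((p - g0 - (c * Gu + s * Gv)) - (q - g0 - c * Gu)) by ring.
rewrite normrM (ger0_norm (ltW s0)).
have -> : e * (2 * `|u| + `|v|) * s ^+ 2 = s * (e * (s * `|u| + s * `|v|) + e * (s * `|u|)) by ring.
rewrite ler_wpM2l// ?(ltW s0)//.
apply: le_trans (ler_normB _ _) _; apply: lerD.
  apply: le_trans H1 _; rewrite ler_wpM2l// ?(ltW e0)//.
  apply: le_trans (ler_normD _ _) _; rewrite !normrZ !ger0_norm ?(ltW s0) ?(ltW c0)//.
  by rewrite lerD2r ler_wpM2r// ltW.
apply: le_trans H2 _; rewrite ler_wpM2l// ?(ltW e0)// normrZ ger0_norm ?(ltW c0)//.
by rewrite ler_wpM2r// ltW.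
Qed.

(** The second difference is symmetric in [u] and [v], so both mixed derivatives approximate the
    same number up to an arbitrarily small multiple of s^2. *)
Lemma derive_swap f U x u v : open U -> U x -> Ck 1 U f ->
  'D_v (fun y => 'D_u f y) x = 'D_u (fun y => 'D_v f y) x.
Proof.
move=> oU Ux fC; apply/eqP; rewrite -subr_eq0 -normr_le0; apply/ler_addgt0Pr => e e0.
(* The two error coefficients 2|u| + |v| and 2|v| + |u| add up to 3(|u| + |v|). *)
rewrite add0r; pose M := 3 * (`|u| + `|v|) + 1.
have M0 : 0 < M by rewrite ltr_wpDl// mulr_ge0// addr_ge0.
have eM : 0 < e / M by rewrite divr_gt0.
have [d1 d10 H1] := second_difference u v oU Ux fC eM.
have [d2 d20 H2] := second_difference v u oU Ux fC eM.
pose s := Num.min d1 d2 / 2.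
have m0 : 0 < Num.min d1 d2 by rewrite lt_min d10.
have s0 : 0 < s by rewrite divr_gt0.
have sm : s < Num.min d1 d2 by rewrite ltr_pdivrMr// ltr_pMr// ltr1n.
have {}H1 := H1 s; have {}H2 := H2 s.
have := sm; rewrite lt_min => /andP[sd1 sd2].
rewrite s0 sd1 in H1; rewrite s0 sd2 in H2.
have {}H1 := H1 isT; have {}H2 := H2 isT.
rewrite [x + s *: v + s *: u]addrAC in H2.
set A := 'D_v _ x in H1 *; set B := 'D_u _ x in H2 *.
set p := f _ in H1 H2; set q := f (x + s *: u) in H1 H2; set r := f (x + s *: v) in H1 H2.
have s20 : 0 < s ^+ 2 by rewrite exprn_gt0.
rewrite -(ler_pM2l s20) -[X in X * `|_|](ger0_norm (ltW s20)) -normrM.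
have -> : s ^+ 2 * (A - B) = (p - r - q + f x - s ^+ 2 * B) - (p - q - r + f x - s ^+ 2 * A) by ring.
apply: le_trans (ler_normB _ _) _; apply: le_trans (lerD H2 H1) _.
have -> : e / M * (2 * `|v| + `|u|) * s ^+ 2 + e / M * (2 * `|u| + `|v|) * s ^+ 2 =
  s ^+ 2 * (e * ((3 * (`|u| + `|v|)) / M)) by ring.
rewrite ler_wpM2l// ?(ltW s20)// ler_piMr// ?(ltW e0)//.
by rewrite ler_pdivrMr// mul1r /M lerDl.
Qed.

End Schwarz.

Lemma derive_swap_mx (R : realType) (V : normedModType R) m n (f : V -> 'M[R]_(m, n)) U x u v :
  open U -> U x -> Ck 1 U f -> 'D_v (fun y => 'D_u f y) x = 'D_u (fun y => 'D_v f y) x.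
Proof.
move=> oU Ux fC; apply/matrixP => i j.
have df w : differentiable (fun y => 'D_w f y) x.
  exact: Ck_differentiable (Ck_derive w fC) Ux.
have E w z : ('D_z (fun y => 'D_w f y) x) i j = 'D_z (fun y => 'D_w (fun t => f t i j) y) x.
  rewrite (derive_entry i j z (df w)).
  apply: (eq_derive_open z oU Ux) => y Uy.
  exact: derive_entry (Ck_differentiable fC Uy).
refine (etrans (E u v) (etrans _ (esym (E v u)))); apply: (derive_swap _ _ oU Ux).
by move/(Ck_mxP _ _ oU) : fC; exact.
Qed.

(** Equivalent to [smooth_on] by [smooth_onP], in the form suited to induction on the order. *)
Definition smooth (R : realType) (V W : normedModType R) (U : set V) (f : V -> W) :=
  forall k, Ck k U f.

(* A sealed copy of ['D_v f x]: comparing two distinct derivatives by unfolding them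
   to limits is prohibitively slow. *)
HB.lock Definition dd (R : realType) (V W : normedModType R) (v : V) (f : V -> W) (x : V) : W :=
  'D_v f x.

(** * Rules of calculus for the sealed derivative *)

Section SealedDerivative.
Variable R : realType.

Lemma ddE (V W : normedModType R) (v : V) (f : V -> W) x : 'D_v f x = dd v f x.
Proof. by rewrite dd.unlock. Qed.

Lemma dd_ext (V W : normedModType R) (f g : V -> W) (U : set V) x v :
  open U -> U x -> (forall y, U y -> f y = g y) -> dd v f x = dd v g x.
Proof. by rewrite dd.unlock; exact: eq_derive_open. Qed.

Lemma dd_dirD (V W : normedModType R) (f : V -> W) x u v : differentiable f x ->
  dd (u + v) f x = dd u f x + dd v f x.
Proof. by rewrite dd.unlock; exact: derive_dirD. Qed.

Lemma dd_dirZ (V W : normedModType R) (f : V -> W) x (a : R) u : differentiable f x ->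
  dd (a *: u) f x = a *: dd u f x.
Proof. by rewrite dd.unlock; exact: derive_dirZ. Qed.

Lemma dd_dirB (V W : normedModType R) (f : V -> W) x u v : differentiable f x ->
  dd (u - v) f x = dd u f x - dd v f x.
Proof. by move=> df; rewrite -scaleN1r dd_dirD// dd_dirZ// scaleN1r. Qed.

Lemma dd_dir_sum (V W : normedModType R) (f : V -> W) x (I : finType) (a : I -> R) (u : I -> V) :
  differentiable f x -> dd (\sum_i a i *: u i) f x = \sum_i a i *: dd (u i) f x.
Proof. by rewrite dd.unlock; exact: derive_dir_sum. Qed.

Lemma dd_dir_basis m (W : normedModType R) (f : 'rV[R]_m -> W) x u :
  differentiable f x -> dd u f x = \sum_a u 0 a *: dd (basis_vec a) f x.
Proof. by rewrite dd.unlock; exact: derive_dir_basis. Qed.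

Lemma dd_cst (V W : normedModType R) (a : W) (x v : V) : dd v (fun=> a) x = 0.
Proof. by rewrite dd.unlock derive_cst. Qed.

Lemma dd_id (V : normedModType R) (x v : V) : dd v (fun y => y) x = v.
Proof. by rewrite dd.unlock; exact: derive_id. Qed.

Lemma smooth_id (V : normedModType R) (U : set V) : smooth U (fun x : V => x).
Proof.
move=> k; apply: CkS; split=> [x _|v]; first exact: (@ex_diff _ _ _ _ _ _ id).
rewrite (_ : (fun x : V => 'D_v _ x) = fun=> v); first exact: Ck_cst.
by apply/funext => x; exact: derive_id.
Qed.

Lemma ddD (V W : normedModType R) (f g : V -> W) x v :
  differentiable f x -> differentiable g x ->
  dd v (fun y => f y + g y) x = dd v f x + dd v g x.
Proof. by move=> df dg; rewrite dd.unlock -deriveD; [|exact: diff_derivable..]. Qed.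

Lemma ddB (V W : normedModType R) (f g : V -> W) x v :
  differentiable f x -> differentiable g x ->
  dd v (fun y => f y - g y) x = dd v f x - dd v g x.
Proof. by move=> df dg; rewrite dd.unlock -deriveB; [|exact: diff_derivable..]. Qed.

Lemma dd_sum (V W : normedModType R) n (F : 'I_n -> V -> W) x v :
  (forall i, differentiable (F i) x) ->
  dd v (fun y => \sum_i F i y) x = \sum_i dd v (F i) x.
Proof. by rewrite dd.unlock; exact: derive_sum_fct. Qed.

Lemma dd_mul (V : normedModType R) (f g : V -> R) x v :
  differentiable f x -> differentiable g x ->
  dd v (fun y => f y * g y) x = dd v f x * g x + f x * dd v g x.
Proof. by rewrite dd.unlock; exact: derive_mul. Qed.

Lemma dd_scale (V : normedModType R) m n (a : V -> R) (F : V -> 'M[R]_(m, n)) x v :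
  differentiable a x -> differentiable F x ->
  dd v (fun y => a y *: F y) x = dd v a x *: F x + a x *: dd v F x.
Proof. by rewrite dd.unlock; exact: derive_scale. Qed.

Lemma dd_entry (V : normedModType R) m n (F : V -> 'M[R]_(m, n)) i j x v :
  differentiable F x -> (dd v F x) i j = dd v (fun y => F y i j) x.
Proof. by rewrite dd.unlock; exact: derive_entry. Qed.

Lemma dd_mulmx (V : normedModType R) m n p (A : V -> 'M[R]_(m, n)) (B : V -> 'M[R]_(n, p)) x v :
  differentiable A x -> differentiable B x ->
  dd v (fun y => A y *m B y) x = dd v A x *m B x + A x *m dd v B x.
Proof. by rewrite dd.unlock; exact: derive_mulmx. Qed.

Lemma dd_comp (V W X : normedModType R) (f : V -> W) (h : W -> X) x v :
  differentiable f x -> differentiable h (f x) ->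
  dd v (fun y => h (f y)) x = dd (dd v f x) h (f x).
Proof. by rewrite dd.unlock; exact: derive_comp. Qed.

Lemma dd_apply (V : normedModType R) m p q (L : V -> 'rV[R]_m -> 'M[R]_(p, q))
    (X : V -> 'rV[R]_m) (U : set V) x v :
  open U -> (forall y, U y -> linear (L y)) -> U x ->
  (forall a, differentiable (fun y => L y (basis_vec a)) x) -> differentiable X x ->
  dd v (fun y => L y (X y)) x = dd v (fun y => L y (X x)) x + L x (dd v X x).
Proof. by rewrite dd.unlock => oU Ll Ux dL dX; exact: (derive_apply oU Ll v Ux dL dX). Qed.

Lemma dd_swap (V : normedModType R) m n (f : V -> 'M[R]_(m, n)) U x u v :
  open U -> U x -> smooth U f -> dd v (dd u f) x = dd u (dd v f) x.
Proof. by rewrite dd.unlock => oU Ux fs; exact: derive_swap_mx oU Ux (fs 1%N). Qed.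

Lemma dd_swap_scalar (V : normedModType R) (f : V -> R) U x u v :
  open U -> U x -> smooth U f -> dd v (dd u f) x = dd u (dd v f) x.
Proof. by rewrite dd.unlock => oU Ux fs; exact: derive_swap oU Ux (fs 1%N). Qed.

End SealedDerivative.

Section SmoothClosure.
Variables (R : realType) (V W : normedModType R) (U : set V).
Hypothesis oU : open U.

Lemma smooth_diff (f : V -> W) x : smooth U f -> U x -> differentiable f x.
Proof. by move=> fs; exact: Ck_differentiable (fs 0%N). Qed.

Lemma smooth_dd (f : V -> W) v : smooth U f -> smooth U (dd v f).
Proof. by rewrite dd.unlock => fs k; exact: Ck_derive (fs k.+1). Qed.

Lemma smoothD (f g : V -> W) : smooth U f -> smooth U g -> smooth U (fun x => f x + g x).
Proof. by move=> fs gs k; exact: CkD. Qed.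

Lemma smooth_cst (a : W) : smooth U (fun=> a).
Proof. by move=> k; exact: Ck_cst. Qed.

Lemma smooth_ext (f g : V -> W) : (forall x, U x -> f x = g x) -> smooth U f -> smooth U g.
Proof. by move=> fg fs k; exact: Ck_ext (fs k). Qed.

End SmoothClosure.

(* A sealed copy of [bil]: unification must not unfold it. *)
HB.lock Definition iprod (R : realType) (m : nat) (G : 'M[R]_m) (u v : 'rV[R]_m) : R :=
  bil G u v.

(** * Bilinear forms given by matrices *)

Section Bil.
Variables (R : realType) (m : nat).
Implicit Types (G : 'M[R]_m) (u v w : 'rV[R]_m) (a : R).

Lemma ipDl G u v w : iprod G (u + v) w = iprod G u w + iprod G v w.
Proof. by rewrite iprod.unlock /bil !mulmxDl mxE. Qed.
Lemma ipDr G u v w : iprod G u (v + w) = iprod G u v + iprod G u w.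
Proof. by rewrite iprod.unlock /bil linearD mulmxDr mxE. Qed.
Lemma ipZl G a u v : iprod G (a *: u) v = a * iprod G u v.
Proof. by rewrite iprod.unlock /bil -!scalemxAl mxE. Qed.
Lemma ipZr G a u v : iprod G u (a *: v) = a * iprod G u v.
Proof. by rewrite iprod.unlock /bil linearZ -scalemxAr mxE. Qed.
Lemma ip0l G u : iprod G 0 u = 0.
Proof. by rewrite -(scale0r 0) ipZl mul0r. Qed.
Lemma ip0r G u : iprod G u 0 = 0.
Proof. by rewrite -(scale0r 0) ipZr mul0r. Qed.
Lemma ipNl G u v : iprod G (- u) v = - iprod G u v.
Proof. by rewrite -scaleN1r ipZl mulN1r. Qed.
Lemma ipNr G u v : iprod G u (- v) = - iprod G u v.
Proof. by rewrite -scaleN1r ipZr mulN1r. Qed.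
Lemma ipBl G u v w : iprod G (u - v) w = iprod G u w - iprod G v w.
Proof. by rewrite ipDl ipNl. Qed.
Lemma ipBr G u v w : iprod G u (v - w) = iprod G u v - iprod G u w.
Proof. by rewrite ipDr ipNr. Qed.
Lemma ip_suml G (I : finType) (F : I -> 'rV[R]_m) v :
  iprod G (\sum_i F i) v = \sum_i iprod G (F i) v.
Proof. by elim/big_rec2: _ => [|i y1 y2 _ <-]; rewrite ?ip0l ?ipDl. Qed.
Lemma ip_sumr G (I : finType) (F : I -> 'rV[R]_m) v :
  iprod G v (\sum_i F i) = \sum_i iprod G v (F i).
Proof. by elim/big_rec2: _ => [|i y1 y2 _ <-]; rewrite ?ip0r ?ipDr. Qed.
Lemma ip_mxD G G' u v : iprod (G + G') u v = iprod G u v + iprod G' u v.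
Proof. by rewrite iprod.unlock /bil mulmxDr mulmxDl mxE. Qed.
Lemma ip_mxZ a G u v : iprod (a *: G) u v = a * iprod G u v.
Proof. by rewrite iprod.unlock /bil -scalemxAr -scalemxAl mxE. Qed.
Lemma ip_trmx G u v : iprod G^T u v = iprod G v u.
Proof.
rewrite iprod.unlock /bil -[in RHS](trmxK (v *m G *m u^T)) [RHS]mxE.
by rewrite !trmx_mul trmxK mulmxA.
Qed.
Lemma ipC G u v : G^T = G -> iprod G u v = iprod G v u.
Proof. by move=> {1}<-; rewrite ip_trmx. Qed.
Lemma ip_mulmx_invmx G u w : G \in unitmx -> iprod G (u *m invmx G) w = \sum_a u 0 a * w 0 a.
Proof.
move=> Gu; rewrite iprod.unlock /bil mulmxKV// mxE; apply: eq_bigr => a _.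
by rewrite [w^T _ _]mxE.
Qed.
Lemma ip_inj G u v : G \in unitmx -> (forall w, iprod G u w = iprod G v w) -> u = v.
Proof.
move=> Gu H; rewrite -(mulmxK Gu u) -(mulmxK Gu v); congr (_ *m _).
apply/rowP => a; have := H (basis_vec a); rewrite iprod.unlock /bil /basis_vec.
by rewrite trmx_delta -!colE !mxE.
Qed.
Lemma ip_sum_basis G u v : iprod G u v = \sum_a v 0 a * iprod G u (basis_vec a).
Proof. by rewrite {1}(row_sum_basis v) ip_sumr; under eq_bigr do rewrite ipZr. Qed.
Lemma ip_sum2 G u v : iprod G u v = \sum_a \sum_b u 0 a * G a b * v 0 b.
Proof.
rewrite iprod.unlock /bil mxE exchange_big; apply: eq_bigr => b _; rewrite !mxE big_distrl /=.
by [].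
Qed.
End Bil.

Section BilDerive.
Variables (R : realType) (V : normedModType R) (m : nat).

Lemma smooth_ip (G : V -> 'M[R]_m) (X Y : V -> 'rV[R]_m) U : open U ->
  smooth U G -> smooth U X -> smooth U Y -> smooth U (fun y => iprod (G y) (X y) (Y y)).
Proof.
move=> oU Gs Xs Ys k; have H := Ck_mulmx oU
  (Ck_mulmx oU (Xs k) (Gs k)) (Ck_trmx oU (Ys k)).
rewrite iprod.unlock; exact: ((Ck_mxP k (fun y => X y *m G y *m (Y y)^T) oU).1 H 0 0).
Qed.

Lemma dd_ip (G : V -> 'M[R]_m) (X Y : V -> 'rV[R]_m) x v :
  differentiable G x -> differentiable X x -> differentiable Y x ->
  dd v (fun y => iprod (G y) (X y) (Y y)) x =
  iprod (dd v G x) (X x) (Y x) + iprod (G x) (dd v X x) (Y x) + iprod (G x) (X x) (dd v Y x).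
Proof.
move=> dG dX dY; rewrite dd.unlock.
have dYT : differentiable (fun y => (Y y)^T) x.
  apply/differentiable_mxP => i j; under eq_fun do rewrite mxE.
  exact: differentiable_entry.
have DYT : 'D_v (fun y => (Y y)^T) x = ('D_v Y x)^T.
  apply/matrixP => i j; rewrite (derive_entry _ _ _ dYT) mxE (derive_entry _ _ _ dY).
  by congr ('D_v _ x); apply/funext => y; rewrite mxE.
rewrite iprod.unlock -(derive_entry 0 0 v (differentiable_mulmx (differentiable_mulmx dX dG) dYT)).
rewrite (derive_mulmx _ (differentiable_mulmx dX dG) dYT) (derive_mulmx _ dX dG) DYT.
by rewrite /bil mulmxDl !mxE [X in _ = X + _]addrC.
Qed.
End BilDerive.

(** * Tensor fields evaluated along a map at moving arguments *)

Section Families.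
Variables (R : realType) (V : normedModType R) (m p q r s t : nat).
Variables (U : set V) (U' : set 'rV[R]_m) (f : V -> 'rV[R]_m).
Hypotheses (oU : open U) (oU' : open U') (UU : forall x, U x -> U' (f x)) (fs : smooth U f).

Lemma smooth_comp_mx (h : 'rV[R]_m -> 'M[R]_(s, t)) :
  smooth U' h -> smooth U (fun x => h (f x)).
Proof. by move=> hs k; exact: (Ck_comp_mx oU oU' UU (fs k) (hs k)). Qed.

Section Two.
Variable T : 'rV[R]_m -> 'rV[R]_p -> 'rV[R]_q -> 'M[R]_(s, t).
Hypothesis T1 : forall y, U' y -> forall b, linear (fun a => T y a b).
Hypothesis T2 : forall y, U' y -> forall a, linear (T y a).
Hypothesis Ts : forall a b, smooth U' (fun y => T y a b).
Variables (X : V -> 'rV[R]_p) (Y : V -> 'rV[R]_q).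
Hypotheses (Xs : smooth U X) (Ys : smooth U Y).

Lemma smooth_family2r a : smooth U (fun y => T (f y) a (Y y)).
Proof.
move=> k; apply: (@Ck_apply _ _ _ _ _ (fun y b => T (f y) a b) _ _ oU) => //.
  by move=> y /UU Uy; exact: T2.
by move=> b; exact: (smooth_comp_mx (Ts a (basis_vec b)) k).
Qed.

Lemma smooth_family2 : smooth U (fun y => T (f y) (X y) (Y y)).
Proof.
move=> k; apply: (@Ck_apply _ _ _ _ _ (fun y a => T (f y) a (Y y)) _ _ oU) => //.
  by move=> y /UU Uy; exact: T1.
by move=> a; exact: (smooth_family2r (basis_vec a) k).
Qed.

(** Chain rule in the base point plus the Leibniz rule in each slot. Christoffel symbols are
    differentiated along a map in this way, and curvature through the version with three slots. *)
Lemma dd_family2 x v : U x ->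
  dd v (fun y => T (f y) (X y) (Y y)) x =
  dd (dd v f x) (fun z => T z (X x) (Y x)) (f x)
  + T (f x) (dd v X x) (Y x) + T (f x) (X x) (dd v Y x).
Proof.
rewrite dd.unlock => Ux; have dX := smooth_diff Xs Ux; have dY := smooth_diff Ys Ux.
have df := smooth_diff fs Ux.
rewrite (@derive_apply _ _ _ _ _ (fun y a => T (f y) a (Y y)) X U)//; last 2 first.
- by move=> y /UU Uy; exact: T1.
- by move=> a; exact: (smooth_diff (smooth_family2r (basis_vec a)) Ux).
rewrite (@derive_apply _ _ _ _ _ (fun y b => T (f y) (X x) b) Y U)//; last 2 first.
- by move=> y /UU Uy; exact: T2.
- by move=> b; exact: (smooth_diff (smooth_comp_mx (Ts (X x) (basis_vec b))) Ux).
have dT : differentiable (fun z => T z (X x) (Y x)) (f x).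
  exact: (smooth_diff (Ts (X x) (Y x)) (UU Ux)).
by rewrite (derive_comp v df dT) addrAC.
Qed.
End Two.
End Families.

Section Families3.
Variables (R : realType) (V : normedModType R) (m p q r s t : nat).
Variables (U : set V) (U' : set 'rV[R]_m) (f : V -> 'rV[R]_m).
Hypotheses (oU : open U) (oU' : open U') (UU : forall x, U x -> U' (f x)) (fs : smooth U f).
Variable T : 'rV[R]_m -> 'rV[R]_p -> 'rV[R]_q -> 'rV[R]_r -> 'M[R]_(s, t).
Hypothesis T1 : forall y, U' y -> forall b c, linear (fun a => T y a b c).
Hypothesis T2 : forall y, U' y -> forall a c, linear (fun b => T y a b c).
Hypothesis T3 : forall y, U' y -> forall a b, linear (T y a b).
Hypothesis Ts : forall a b c, smooth U' (fun y => T y a b c).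
Variables (X : V -> 'rV[R]_p) (Y : V -> 'rV[R]_q) (Z : V -> 'rV[R]_r).
Hypotheses (Xs : smooth U X) (Ys : smooth U Y) (Zs : smooth U Z).

Lemma smooth_family3r a : smooth U (fun y => T (f y) a (Y y) (Z y)).
Proof.
exact: (smooth_family2 (T := fun y => T y a) oU oU' UU fs (fun y Uy => @T2 y Uy a)
  (fun y Uy => @T3 y Uy a) (Ts a) Ys Zs).
Qed.

Lemma smooth_family3 : smooth U (fun y => T (f y) (X y) (Y y) (Z y)).
Proof.
move=> k; apply: (@Ck_apply _ _ _ _ _ (fun y a => T (f y) a (Y y) (Z y)) _ _ oU) => //.
  by move=> y /UU Uy; exact: T1.
by move=> a; exact: (smooth_family3r (basis_vec a) k).
Qed.

Lemma dd_family3 x v : U x ->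
  dd v (fun y => T (f y) (X y) (Y y) (Z y)) x =
  dd (dd v f x) (fun z => T z (X x) (Y x) (Z x)) (f x)
  + T (f x) (dd v X x) (Y x) (Z x) + T (f x) (X x) (dd v Y x) (Z x)
  + T (f x) (X x) (Y x) (dd v Z x).
Proof.
move=> Ux; have dX := smooth_diff Xs Ux.
rewrite (@dd_apply _ _ _ _ _ (fun y a => T (f y) a (Y y) (Z y)) X U)//; last 2 first.
- by move=> y /UU Uy; exact: T1.
- by move=> a; exact: (smooth_diff (smooth_family3r (basis_vec a)) Ux).
rewrite (dd_family2 (T := fun y => T y (X x)) oU oU' UU fs (fun y Uy => @T2 y Uy (X x))
  (fun y Uy => @T3 y Uy (X x)) (Ts (X x)) Ys Zs v Ux).
by rewrite addrAC [X in X + _]addrAC.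
Qed.
End Families3.

(** * Levi-Civita connection and curvature *)

Definition metric_on (R : realType) (m : nat) (V : set 'rV[R]_m) (g : 'rV[R]_m -> 'M[R]_m) :=
  [/\ open V, smooth V g, forall y, V y -> (g y)^T = g y &
      forall y, V y -> g y \in unitmx].

HB.lock Definition chr (R : realType) (m : nat) (g : 'rV[R]_m -> 'M[R]_m) (x u v : 'rV[R]_m) :=
  christoffel g x u v.

Section Christoffel.
Variables (R : realType) (m : nat) (V : set 'rV[R]_m) (g : 'rV[R]_m -> 'M[R]_m).
Hypothesis gm : metric_on V g.
Implicit Types (x y u v w z : 'rV[R]_m) (a : R).
Let oV : open V. Proof. by case: gm. Qed.
Let gs : smooth V g. Proof. by case: gm. Qed.
Let gsym y : V y -> (g y)^T = g y. Proof. by case: gm => _ _ + _; apply. Qed.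
Let gu y : V y -> g y \in unitmx. Proof. by case: gm => _ _ _; apply. Qed.
Let gd y : V y -> differentiable g y. Proof. exact: smooth_diff. Qed.

Lemma dd_metric_sym x u : V x -> (dd u g x)^T = dd u g x.
Proof.
move=> Vx; apply/matrixP => i j.
rewrite mxE (dd_entry j i u (gd Vx)) (dd_entry i j u (gd Vx)).
apply: (dd_ext u oV Vx) => y /gsym E.
by rewrite -[in LHS]E mxE.
Qed.

Lemma chrE x u v : chr g x u v =
  (2^-1 *: \row_a (iprod (dd u g x) v (basis_vec a) + iprod (dd v g x) u (basis_vec a)
     - iprod (dd (basis_vec a) g x) u v)) *m invmx (g x).
Proof. by rewrite chr.unlock iprod.unlock dd.unlock. Qed.

(** Koszul's formula. As [g x] is nondegenerate it determines [chr], and the symmetry and linearity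
    below are read off from it through [ip_inj]. *)
Lemma chr_ip x u v w : V x ->
  iprod (g x) (chr g x u v) w =
  2^-1 * (iprod (dd u g x) v w + iprod (dd v g x) u w - iprod (dd w g x) u v).
Proof.
move=> Vx; rewrite chrE -scalemxAl ipZl ip_mulmx_invmx; last exact: gu.
congr (_ * _); under eq_bigr do rewrite mxE.
rewrite (ip_sum_basis (dd u g x) v w).
rewrite (ip_sum_basis (dd v g x) u w).
have Dw := dd_dir_basis w (gd Vx).
rewrite Dw.
have -> : iprod (\sum_a w 0 a *: dd (basis_vec a) g x) u v =
    \sum_a w 0 a * iprod (dd (basis_vec a) g x) u v.
  elim/big_rec2: _ => [|i y1 y2 _ <-]; last by rewrite ip_mxD ip_mxZ.
  by rewrite -(scale0r 0) ip_mxZ mul0r.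
rewrite -big_split /= -sumrB.
apply: eq_bigr => a _.
by ring.
Qed.

Lemma chr_sym x u v : V x -> chr g x u v = chr g x v u.
Proof.
move=> Vx; apply: (ip_inj (gu Vx)) => w; rewrite !chr_ip//.
by rewrite [X in _ - X](ipC _ _ (dd_metric_sym w Vx)); ring.
Qed.

Lemma chr_linr x u : V x -> linear (chr g x u).
Proof.
move=> Vx a v w; apply: (ip_inj (gu Vx)) => z.
rewrite ipDl ipZl !chr_ip// !ipDl !ipDr !ipZl !ipZr.
rewrite dd_dirD ?dd_dirZ; [|exact: gd|exact: gd].
by rewrite ip_mxD ip_mxZ; ring.
Qed.

Lemma chr_linl x v : V x -> linear (chr g x ^~ v).
Proof.
move=> Vx a u w; rewrite (chr_sym (a *: u + w) v Vx) chr_linr//.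
by rewrite (chr_sym v u Vx) (chr_sym v w Vx).
Qed.

Lemma chrDr x u v w : V x ->
  chr g x u (v + w) = chr g x u v + chr g x u w.
Proof. by move=> Vx; have := chr_linr u Vx 1 v w; rewrite !scale1r. Qed.
Lemma chrDl x u v w : V x ->
  chr g x (u + v) w = chr g x u w + chr g x v w.
Proof. by move=> Vx; have := chr_linl w Vx 1 u v; rewrite !scale1r. Qed.
Lemma chr0l x v : V x -> chr g x 0 v = 0.
Proof.
move=> Vx; apply: (addrI (chr g x 0 v)).
by rewrite -chrDl// !addr0.
Qed.
Lemma chrZr x a u v : V x ->
  chr g x u (a *: v) = a *: chr g x u v.
Proof.
move=> Vx; have := chr_linr u Vx a v 0; rewrite !addr0 => ->.
by rewrite (chr_sym u 0 Vx) chr0l// addr0.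
Qed.
Lemma chrZl x a u v : V x ->
  chr g x (a *: u) v = a *: chr g x u v.
Proof. by move=> Vx; rewrite chr_sym// chrZr// chr_sym. Qed.
Lemma chrBl x u v w : V x ->
  chr g x (u - v) w = chr g x u w - chr g x v w.
Proof. by move=> Vx; rewrite chrDl// -scaleN1r chrZl// scaleN1r. Qed.

(** Metric compatibility: in the sum of the two Koszul formulas the derivatives of [g] in the
    directions [v] and [w] cancel. *)
Lemma chr_compat x u v w : V x ->
  iprod (dd u g x) v w =
  iprod (g x) (chr g x u v) w + iprod (g x) v (chr g x u w).
Proof.
move=> Vx; rewrite (ipC v _ (gsym Vx)) !chr_ip//.
rewrite (ipC w v (dd_metric_sym u Vx)).
by field.
Qed.

Lemma smooth_chr u v : smooth V (fun y => chr g y u v).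
Proof.
move=> k; under eq_fun do rewrite chrE; apply: Ck_mulmx => //; last exact: Ck_invmx.
apply: CkZ => //; apply/Ck_mxP => // i j; under eq_fun do rewrite mxE.
have H w b c : Ck k V (fun y => iprod (dd w g y) b c).
  by apply: (smooth_ip oV); [exact: smooth_dd|exact: smooth_cst|exact: smooth_cst].
apply: CkD => //; first exact: CkD.
under eq_fun do rewrite -scaleN1r; exact: CkZ.
Qed.

End Christoffel.

HB.lock Definition Rm (R : realType) (m : nat) (g : 'rV[R]_m -> 'M[R]_m) (x u v w : 'rV[R]_m) :=
  curv g x u v w.
HB.lock Definition dRm (R : realType) (m : nat) (g : 'rV[R]_m -> 'M[R]_m) (x z u v w : 'rV[R]_m) :=
  nabla_curv g x z u v w.

Section Curvature.
Variables (R : realType) (m : nat) (V : set 'rV[R]_m) (g : 'rV[R]_m -> 'M[R]_m).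
Hypothesis gm : metric_on V g.
Implicit Types (x y u v w z : 'rV[R]_m) (a : R) (X Y Z : 'rV[R]_m -> 'rV[R]_m).
Let oV : open V. Proof. by case: gm. Qed.
Let chrs u v : smooth V (fun y => chr g y u v). Proof. exact: smooth_chr. Qed.
Let chrd x u v : V x -> differentiable (fun y => chr g y u v) x.
Proof. exact: smooth_diff. Qed.
Let idV x : V x -> V (id x). Proof. by []. Qed.
Let ids := smooth_id V.

Lemma nablaE X Y x : nabla g X Y x = dd (X x) Y x + chr g x (X x) (Y x).
Proof. by rewrite dd.unlock chr.unlock. Qed.

Lemma smooth_chr_fields X Y : smooth V X -> smooth V Y ->
  smooth V (fun y => chr g y (X y) (Y y)).
Proof.
move=> Xs Ys.
exact: (smooth_family2 (T := chr g) oV oV idV ids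
  (fun y Vy b => chr_linl gm b Vy) (fun y Vy b => chr_linr gm b Vy) chrs Xs Ys).
Qed.

Lemma dd_chr_fields X Y x v : smooth V X -> smooth V Y -> V x ->
  dd v (fun y => chr g y (X y) (Y y)) x =
  dd v (fun y => chr g y (X x) (Y x)) x + chr g x (dd v X x) (Y x)
  + chr g x (X x) (dd v Y x).
Proof.
move=> Xs Ys Vx; rewrite (dd_family2 (T := chr g) oV oV idV ids
  (fun y Vy b => chr_linl gm b Vy) (fun y Vy b => chr_linr gm b Vy) chrs Xs Ys v Vx).
by rewrite dd_id.
Qed.

Lemma smooth_dd_fields X Y : smooth V X -> smooth V Y ->
  smooth V (fun y => dd (X y) Y y).
Proof.
move=> Xs Ys k; apply: (@Ck_apply _ _ _ _ _ (fun y b => dd b Y y) X V oV) => //.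
  move=> y Vy c u w; have dY := smooth_diff Ys Vy.
  by rewrite dd_dirD// dd_dirZ.
by move=> a; exact: (smooth_dd (basis_vec a) Ys).
Qed.

Lemma dd_dd_fields X Y x v : smooth V X -> smooth V Y -> V x ->
  dd v (fun y => dd (X y) Y y) x = dd v (dd (X x) Y) x + dd (dd v X x) Y x.
Proof.
move=> Xs Ys Vx; rewrite (@dd_apply _ _ _ _ _ (fun y b => dd b Y y) X V)//.
- move=> y Vy c u w; have dY := smooth_diff Ys Vy.
  by rewrite dd_dirD// dd_dirZ.
- by move=> a; apply: smooth_diff Vx; exact: smooth_dd.
- exact: smooth_diff Vx.
Qed.

Lemma nabla_nabla X Y Z x : smooth V X -> smooth V Y -> smooth V Z -> V x ->
  nabla g X (nabla g Y Z) x =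
  dd (X x) (dd (Y x) Z) x + dd (dd (X x) Y x) Z x
  + (dd (X x) (fun y => chr g y (Y x) (Z x)) x + chr g x (dd (X x) Y x) (Z x)
     + chr g x (Y x) (dd (X x) Z x))
  + (chr g x (X x) (dd (Y x) Z x) + chr g x (X x) (chr g x (Y x) (Z x))).
Proof.
move=> Xs Ys Zs Vx; rewrite nablaE nablaE -(chrDr gm)//.
have -> : dd (X x) (nabla g Y Z) x =
    dd (X x) (fun y => dd (Y y) Z y + chr g y (Y y) (Z y)) x.
  by congr (dd _ _ _); apply/funext => y; rewrite nablaE.
rewrite (chrDr gm)// ddD; last 2 first.
- exact: smooth_diff (smooth_dd_fields Ys Zs) Vx.
- exact: smooth_diff (smooth_chr_fields Ys Zs) Vx.
by rewrite (dd_dd_fields (X x) Ys Zs Vx) (dd_chr_fields (X x) Ys Zs Vx).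
Qed.

(** The classical coordinate formula of the curvature tensor, derivatives of Christoffel symbols
    plus their quadratic terms, on vectors instead of indices. *)
Definition riem_expr x u v w := dd u (fun y => chr g y v w) x - dd v (fun y => chr g y u w) x
  + chr g x u (chr g x v w) - chr g x v (chr g x u w).

(** Tensoriality: second derivatives of [Z] commute, the bracket absorbs the derivatives of [X] and
    [Y], and the first derivatives of [Z] cancel in pairs. *)
Lemma curv_field_expr X Y Z x : smooth V X -> smooth V Y -> smooth V Z -> V x ->
  curv_field g X Y Z x = riem_expr x (X x) (Y x) (Z x).
Proof.
move=> Xs Ys Zs Vx; rewrite /curv_field !nabla_nabla// nablaE /lie_bracket !ddE.
have dZ := smooth_diff Zs Vx.
rewrite dd_dirB// (chrBl gm)//.
rewrite (dd_swap (X x) (Y x) oV Vx Zs) /riem_expr.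
set p := dd (Y x) _ x; set q := dd (dd (X x) Y x) Z x; set r := dd (dd (Y x) X x) Z x.
move: (dd (X x) _ x) (chr g x (dd (X x) Y x) _) (chr g x (Y x) (dd _ _ _)) => A1 A2 A3.
move: (chr g x (X x) (dd _ _ _)) (chr g x (X x) (chr _ _ _ _)) => A4 A5.
apply/rowP => i; rewrite !mxE; ring.
Qed.

Lemma RmE x u v w : V x -> Rm g x u v w = riem_expr x u v w.
Proof.
by move=> Vx; rewrite Rm.unlock /curv curv_field_expr//; exact: smooth_cst.
Qed.

Lemma curv_fieldE X Y Z x : smooth V X -> smooth V Y -> smooth V Z -> V x ->
  curv_field g X Y Z x = Rm g x (X x) (Y x) (Z x).
Proof. by move=> *; rewrite RmE// curv_field_expr. Qed.

Lemma Rm_anti x u v w : V x -> Rm g x u v w = - Rm g x v u w.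
Proof.
move=> Vx; rewrite !RmE// /riem_expr.
by apply/rowP => i; rewrite !mxE; ring.
Qed.

Let dd_chr_lin1 x z v w a u : V x ->
  dd z (fun y => chr g y (a *: u + v) w) x =
  a *: dd z (fun y => chr g y u w) x + dd z (fun y => chr g y v w) x.
Proof.
move=> Vx.
rewrite (@dd_ext _ _ _ _ (fun y => a *: chr g y u w + chr g y v w) V)//; last first.
  by move=> y Vy; rewrite (chr_linl gm).
rewrite ddD; [|exact/differentiableZ/chrd|exact: chrd].
by congr (_ + _); rewrite dd.unlock (@deriveZ _ _ _ (fun y => chr g y u w))//; exact/diff_derivable/chrd.
Qed.

Let dd_chr_lin2 x z v w a u : V x ->
  dd z (fun y => chr g y w (a *: u + v)) x =
  a *: dd z (fun y => chr g y w u) x + dd z (fun y => chr g y w v) x.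
Proof.
move=> Vx.
have E b c : dd z (fun y => chr g y b c) x = dd z (fun y => chr g y c b) x.
  by apply: (dd_ext _ oV) => // y Vy; rewrite (chr_sym gm).
by rewrite (E w (a *: u + v)) dd_chr_lin1// (E w u) (E w v).
Qed.

Lemma Rm_lin3 x u v : V x -> linear (Rm g x u v).
Proof.
move=> Vx a w z; rewrite !RmE// /riem_expr.
rewrite !dd_chr_lin2// !(chrDr gm)// !(chrZr gm)//.
set A1 := dd _ _ _; set A2 := dd _ _ _; set A3 := dd _ _ _; set A4 := dd _ _ _.
set B1 := chr _ _ _ _; set B2 := chr _ _ _ _; set B3 := chr _ _ _ _; set B4 := chr _ _ _ _.
by apply/rowP => i; rewrite !mxE; ring.
Qed.

Lemma Rm_lin1 x v w : V x -> linear (fun u => Rm g x u v w).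
Proof.
move=> Vx a u z; rewrite !RmE// /riem_expr.
rewrite dd_chr_lin1// !(chrDl gm)// !(chrZl gm)// !(chrDr gm)// !(chrZr gm)//.
have dc := chrd v w Vx; rewrite dd_dirD// dd_dirZ//.
set A1 := dd _ _ _; set A2 := dd _ _ _; set A3 := dd _ _ _; set A4 := dd _ _ _.
set B1 := chr _ _ _ _; set B2 := chr _ _ _ _; set B3 := chr _ _ _ _; set B4 := chr _ _ _ _.
by apply/rowP => i; rewrite !mxE; ring.
Qed.

Lemma Rm_lin2 x u w : V x -> linear (fun v => Rm g x u v w).
Proof.
move=> Vx a v z; rewrite (Rm_anti u (a *: v + z) w Vx) Rm_lin1//.
by rewrite (Rm_anti u v w Vx) (Rm_anti u z w Vx) opprD scalerN.
Qed.

Lemma smooth_Rm u v w : smooth V (fun y => Rm g y u v w).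
Proof.
apply: (@smooth_ext _ _ _ _ oV (fun y => riem_expr y u v w)).
  by move=> y Vy; rewrite RmE.
have sN (F : 'rV[R]_m -> 'rV[R]_m) : smooth V F -> smooth V (fun y => - F y).
  by move=> Fs k; under eq_fun do rewrite -scaleN1r; exact: CkZ.
rewrite /riem_expr; apply: (smoothD oV); last first.
  by apply: sN; apply: smooth_chr_fields => //; exact: smooth_cst.
apply: (smoothD oV); last by apply: smooth_chr_fields => //; exact: smooth_cst.
by apply: (smoothD oV); [|apply: sN]; exact: smooth_dd.
Qed.

(** On constant fields [nabla] reduces to a Christoffel symbol, and tensoriality turns the curvature
    of the resulting nonconstant fields into [Rm] at their values. *)
Lemma dRmE x z u v w : V x -> dRm g x z u v w =
  dd z (fun y => Rm g y u v w) x + chr g x z (Rm g x u v w)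
  - Rm g x (chr g x z u) v w - Rm g x u (chr g x z v) w - Rm g x u v (chr g x z w).
Proof.
move=> Vx; rewrite dRm.unlock /nabla_curv /nabla_curv_field.
have cs c : smooth V (cst c : 'rV[R]_m -> 'rV[R]_m) by exact: smooth_cst.
have nE c : nabla g (cst z) (cst c) = fun y => chr g y z c.
  by apply/funext => y; rewrite nablaE dd_cst add0r.
rewrite !nE !curv_fieldE//.
have E : dd z (curv_field g (cst u) (cst v) (cst w)) x = dd z (fun y => Rm g y u v w) x.
  by apply: (dd_ext _ oV) => // y Vy; rewrite curv_fieldE.
by rewrite nablaE curv_fieldE// E.
Qed.

(** In the coordinate formula the cyclic sum cancels term by term by the symmetry of the Christoffel
    symbols. *)
Lemma bianchi x u v w : V x -> Rm g x u v w + Rm g x v w u + Rm g x w u v = 0.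
Proof.
move=> Vx; rewrite !RmE// /riem_expr.
have E z b c : dd z (fun y => chr g y b c) x = dd z (fun y => chr g y c b) x.
  by apply: (dd_ext _ oV) => // y Vy; rewrite (chr_sym gm).
rewrite (E _ w u) (E _ w v) (E _ v u) (chr_sym gm w u)// (chr_sym gm w v)// (chr_sym gm v u)//.
by apply/rowP => i; rewrite !mxE; ring.
Qed.

End Curvature.

(** * Covariant derivative along a map *)

(** The dimension of the source is arbitrary: the identity map gives the symmetries of the ambient
    curvature, an immersion the equations of the hypersurface. *)
Definition cov (R : realType) (k m : nat) (g : 'rV[R]_m -> 'M[R]_m) (f : 'rV[R]_k -> 'rV[R]_m)
    (u : 'rV[R]_k) (X : 'rV[R]_k -> 'rV[R]_m) (y : 'rV[R]_k) : 'rV[R]_m :=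
  dd u X y + chr g (f y) (dd u f y) (X y).

Section Along.
Variables (R : realType) (k m : nat) (V : set 'rV[R]_m) (g : 'rV[R]_m -> 'M[R]_m).
Hypothesis gm : metric_on V g.
Variables (U : set 'rV[R]_k) (f : 'rV[R]_k -> 'rV[R]_m).
Hypotheses (oU : open U) (fV : forall y, U y -> V (f y)) (fs : smooth U f).
Implicit Types (u v : 'rV[R]_k) (y : 'rV[R]_k) (X Y Z : 'rV[R]_k -> 'rV[R]_m).
Let oV : open V. Proof. by case: gm. Qed.
Let chrs b c : smooth V (fun z => chr g z b c). Proof. exact: smooth_chr. Qed.
Let C1 z (Vz : V z) b := chr_linl gm b Vz.
Let C2 z (Vz : V z) b := chr_linr gm b Vz.

Lemma smooth_g_along : smooth U (fun y => g (f y)).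
Proof. by apply: (smooth_comp_mx oU oV fV fs); case: gm. Qed.

Lemma smooth_chr_along X Y : smooth U X -> smooth U Y ->
  smooth U (fun y => chr g (f y) (X y) (Y y)).
Proof. exact: (smooth_family2 (T := chr g) oU oV fV fs C1 C2 chrs). Qed.

Lemma smooth_cov u X : smooth U X -> smooth U (cov g f u X).
Proof.
move=> Xs; apply: (smoothD oU); first exact: smooth_dd.
by apply: smooth_chr_along => //; exact: smooth_dd.
Qed.

Lemma dd_g_along u y : U y -> dd u (fun y => g (f y)) y = dd (dd u f y) g (f y).
Proof.
move=> Uy; apply: dd_comp; first exact: smooth_diff fs Uy.
by case: gm => _ gs _ _; exact: smooth_diff gs (fV Uy).
Qed.

Lemma dd_ip_cov u X Y y : smooth U X -> smooth U Y -> U y ->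
  dd u (fun y => iprod (g (f y)) (X y) (Y y)) y =
  iprod (g (f y)) (cov g f u X y) (Y y) + iprod (g (f y)) (X y) (cov g f u Y y).
Proof.
move=> Xs Ys Uy; rewrite dd_ip; [|exact: (smooth_diff smooth_g_along Uy)|exact: (smooth_diff Xs Uy)|exact: (smooth_diff Ys Uy)].
rewrite dd_g_along// (chr_compat gm _ _ _ (fV Uy)) /cov ipDl ipDr; ring.
Qed.

Lemma smooth_ip_along X Y : smooth U X -> smooth U Y ->
  smooth U (fun y => iprod (g (f y)) (X y) (Y y)).
Proof. by move=> Xs Ys; apply: smooth_ip => //; exact: smooth_g_along. Qed.

Lemma cov_swap u v y : U y -> cov g f u (dd v f) y = cov g f v (dd u f) y.
Proof.
move=> Uy; rewrite /cov (dd_swap _ _ oU Uy fs); congr (_ + _).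
by rewrite (chr_sym gm)//; exact: fV.
Qed.

Lemma cov_dir_sum (I : finType) (a : I -> R) (e : I -> 'rV[R]_k) X y :
  smooth U X -> U y ->
  cov g f (\sum_i a i *: e i) X y = \sum_i a i *: cov g f (e i) X y.
Proof.
move=> Xs Uy; have Vy := fV Uy.
have df := smooth_diff fs Uy; have dX := smooth_diff Xs Uy.
rewrite /cov !dd_dir_sum//; under [RHS]eq_bigr do rewrite scalerDr.
rewrite big_split /=; congr (_ + _).
elim/big_rec2: _ => [|i y1 y2 _ IH]; first by rewrite (chr0l gm).
by rewrite (chrDl gm)// (chrZl gm)// IH.
Qed.

Lemma dd_chr_along X Y u y : smooth U X -> smooth U Y -> U y ->
  dd u (fun y => chr g (f y) (X y) (Y y)) y =
  dd (dd u f y) (fun z => chr g z (X y) (Y y)) (f y) + chr g (f y) (dd u X y) (Y y)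
  + chr g (f y) (X y) (dd u Y y).
Proof.
move=> Xs Ys Uy.
exact: (dd_family2 (T := chr g) oU oV fV fs C1 C2 chrs Xs Ys).
Qed.

(** Coordinate fields commute, so no bracket appears. All terms with derivatives of [X] or second
    derivatives of [f] are symmetric in [u] and [v]; what remains is [riem_expr] at the images of
    [u] and [v]. *)
Lemma cov_curvature u v X y : smooth U X -> U y ->
  cov g f u (cov g f v X) y - cov g f v (cov g f u X) y =
  Rm g (f y) (dd u f y) (dd v f y) (X y).
Proof.
move=> Xs Uy; have Vy := fV Uy.
have E a b : cov g f a (cov g f b X) y =
    dd a (dd b X) y + (dd (dd a f y) (fun z => chr g z (dd b f y) (X y)) (f y)
      + chr g (f y) (dd a (dd b f) y) (X y) + chr g (f y) (dd b f y) (dd a X y))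
    + (chr g (f y) (dd a f y) (dd b X y)
      + chr g (f y) (dd a f y) (chr g (f y) (dd b f y) (X y))).
  have fbs := smooth_dd b fs.
  have D : dd a (cov g f b X) y = dd a (dd b X) y + dd a (fun z => chr g (f z) (dd b f z) (X z)) y.
    by apply: ddD; [exact: smooth_diff (smooth_dd b Xs) Uy|exact: smooth_diff (smooth_chr_along fbs Xs) Uy].
  by rewrite {1}/cov D (dd_chr_along _ fbs Xs Uy) /cov (chrDr gm _ _ _ Vy).
rewrite !E (dd_swap u v oU Uy Xs) (dd_swap u v oU Uy fs) (RmE gm _ _ _ Vy) /riem_expr.
move: (dd u (dd v X) y) (chr g _ (dd u (dd v f) y) _) (chr g _ _ (dd u X y)) (chr g _ _ (dd v X y)) => A1 A2 A3 A4.
move: (dd _ _ _) (dd _ _ _) (chr _ _ _ _) (chr _ _ _ _) => B1 B2 B3 B4.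
by apply/rowP => i; rewrite !mxE; ring.
Qed.

Lemma smooth_Rm_along X Y Z : smooth U X -> smooth U Y -> smooth U Z ->
  smooth U (fun y => Rm g (f y) (X y) (Y y) (Z y)).
Proof.
exact: (smooth_family3 (T := Rm g) oU oV fV fs (fun z Vy b c => Rm_lin1 gm b c Vy)
  (fun z Vy b c => Rm_lin2 gm b c Vy) (fun z Vy b c => Rm_lin3 gm b c Vy) (smooth_Rm gm)).
Qed.

(** Product rule for curvature along the map: the Christoffel terms in the definition of [dRm] are
    those that complete the derivatives of the three slots to covariant ones. *)
Lemma cov_Rm u X Y Z y : smooth U X -> smooth U Y -> smooth U Z -> U y ->
  cov g f u (fun y => Rm g (f y) (X y) (Y y) (Z y)) y =
  dRm g (f y) (dd u f y) (X y) (Y y) (Z y)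
  + Rm g (f y) (cov g f u X y) (Y y) (Z y) + Rm g (f y) (X y) (cov g f u Y y) (Z y)
  + Rm g (f y) (X y) (Y y) (cov g f u Z y).
Proof.
move=> Xs Ys Zs Uy; have Vy := fV Uy.
rewrite {1}/cov (dd_family3 (T := Rm g) oU oV fV fs (fun z Vy b c => Rm_lin1 gm b c Vy)
  (fun z Vy b c => Rm_lin2 gm b c Vy) (fun z Vy b c => Rm_lin3 gm b c Vy) (smooth_Rm gm)
  Xs Ys Zs u Uy).
rewrite (dRmE gm _ _ _ _ Vy) /cov.
have L1 b c : Rm g (f y) (b + c) (Y y) (Z y) = Rm g (f y) b (Y y) (Z y) + Rm g (f y) c (Y y) (Z y).
  by have := Rm_lin1 gm (Y y) (Z y) Vy 1 b c; rewrite !scale1r.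
have L2 b c : Rm g (f y) (X y) (b + c) (Z y) = Rm g (f y) (X y) b (Z y) + Rm g (f y) (X y) c (Z y).
  by have := Rm_lin2 gm (X y) (Z y) Vy 1 b c; rewrite !scale1r.
have L3 b c : Rm g (f y) (X y) (Y y) (b + c) = Rm g (f y) (X y) (Y y) b + Rm g (f y) (X y) (Y y) c.
  by have := Rm_lin3 gm (X y) (Y y) Vy 1 b c; rewrite !scale1r.
rewrite L1 L2 L3.
move: (dd _ _ _) (chr _ _ _ _) (Rm _ _ _ _ _) (Rm _ _ _ _ _) (Rm _ _ _ _ _) (Rm _ _ _ _ _) (Rm _ _ _ _ _) (Rm _ _ _ _ _) => *.
by apply/rowP => i; rewrite !mxE; ring.
Qed.

(** The second derivatives of <X, Y> commute. Antisymmetrizing them in [u] and [v] cancels the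
    products of first covariant derivatives and leaves the commutators, which are curvature
    terms. *)
Lemma Rm_skew_along u v X Y y : smooth U X -> smooth U Y -> U y ->
  iprod (g (f y)) (Rm g (f y) (dd u f y) (dd v f y) (X y)) (Y y) =
  - iprod (g (f y)) (Rm g (f y) (dd u f y) (dd v f y) (Y y)) (X y).
Proof.
move=> Xs Ys Uy; have Vy := fV Uy.
have gsym : (g (f y))^T = g (f y) by case: gm => _ _ + _; apply.
have E a b : dd a (dd b (fun y => iprod (g (f y)) (X y) (Y y))) y =
    iprod (g (f y)) (cov g f a (cov g f b X) y) (Y y) + iprod (g (f y)) (cov g f b X y) (cov g f a Y y)
    + (iprod (g (f y)) (cov g f a X y) (cov g f b Y y) + iprod (g (f y)) (X y) (cov g f a (cov g f b Y) y)).
  have bX := smooth_cov b Xs; have bY := smooth_cov b Ys.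
  rewrite -(dd_ip_cov _ bX Ys Uy) -(dd_ip_cov _ Xs bY Uy).
  rewrite -ddD; [|exact: smooth_diff (smooth_ip_along bX Ys) Uy|exact: smooth_diff (smooth_ip_along Xs bY) Uy].
  by apply: (dd_ext _ oU Uy) => z Uz; rewrite dd_ip_cov.
have := dd_swap_scalar v u oU Uy (smooth_ip_along Xs Ys).
rewrite !E -!cov_curvature// !ipBl (ipC (X y) (cov g f u _ _) gsym) (ipC (X y) (cov g f v _ _) gsym) => H.
by move: H; lra.
Qed.

End Along.

(** * Algebraic symmetries of the curvature tensor *)

Section Symmetries.
Variables (R : realType) (m : nat) (V : set 'rV[R]_m) (g : 'rV[R]_m -> 'M[R]_m).
Hypothesis gm : metric_on V g.
Variables (x : 'rV[R]_m) (Vx : V x).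

(** The case of the identity map and of constant fields in [Rm_skew_along]. *)
Lemma Rm_skew u v w z : iprod (g x) (Rm g x u v w) z = - iprod (g x) (Rm g x u v z) w.
Proof.
have oV : open V by case: gm.
have := @Rm_skew_along R m m V g gm V id oV (fun _ => id) (smooth_id V) u v (fun=> w) (fun=> z) x
  (@smooth_cst _ _ _ _ w) (@smooth_cst _ _ _ _ z) Vx.
by rewrite !dd_id.
Qed.

(** The usual combination of four Bianchi identities, one for each choice of the vector left out of
    the cyclic sum, reduced by the two antisymmetries. *)
Lemma Rm_pair u v w z : iprod (g x) (Rm g x u v w) z = iprod (g x) (Rm g x w z u) v.
Proof.
have B a b c d : iprod (g x) (Rm g x a b c) d + iprod (g x) (Rm g x b c a) d + iprod (g x) (Rm g x c a b) d = 0.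
  by rewrite -!ipDl (bianchi gm)// ip0l.
have A a b c d : iprod (g x) (Rm g x a b c) d = - iprod (g x) (Rm g x b a c) d.
  by rewrite (Rm_anti gm)// ipNl.
have := B u v w z; have := B v w z u; have := B w z u v; have := B z u v w.
rewrite (A w u v z) (A z v w u) (Rm_skew v w z u) (Rm_skew w z v u).
rewrite (Rm_skew v z w u) (A z u w v) (Rm_skew u z w v) (Rm_skew u w z v).
rewrite (Rm_skew z u v w) (A z u w v) (Rm_skew u v z w) (Rm_skew u z w v).
lra.
Qed.

End Symmetries.

Section Scaling.
Variables (R : realType) (m : nat) (V : set 'rV[R]_m) (g : 'rV[R]_m -> 'M[R]_m).
Hypothesis gm : metric_on V g.
Variables (x : 'rV[R]_m) (Vx : V x).

Lemma RmZ1 u v w (a : R) : Rm g x (a *: u) v w = a *: Rm g x u v w.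
Proof.
have L := Rm_lin1 gm v w Vx; have := L a u 0; rewrite !addr0 => ->.
have := L 1 0 0; rewrite !scale1r !addr0 => /eqP; rewrite eq_sym -subr_eq0 addrK => /eqP->.
by rewrite addr0.
Qed.

Lemma RmZ2 u v w (a : R) : Rm g x u (a *: v) w = a *: Rm g x u v w.
Proof. by rewrite (Rm_anti gm _ _ _ Vx) RmZ1 (Rm_anti gm v u _ Vx) scalerN opprK. Qed.

Lemma RmZ3 u v w (a : R) : Rm g x u v (a *: w) = a *: Rm g x u v w.
Proof.
have L := Rm_lin3 gm u v Vx; have := L a w 0; rewrite !addr0 => ->.
have := L 1 0 0; rewrite !scale1r !addr0 => /eqP; rewrite eq_sym -subr_eq0 addrK => /eqP->.
by rewrite addr0.
Qed.
End Scaling.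

Lemma dRmZ3 (R : realType) (m : nat) (V : set 'rV[R]_m) (g : 'rV[R]_m -> 'M[R]_m) (gm : metric_on V g)
  x z u v w (a : R) : V x -> dRm g x z u (a *: v) w = a *: dRm g x z u v w.
Proof.
move=> Vx; have oV : open V by case: gm.
rewrite !(dRmE gm _ _ _ _ Vx) (chrZr gm)// !(RmZ2 gm Vx) (chrZr gm)//.
have ds : differentiable (fun y => Rm g y u v w) x := smooth_diff (smooth_Rm gm u v w) Vx.
have dc : differentiable (fun _ : 'rV[R]_m => a) x by exact: differentiable_cst.
rewrite (@dd_ext _ _ _ _ (fun y => a *: Rm g y u v w) V)//; last first.
  by move=> y Vy; rewrite (RmZ2 gm Vy).
rewrite (dd_scale _ dc ds) dd_cst scale0r add0r ?(RmZ2 gm Vx) ?(chrZr gm)//.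
by rewrite !scalerBr scalerDr.
Qed.

(** * Simons' identity in normal coordinates *)

(** Orthonormality says P (G P^T) = 1 for the matrix P of the frame; as P is square, also (G P^T) P
    = 1, which is the expansion. *)
Lemma orthonormal_expansion (R : realType) (m : nat) (G : 'M[R]_m) (E : 'I_m -> 'rV[R]_m) w :
  (forall a b, iprod G (E a) (E b) = (a == b)%:R) -> w = \sum_a iprod G w (E a) *: E a.
Proof.
move=> EE; pose P := \matrix_a E a.
have ipE u v : iprod G u v = (u *m (G *m v^T)) 0 0 by rewrite iprod.unlock /bil mulmxA.
have P1 : P *m (G *m P^T) = 1%:M.
  apply/matrixP => a b; rewrite mxE [RHS]mxE -(EE a b) ipE mxE.
  apply: eq_bigr => c _; rewrite !mxE; congr (_ * _).
  by apply: eq_bigr => d _; rewrite !mxE.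
have P2 := mulmx1C P1.
rewrite -{1}(mulmx1 w) -P2 mulmxA mulmx_sum_row; apply: eq_bigr => a _.
rewrite rowK; congr (_ *: _); rewrite ipE !mxE; apply: eq_bigr => c _.
by congr (_ * _); rewrite !mxE; apply: eq_bigr => d _; rewrite !mxE.
Qed.

Section Extend.
Variables (R : realType) (n : nat) (G : 'M[R]_n.+1) (E : 'I_n -> 'rV[R]_n.+1) (nu : 'rV[R]_n.+1).
Hypothesis Gsym : G^T = G.
Hypothesis EE : forall a b, iprod G (E a) (E b) = (a == b)%:R.
Hypothesis nu1 : iprod G nu nu = 1.
Hypothesis nuE : forall a, iprod G nu (E a) = 0.

(** Index 0 carries the normal, so that [big_ord_recl] splits it off from sums over the ambient
    frame. *)
Definition ext_frame (i : 'I_n.+1) := if unlift ord0 i is Some a then E a else nu.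

Lemma ext_frame0 : ext_frame ord0 = nu. Proof. by rewrite /ext_frame unlift_none. Qed.
Lemma ext_frame_lift a : ext_frame (lift ord0 a) = E a.
Proof. by rewrite /ext_frame liftK. Qed.

Lemma ext_frame_orthonormal a b : iprod G (ext_frame a) (ext_frame b) = (a == b)%:R.
Proof.
case: (unliftP ord0 a) => [a' ->|->]; case: (unliftP ord0 b) => [b' ->|->];
  rewrite ?ext_frame0 ?ext_frame_lift.
- by rewrite (inj_eq lift_inj) EE.
- by rewrite (ipC _ _ Gsym) nuE.
- by rewrite nuE.
- by rewrite eqxx nu1.
Qed.

End Extend.

(** * Weingarten and Codazzi equations of a hypersurface *)

Section Hypersurface.
Variables (R : realType) (n : nat) (V : set 'rV[R]_n.+1) (g : 'rV[R]_n.+1 -> 'M[R]_n.+1).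
Hypothesis gm : metric_on V g.
Variables (U : set 'rV[R]_n) (f nu : 'rV[R]_n -> 'rV[R]_n.+1).
Hypotheses (oU : open U) (fV : forall y, U y -> V (f y)) (fs : smooth U f) (nus : smooth U nu).

Definition tangent a := dd (basis_vec a) f.
Definition hess_map a b := cov g f (basis_vec a) (tangent b).
Definition dnormal a := cov g f (basis_vec a) nu.
Definition ipf (X Y : 'rV[R]_n -> 'rV[R]_n.+1) y := iprod (g (f y)) (X y) (Y y).
Definition first_form a b := ipf (tangent a) (tangent b).
(** The full covariant derivative of the tangent field is paired with [nu], which discards its
    tangential component. *)
Definition sff a b := ipf (hess_map a b) nu.
Definition codazzi_term c a b :=
  ipf (fun y => Rm g (f y) (tangent c y) (tangent a y) (tangent b y)) nu.

Local Notation fa := tangent.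
Local Notation fab := hess_map.
Local Notation na := dnormal.
Local Notation G := first_form.
Local Notation h := sff.
Local Notation S := codazzi_term.
Local Notation e := basis_vec.

Hypothesis nu1 : forall y, U y -> ipf nu nu y = 1.
Hypothesis nuT : forall y, U y -> forall a, ipf nu (fa a) y = 0.

Let ts a : smooth U (fa a). Proof. exact: smooth_dd. Qed.
Let fabs a b : smooth U (fab a b). Proof. exact: (smooth_cov gm oU fV fs). Qed.
Let nas a : smooth U (na a). Proof. exact: (smooth_cov gm oU fV fs). Qed.
Let gsym y : U y -> (g (f y))^T = g (f y).
Proof. by move=> /fV Vy; case: gm => _ _ + _; apply. Qed.

Lemma smooth_ipf X Y : smooth U X -> smooth U Y -> smooth U (ipf X Y).
Proof. exact: (smooth_ip_along gm oU fV fs). Qed.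

Lemma dd_ipf v X Y y : smooth U X -> smooth U Y -> U y ->
  dd v (ipf X Y) y = ipf (cov g f v X) Y y + ipf X (cov g f v Y) y.
Proof. exact: (dd_ip_cov gm oU fV fs). Qed.

Lemma ipfC X Y y : U y -> ipf X Y y = ipf Y X y.
Proof. by move=> Uy; rewrite /ipf ipC// gsym. Qed.

Lemma smooth_sff a b : smooth U (h a b). Proof. exact: smooth_ipf. Qed.
Lemma smooth_first_form a b : smooth U (G a b). Proof. exact: smooth_ipf. Qed.

Lemma hess_map_sym a b y : U y -> fab a b y = fab b a y.
Proof. exact: (cov_swap gm oU fV fs). Qed.

Lemma sff_sym a b y : U y -> h a b y = h b a y.
Proof. by move=> Uy; rewrite /sff /ipf hess_map_sym. Qed.

Lemma dnormal_nu a y : U y -> ipf (na a) nu y = 0.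
Proof.
move=> Uy; have := dd_ipf (e a) nus nus Uy.
rewrite (@dd_ext R _ _ _ (fun=> (1 : R)) U)// dd_cst.
rewrite -[cov g f (e a) nu]/(na a) (ipfC nu _ Uy); lra.
Qed.

(** Weingarten's equation, from differentiating <nu, f_b> = 0. *)
Lemma dnormal_tangent a b y : U y -> ipf (na a) (fa b) y = - h a b y.
Proof.
move=> Uy; have := dd_ipf (e a) nus (ts b) Uy.
rewrite (@dd_ext R _ _ _ (fun=> (0 : R)) U)//; last by move=> z Uz; exact: nuT.
rewrite dd_cst -[cov g f (e a) nu]/(na a) -[cov g f (e a) (fa b)]/(fab a b).
rewrite (ipfC nu _ Uy) -[ipf (fab a b) nu y]/(h a b y); lra.
Qed.

(** Stated at every point of [U] and in an arbitrary chart, since it has to be differentiated again.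
    The last two terms vanish at the centre of normal coordinates, but their derivatives do not. *)
Lemma codazzi c a b y : U y ->
  dd (e c) (h a b) y = dd (e a) (h c b) y + S c a b y
    + ipf (fab a b) (na c) y - ipf (fab c b) (na a) y.
Proof.
move=> Uy; rewrite !dd_ipf// -![cov g f _ nu]/(na _).
have := cov_curvature gm oU fV fs (e c) (e a) (ts b) Uy.
rewrite -![cov g f _ (fa b)]/(fab _ b) => /(congr1 (fun w => iprod (g (f y)) w (nu y))).
rewrite ipBl -[X in _ = X]/(S c a b y).
rewrite -[iprod _ (cov g f (e c) _ y) _]/(ipf (cov g f (e c) (fab a b)) nu y).
rewrite -[iprod _ (cov g f (e a) _ y) _]/(ipf (cov g f (e a) (fab c b)) nu y) => <-.
ring.
Qed.

Let smooth_fn a b c : smooth U (ipf (fab a b) (na c)). Proof. exact: smooth_ipf. Qed.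
Let Rs c a b : smooth U (fun y => Rm g (f y) (fa c y) (fa a y) (fa b y)).
Proof. exact: (smooth_Rm_along gm oU fV fs). Qed.
Lemma smooth_codazzi_term c a b : smooth U (S c a b).
Proof. exact: smooth_ipf. Qed.

Lemma dd_codazzi d c a b y : U y ->
  dd d (dd (e c) (h a b)) y = dd d (dd (e a) (h c b)) y + dd d (S c a b) y
    + dd d (ipf (fab a b) (na c)) y - dd d (ipf (fab c b) (na a)) y.
Proof.
move=> Uy.
have d1 := smooth_diff (smooth_dd (e a) (smooth_sff c b)) Uy.
have d2 := smooth_diff (smooth_codazzi_term c a b) Uy.
have d3 := smooth_diff (smooth_fn a b c) Uy; have d4 := smooth_diff (smooth_fn c b a) Uy.
rewrite (@dd_ext _ _ _ _ (fun y => dd (e a) (h c b) y + S c a b y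
    + ipf (fab a b) (na c) y - ipf (fab c b) (na a) y) U)//; last first.
  by move=> z Uz; exact: codazzi.
have d12 := differentiableD d1 d2; have d123 := differentiableD d12 d3.
by rewrite (ddB _ d123 d4) (ddD _ d12 d3) (ddD _ d1 d2).
Qed.

(* Codazzi is used twice, commuting the two coordinate derivatives in between. *)
Lemma dd_dd_sff i k y : U y ->
  dd (e k) (dd (e k) (h i i)) y = dd (e i) (dd (e i) (h k k)) y
    + dd (e k) (S k i i) y + dd (e i) (S k i k) y
    + dd (e k) (ipf (fab i i) (na k)) y - dd (e k) (ipf (fab k i) (na i)) y
    + dd (e i) (ipf (fab i k) (na k)) y - dd (e i) (ipf (fab k k) (na i)) y.
Proof.
move=> Uy; rewrite dd_codazzi// (dd_swap_scalar (e i) (e k) oU Uy (smooth_sff k i)).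
have -> : dd (e i) (dd (e k) (h k i)) y = dd (e i) (dd (e k) (h i k)) y.
  apply: (dd_ext _ oU) => // z Uz; apply: (dd_ext _ oU) => // t Ut.
  exact: sff_sym.
rewrite dd_codazzi//; ring.
Qed.

(** * Normal coordinates at a point, along principal directions *)

Variable x : 'rV[R]_n.
Hypothesis Ux : U x.
Variable lam : 'I_n -> R.
Hypothesis G0 : forall a b, G a b x = (a == b)%:R.
Hypothesis T0 : forall a b c, ipf (fab a b) (fa c) x = 0.
Hypothesis h0 : forall a b, h a b x = (a == b)%:R * lam a.

Lemma frame_expansion w :
  w = iprod (g (f x)) w (nu x) *: nu x + \sum_a iprod (g (f x)) w (fa a x) *: fa a x.
Proof.
have nuE a : iprod (g (f x)) (nu x) (fa a x) = 0 by exact: nuT.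
rewrite {1}(orthonormal_expansion w (ext_frame_orthonormal (gsym Ux) G0 (nu1 Ux) nuE)).
rewrite big_ord_recl ext_frame0; congr (_ + _); apply: eq_bigr => a _.
by rewrite ext_frame_lift.
Qed.

Lemma hess_map_normal a b : fab a b x = ((a == b)%:R * lam a) *: nu x.
Proof.
rewrite [LHS]frame_expansion big1 ?addr0 => [|c _].
  by congr (_ *: _); rewrite -h0.
by rewrite -[iprod _ _ _]/(ipf (fab a b) (fa c) x) T0 scale0r.
Qed.

Lemma dnormal_principal a : na a x = (- lam a) *: fa a x.
Proof.
rewrite [LHS]frame_expansion -[iprod _ (na a x) (nu x)]/(ipf (na a) nu x) dnormal_nu// scale0r add0r.
rewrite (bigD1 a)//= big1 ?addr0 => [|c ca].
  by rewrite -[iprod _ _ _]/(ipf (na a) (fa a) x) dnormal_tangent// h0 eqxx mul1r.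
rewrite -[iprod _ _ _]/(ipf (na a) (fa c) x) dnormal_tangent// h0 eq_sym (negPf ca).
by rewrite mul0r oppr0 scale0r.
Qed.

(** Tangential components of the third covariant derivative of the immersion. They are symmetric in
    the two inner indices [b] and [c], and exchanging [a] and [b] costs a curvature term. *)
Let q a b c d := ipf (cov g f (e a) (fab b c)) (fa d) x.

Let q_sym a b c d : q a b c d = q a c b d.
Proof.
rewrite /q /ipf; congr (iprod _ _ _); rewrite /cov; congr (_ + chr _ _ _ _).
  by apply: (dd_ext _ oU Ux) => y Uy; exact: hess_map_sym.
exact: hess_map_sym.
Qed.

Let q_curv a b c d : q a b c d - q b a c d = iprod (g (f x)) (Rm g (f x) (fa a x) (fa b x) (fa c x)) (fa d x).
Proof. by rewrite -(cov_curvature gm oU fV fs (e a) (e b) (ts c) Ux) ipBl. Qed.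

(** From differentiating <nu_d, nu> = 0: what remains is the product of two derivatives of the
    normal, both principal at [x]. *)
Let nu_dd_dnormal a d : ipf nu (cov g f (e a) (na d)) x = - ((a == d)%:R * lam a * lam d).
Proof.
have := dd_ipf (e a) (nas d) nus Ux.
rewrite (@dd_ext R _ _ _ (fun=> (0 : R)) U)//; last by move=> z Uz; exact: dnormal_nu.
rewrite dd_cst -[cov g f (e a) nu]/(na a) (ipfC _ nu Ux).
rewrite [ipf (na d) (na a) x]/ipf !dnormal_principal ipZl ipZr -[iprod _ _ _]/(G d a x) G0 eq_sym.
lra.
Qed.

Let dd_hess_dnormal a b c d : dd (e a) (ipf (fab b c) (na d)) x =
  - lam d * q a b c d - (b == c)%:R * (a == d)%:R * lam b * lam a * lam d.
Proof.
rewrite dd_ipf// [ipf (cov _ _ _ _) (na d) x]/ipf dnormal_principal ipZr -[iprod _ _ (fa d x)]/(q a b c d).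
rewrite [X in _ + X]/ipf hess_map_normal ipZl -[iprod _ (nu x) _]/(ipf nu (cov g f (e a) (na d)) x).
by rewrite nu_dd_dnormal; ring.
Qed.

Lemma dd_first_form a b c : dd (e c) (G a b) x = 0.
Proof. by rewrite dd_ipf// T0 (ipfC _ _ Ux) T0 addr0. Qed.

Let dd_dd_first_form i k : dd (e i) (dd (e i) (G k k)) x =
  2 * q i i k k + 2 * ((i == k)%:R * lam i ^+ 2).
Proof.
rewrite (@dd_ext _ _ _ _ (fun y => ipf (fab i k) (fa k) y + ipf (fab i k) (fa k) y) U)//; last first.
  by move=> y Uy; rewrite dd_ipf// -[cov _ _ _ _]/(fab i k) (ipfC (fa k) _ Uy).
have d1 : differentiable (ipf (fab i k) (fa k)) x by apply: smooth_diff Ux; exact: smooth_ipf.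
rewrite (ddD _ d1 d1) dd_ipf// -/(q i i k k) -[cov _ _ _ (fa k)]/(fab i k).
rewrite [ipf (fab i k) (fab i k) x]/ipf hess_map_normal ipZl ipZr -[iprod _ (nu x) _]/(ipf nu nu x) nu1//.
by case: (i == k); rewrite /= ?mulr1n ?mulr0n; ring.
Qed.

Definition sec_curv a b := iprod (g (f x)) (Rm g (f x) (fa a x) (fa b x) (fa b x)) (fa a x).
Definition sec_normal a := iprod (g (f x)) (Rm g (f x) (nu x) (fa a x) (fa a x)) (nu x).
Definition dRm_normal d c a b := iprod (g (f x)) (dRm g (f x) (fa d x) (fa c x) (fa a x) (fa b x)) (nu x).

Let Vx := fV Ux.

(** Subtracting lam_i G_ii,kk removes exactly the unknown components [q], after two of them have
    been reordered at the price of a sectional curvature each. The factor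
    [sec_curv i k + lam i * lam k] is the intrinsic sectional curvature given by Gauss' equation. *)
Lemma laplace_sff_term i k :
  dd (e k) (dd (e k) (h i i)) x - lam i * dd (e k) (dd (e k) (G i i)) x =
  (dd (e i) (dd (e i) (h k k)) x - lam k * dd (e i) (dd (e i) (G k k)) x)
  + dd (e k) (S k i i) x + dd (e i) (S k i k) x
  + (lam i - lam k) * (sec_curv i k + lam i * lam k).
Proof.
rewrite dd_dd_sff// !dd_hess_dnormal !dd_dd_first_form !eqxx.
have H1 := q_curv i k i k; have H2 := q_curv i k k i.
rewrite (q_sym i k i k) in H1; rewrite (q_sym k i k i) in H2.
rewrite (Rm_skew gm Vx) -/(sec_curv i k) in H1; rewrite -/(sec_curv i k) in H2.
have -> : q k i i k = q i i k k + sec_curv i k by move: H1; lra.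
have -> : q i k k i = q k k i i + sec_curv i k by move: H2; lra.
rewrite (eq_sym k i); case: (eqVneq i k) => [->|_]; rewrite /= ?mulr1n ?mulr0n; ring.
Qed.

(** By [cov_Rm] the derivative also falls on the tangent fields and on the normal. At [x] the former
    become multiples of [nu], giving the terms in [sec_normal], and the latter a multiple of a
    tangent vector, giving a second copy of the sectional curvature term of [laplace_sff_term]. *)
Lemma dd_codazzi_div i k :
  dd (e k) (S k i i) x + dd (e i) (S k i k) x =
  dRm_normal k k i i + dRm_normal i k i k
  + lam k * sec_normal i - lam i * sec_normal k + (lam i - lam k) * sec_curv i k.
Proof.
have D d c a b : dd (e d) (S c a b) x = dRm_normal d c a b
   + (d == c)%:R * lam d * iprod (g (f x)) (Rm g (f x) (nu x) (fa a x) (fa b x)) (nu x)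
   + (d == a)%:R * lam d * iprod (g (f x)) (Rm g (f x) (fa c x) (nu x) (fa b x)) (nu x)
   - lam d * iprod (g (f x)) (Rm g (f x) (fa c x) (fa a x) (fa b x)) (fa d x).
  rewrite dd_ipf// {1}/ipf (cov_Rm gm oU fV fs _ (ts c) (ts a) (ts b) Ux) !ipDl.
  rewrite -![cov g f (e d) (fa _) x]/(fab d _ x) !hess_map_normal (RmZ1 gm Vx) (RmZ2 gm Vx) !ipZl.
  have -> z : iprod (g (f x)) (Rm g (f x) (fa c x) (fa a x) (z *: nu x)) (nu x) = 0.
    rewrite (Rm_skew gm Vx) ipZr; have := Rm_skew gm Vx (fa c x) (fa a x) (nu x) (nu x).
    move: (iprod _ _ _) => A HA; have -> : A = 0 by move: HA; lra.
    by rewrite mulr0 oppr0.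
  rewrite -/(dRm_normal d c a b) [X in _ + X]/ipf -[cov g f _ nu x]/(na d x) dnormal_principal ipZr.
  ring.
have N1 u v w : iprod (g (f x)) (Rm g (f x) u (nu x) w) v = - iprod (g (f x)) (Rm g (f x) (nu x) u w) v.
  by rewrite (Rm_anti gm _ _ _ Vx) ipNl.
rewrite !D !eqxx !N1 (Rm_skew gm Vx (fa k x) (fa i x) (fa k x)).
have -> : iprod (g (f x)) (Rm g (f x) (fa k x) (fa i x) (fa i x)) (fa k x) = sec_curv i k.
  by rewrite (Rm_anti gm _ _ _ Vx) ipNl (Rm_skew gm Vx) opprK.
rewrite (eq_sym k i) -!/(sec_normal _).
case: (eqVneq i k) => [->|_]; rewrite /= ?mulr1n ?mulr0n; ring.
Qed.

(** The products of second derivatives of [f] with derivatives of [nu] vanish at [x], the former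
    being normal and the latter tangent. *)
Lemma codazzi_at c a b : dd (e c) (h a b) x = dd (e a) (h c b) x + S c a b x.
Proof.
have Z a' b' c' : ipf (fab a' b') (na c') x = 0.
  rewrite /ipf hess_map_normal ipZl -[iprod _ _ _]/(ipf nu (na c') x) (ipfC _ _ Ux) dnormal_nu//.
  by rewrite mulr0.
by rewrite codazzi// !Z subr0 addr0.
Qed.

End Hypersurface.

(** * Derivatives of h G^-1 and of the trace of its square *)

Section TraceSquare.
Variables (R : realType) (V : normedModType R) (n : nat).
Variables (U : set V) (Gm hm : V -> 'M[R]_n).
Hypotheses (oU : open U) (Gs : smooth U Gm) (hs : smooth U hm).
Hypothesis Gu : forall y, U y -> Gm y \in unitmx.

Lemma dd_trace (A : V -> 'M[R]_n) y v : differentiable A y ->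
  dd v (fun y => \tr (A y)) y = \tr (dd v A y).
Proof.
move=> dA; rewrite /mxtrace dd_sum; last by move=> i; exact: differentiable_entry.
by apply: eq_bigr => i _; rewrite dd_entry.
Qed.

Lemma smooth_mulmx (A B : V -> 'M[R]_n) : smooth U A -> smooth U B ->
  smooth U (fun y => A y *m B y).
Proof. by move=> As Bs k; exact: Ck_mulmx. Qed.

Lemma smooth_trace (A : V -> 'M[R]_n) : smooth U A -> smooth U (fun y => \tr (A y)).
Proof.
move=> As k; apply: Ck_sum => // i _.
by have /(Ck_mxP _ _ oU) := As k.
Qed.

Definition quot_mx y := hm y *m invmx (Gm y).
Local Notation B := quot_mx.

Lemma smooth_quot_mx : smooth U B.
Proof. by apply: smooth_mulmx => // k; exact: Ck_invmx. Qed.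
Let Bs := smooth_quot_mx.

Variables (x : V) (v : V) (c : R).
Hypotheses (Ux : U x) (G1 : Gm x = 1%:M) (dG : dd v Gm x = 0).
Hypothesis trB : forall y, U y -> \tr (B y) = c.

Let Bx : B x = hm x. Proof. by rewrite /B G1 invmx1 mulmx1. Qed.

(** Differentiating h = B G gives the derivatives of [B] without a formula for the derivative of an
    inverse matrix. *)
Let dh y : U y -> dd v hm y = dd v B y *m Gm y + B y *m dd v Gm y.
Proof.
move=> Uy; have dB := smooth_diff Bs Uy; have dGm := smooth_diff Gs Uy.
rewrite -(dd_mulmx _ dB dGm); apply: (dd_ext _ oU Uy) => z Uz.
by rewrite /B mulmxKV// Gu.
Qed.

Lemma dd_quot_mx : dd v B x = dd v hm x.
Proof. by rewrite dh// G1 dG mulmx1 mulmx0 addr0. Qed.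

Lemma dd_dd_quot_mx : dd v (dd v B) x = dd v (dd v hm) x - hm x *m dd v (dd v Gm) x.
Proof.
have dB := smooth_diff Bs Ux; have dGm := smooth_diff Gs Ux.
have ddB := smooth_diff (smooth_dd v Bs) Ux; have ddG := smooth_diff (smooth_dd v Gs) Ux.
have dm1 := differentiable_mulmx ddB dGm; have dm2 := differentiable_mulmx dB ddG.
rewrite (dd_ext v oU Ux dh) (ddD _ dm1 dm2) (dd_mulmx _ ddB dGm) (dd_mulmx _ dB ddG).
by rewrite G1 dG !mulmx0 mulmx1 add0r addr0 Bx addrK.
Qed.

Lemma trace_dd : \tr (dd v hm x) = 0.
Proof.
rewrite -dd_quot_mx -(dd_trace _ (smooth_diff Bs Ux)).
by rewrite (dd_ext v oU Ux trB) dd_cst.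
Qed.

(** The trace of the second derivative of [B] vanishes because the trace of [B] is constant near
    [x]; the second derivative of the metric is what then remains of [dd_dd_quot_mx]. *)
Lemma trace_dd_dd : \tr (dd v (dd v hm) x) = \tr (hm x *m dd v (dd v Gm) x).
Proof.
apply/eqP; rewrite -subr_eq0 -raddfB /= -dd_dd_quot_mx.
rewrite -(dd_trace _ (smooth_diff (smooth_dd v Bs) Ux)).
rewrite (@dd_ext _ _ _ _ (fun=> (0 : R)) U)// ?dd_cst// => y Uy.
by rewrite -(dd_trace _ (smooth_diff Bs Uy)) (dd_ext v oU Uy trB) dd_cst.
Qed.

Lemma dd_trace_sqr y : U y ->
  dd v (fun y => \tr (B y *m B y)) y = 2 * \tr (B y *m dd v B y).
Proof.
move=> Uy; have dB := smooth_diff Bs Uy.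
rewrite (dd_trace _ (differentiable_mulmx dB dB)) (dd_mulmx _ dB dB) raddfD /=.
by rewrite mxtrace_mulC; ring.
Qed.

Lemma dd_trace_sqr_at : dd v (fun y => \tr (B y *m B y)) x = 2 * \tr (hm x *m dd v hm x).
Proof. by rewrite dd_trace_sqr// Bx dd_quot_mx. Qed.

Lemma dd_dd_trace_sqr : dd v (dd v (fun y => \tr (B y *m B y))) x =
  2 * \tr (dd v hm x *m dd v hm x)
  + 2 * \tr (hm x *m (dd v (dd v hm) x - hm x *m dd v (dd v Gm) x)).
Proof.
have dB := smooth_diff Bs Ux; have ddB := smooth_diff (smooth_dd v Bs) Ux.
have dm := differentiable_mulmx dB ddB.
rewrite (dd_ext v oU Ux dd_trace_sqr).
have d2 : differentiable (fun=> (2 : R)) x by exact: differentiable_cst.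
have dtr : differentiable (fun y => \tr (B y *m dd v B y)) x.
  by apply: smooth_diff Ux; apply: smooth_trace; apply: smooth_mulmx => //; exact: smooth_dd.
rewrite (dd_mul _ d2 dtr) dd_cst mul0r add0r (dd_trace _ dm) (dd_mulmx _ dB ddB).
by rewrite dd_dd_quot_mx dd_quot_mx Bx raddfD /= mulrDr.
Qed.

End TraceSquare.

(** * Simons' identity for the squared norm of the second form *)

Section Simons.
Variables (R : realType) (n : nat) (V : set 'rV[R]_n.+1) (g : 'rV[R]_n.+1 -> 'M[R]_n.+1).
Hypothesis gm : metric_on V g.
Variables (U : set 'rV[R]_n) (f nu : 'rV[R]_n -> 'rV[R]_n.+1).
Hypotheses (oU : open U) (fV : forall y, U y -> V (f y)) (fs : smooth U f) (nus : smooth U nu).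
Local Notation e := basis_vec.
Local Notation G := (first_form g f).
Local Notation h := (sff g f nu).
Hypothesis nu1 : forall y, U y -> ipf g f nu nu y = 1.
Hypothesis nuT : forall y, U y -> forall a, ipf g f nu (tangent f a) y = 0.
Variable x : 'rV[R]_n.
Hypothesis Ux : U x.
Variable lam : 'I_n -> R.
Hypothesis G0 : forall a b, G a b x = (a == b)%:R.
Hypothesis T0 : forall a b c, ipf g f (hess_map g f a b) (tangent f c) x = 0.
Hypothesis h0 : forall a b, h a b x = (a == b)%:R * lam a.

Let Gm y : 'M[R]_n := \matrix_(a, b) G a b y.
Let hm y : 'M[R]_n := \matrix_(a, b) h a b y.
Hypothesis Gu : forall y, U y -> Gm y \in unitmx.
Variable c : R.
Hypothesis trc : forall y, U y -> \tr (hm y *m invmx (Gm y)) = c.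

Let Gs : smooth U Gm.
Proof.
move=> k; apply/Ck_mxP => // a b; under eq_fun do rewrite mxE.
exact (smooth_first_form gm oU fV fs a b k).
Qed.
Let hs : smooth U hm.
Proof.
move=> k; apply/Ck_mxP => // a b; under eq_fun do rewrite mxE.
exact (smooth_sff gm oU fV fs nus a b k).
Qed.
Let Gx : Gm x = 1%:M. Proof. by apply/matrixP => a b; rewrite !mxE G0. Qed.

Let dGm v y a b : U y -> (dd v Gm y) a b = dd v (G a b) y.
Proof.
move=> Uy; rewrite (dd_entry _ _ _ (smooth_diff Gs Uy)).
by congr (dd _ _ _); apply/funext => z; rewrite mxE.
Qed.
Let dhm v y a b : U y -> (dd v hm y) a b = dd v (h a b) y.
Proof.
move=> Uy; rewrite (dd_entry _ _ _ (smooth_diff hs Uy)).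
by congr (dd _ _ _); apply/funext => z; rewrite mxE.
Qed.
Let ddGm v y a b : U y -> (dd v (dd v Gm) y) a b = dd v (dd v (G a b)) y.
Proof.
move=> Uy; rewrite (dd_entry _ _ _ (smooth_diff (smooth_dd v Gs) Uy)).
by apply: (dd_ext _ oU Uy) => z; exact: dGm.
Qed.
Let ddhm v y a b : U y -> (dd v (dd v hm) y) a b = dd v (dd v (h a b)) y.
Proof.
move=> Uy; rewrite (dd_entry _ _ _ (smooth_diff (smooth_dd v hs) Uy)).
by apply: (dd_ext _ oU Uy) => z; exact: dhm.
Qed.
Let dG0 k : dd (e k) Gm x = 0.
Proof.
by apply/matrixP => a b; rewrite dGm// mxE (dd_first_form gm oU fV fs Ux T0).
Qed.
Let hx : hm x = diag_mx (\row_a lam a).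
Proof.
apply/matrixP => a b; rewrite !mxE h0.
by case: (a == b); rewrite ?mul1r ?mul0r ?mulr1n ?mulr0n.
Qed.

Let tr_hx (A : 'M[R]_n) : \tr (hm x *m A) = \sum_a lam a * A a a.
Proof. by rewrite hx; apply: eq_bigr => a _; rewrite mul_diag_mx !mxE. Qed.

Definition norm_sff2 y := \tr (quot_mx Gm hm y *m quot_mx Gm hm y).

Lemma norm_sff2_at : norm_sff2 x = \sum_a lam a ^+ 2.
Proof.
rewrite /norm_sff2 /quot_mx Gx invmx1 mulmx1 tr_hx; apply: eq_bigr => a _.
by rewrite mxE h0 eqxx mul1r expr2.
Qed.

Lemma trace_at : \sum_a lam a = c.
Proof.
rewrite -(trc Ux) Gx invmx1 mulmx1; apply: eq_bigr => a _.
by rewrite mxE h0 eqxx mul1r.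
Qed.

Lemma dd_trace_zero k : \sum_a dd (e k) (h a a) x = 0.
Proof.
rewrite -[RHS](trace_dd oU Gs hs Gu Ux Gx (dG0 k) trc).
by apply: eq_bigr => a _; rewrite dhm.
Qed.

Lemma dd_dd_trace_zero k :
  \sum_a (dd (e k) (dd (e k) (h a a)) x - lam a * dd (e k) (dd (e k) (G a a)) x) = 0.
Proof.
rewrite big_split /= sumrN; apply/eqP; rewrite subr_eq0; apply/eqP.
have := trace_dd_dd oU Gs hs Gu Ux Gx (dG0 k) trc; rewrite tr_hx => E.
transitivity (\tr (dd (e k) (dd (e k) hm) x)).
  by apply: eq_bigr => a _; rewrite ddhm.
by rewrite E; apply: eq_bigr => a _; rewrite ddGm.
Qed.

Lemma dd_norm_sff2 k : dd (e k) norm_sff2 x = 2 * \sum_a lam a * dd (e k) (h a a) x.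
Proof.
rewrite (dd_trace_sqr_at oU Gs hs Gu Ux Gx (dG0 k)) tr_hx; congr (_ * _).
by apply: eq_bigr => a _; rewrite dhm.
Qed.

Lemma dd_dd_norm_sff2 k : dd (e k) (dd (e k) norm_sff2) x =
  2 * (\sum_a \sum_b dd (e k) (h a b) x ^+ 2)
  + 2 * \sum_a lam a * (dd (e k) (dd (e k) (h a a)) x - lam a * dd (e k) (dd (e k) (G a a)) x).
Proof.
rewrite (dd_dd_trace_sqr oU Gs hs Gu Ux Gx (dG0 k)) tr_hx; congr (2 * _ + 2 * _).
  apply: eq_bigr => a _; rewrite mxE; apply: eq_bigr => b _.
  rewrite !dhm// expr2; congr (_ * _).
  by apply: (dd_ext _ oU Ux) => y Uy; exact (sff_sym gm nu oU fV fs b a Uy).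
apply: eq_bigr => a _; congr (_ * _); rewrite mxE [X in _ + X]mxE ddhm//; congr (_ - _).
by rewrite hx mul_diag_mx !mxE ddGm.
Qed.

Local Notation K := (sec_curv g f x).
Local Notation N := (sec_normal g f nu x).
Local Notation dRn := (dRm_normal g f nu x).

(** For fixed k the second derivatives of the diagonal entries of h G^-1 have zero sum. This is used
    twice: to replace [lam i] by [lam i - m] for any [m], and to drop the terms left after i and k
    have been exchanged. With [m] the mean curvature the factor becomes a principal value of phi. *)
Theorem simons m :
  2^-1 * \sum_k dd (e k) (dd (e k) norm_sff2) x =
  \sum_k \sum_a \sum_b dd (e k) (h a b) x ^+ 2
  + \sum_i \sum_k (lam i - m) * (dRn k k i i + dRn i k i k + lam k * N i - lam i * N k
      + (lam i - lam k) * (2 * K i k + lam i * lam k)).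
Proof.
under eq_bigr do rewrite dd_dd_norm_sff2.
rewrite big_split /= -!mulr_sumr mulrDr !mulrA mulVf ?pnatr_eq0// !mul1r; congr (_ + _).
rewrite exchange_big /=.
pose Lh i k := dd (e k) (dd (e k) (h i i)) x - lam i * dd (e k) (dd (e k) (G i i)) x.
have Z : \sum_i \sum_k m * Lh i k = 0.
  rewrite exchange_big big1// => k _.
  by rewrite -mulr_sumr [X in _ * X](dd_dd_trace_zero k) mulr0.
transitivity (\sum_i \sum_k (lam i * Lh i k - m * Lh i k)).
  by under [RHS]eq_bigr do rewrite sumrB; rewrite sumrB Z subr0.
have E i k : lam i * Lh i k - m * Lh i k = (lam i - m) * Lh k i +
   (lam i - m) * (dRn k k i i + dRn i k i k + lam k * N i - lam i * N k
      + (lam i - lam k) * (2 * K i k + lam i * lam k)).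
  rewrite -mulrBl -mulrDr; congr (_ * _).
  rewrite [LHS](laplace_sff_term gm oU fV fs nus nu1 nuT Ux G0 T0 h0).
  rewrite -addrA -addrA [X in _ + X]addrA (dd_codazzi_div gm oU fV fs nus nu1 nuT Ux G0 T0 h0).
  by rewrite /Lh; ring.
apply: eq_bigr => i _; rewrite (eq_bigr _ (fun k _ => E i k)) big_split /=.
by rewrite -mulr_sumr [X in _ * X](dd_dd_trace_zero i) mulr0 add0r.
Qed.

End Simons.

(** * Okumura and Kato inequalities *)

Section Algebra.
Variable R : rcfType.
Variable n : nat.

Lemma sum_const_ord (c : R) : \sum_(j < n) c = n%:R * c.
Proof. by rewrite sumr_const card_ord mulr_natl. Qed.

(** Here -t is the mean of the entries other than [a i]. The inequality amounts to discarding the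
    squares (a_j + t)^2 with j different from i. *)
Lemma zero_sum_sqr_le (a : 'I_n -> R) i : (1 < n)%N -> \sum_j a j = 0 ->
  n%:R * a i ^+ 2 <= (n%:R - 1) * \sum_j a j ^+ 2.
Proof.
move=> n1 a0; have N1 : 0 < n%:R - 1 :> R by rewrite subr_gt0 ltr1n.
pose t := a i / (n%:R - 1).
have ait : a i = t * (n%:R - 1) by rewrite /t divfK// gt_eqF.
have E : \sum_j (a j + t) ^+ 2 = \sum_j a j ^+ 2 + n%:R * t ^+ 2.
  rewrite (eq_bigr (fun j => a j ^+ 2 + (2 * t * a j + t ^+ 2))) => [|j _]; last by ring.
  by rewrite !big_split /= sum_const_ord -mulr_sumr a0 mulr0 add0r.
have L : (a i + t) ^+ 2 <= \sum_j (a j + t) ^+ 2.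
  by rewrite (bigD1 i)//= lerDl sumr_ge0// => j _; exact: sqr_ge0.
rewrite E in L; rewrite {1}ait.
have -> : n%:R * (t * (n%:R - 1)) ^+ 2 = (n%:R - 1) * ((a i + t) ^+ 2 - n%:R * t ^+ 2).
  by rewrite ait; ring.
by rewrite ler_wpM2l ?(ltW N1)// lerBlDr.
Qed.

Variables (mu : 'I_n -> R) (w : R).
Hypotheses (mu0 : \sum_i mu i = 0) (w0 : 0 <= w) (w2 : w ^+ 2 = \sum_i mu i ^+ 2).

(* Okumura's inequality: every mu_i is at least -b := -w (n-1)/r with r^2 = n (n-1),
   so the sum of (mu_i - w/r)^2 (mu_i + b) is nonnegative. *)
Lemma okumura : (1 < n)%N ->
  - ((n%:R - 2) / Num.sqrt (n%:R * (n%:R - 1)) * w ^+ 3) <= \sum_i mu i ^+ 3.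
Proof.
move=> n1; have N1 : 0 < n%:R - 1 :> R by rewrite subr_gt0 ltr1n.
have N0 : 0 < n%:R :> R by rewrite ltr0n (ltn_trans _ n1).
set r := Num.sqrt _.
have r2 : r ^+ 2 = n%:R * (n%:R - 1) by rewrite sqr_sqrtr// mulr_ge0// ltW.
have r0 : 0 < r by rewrite sqrtr_gt0 mulr_gt0.
pose s := w / r; have ws : w = s * r by rewrite /s divfK// gt_eqF.
have s0 : 0 <= s by rewrite divr_ge0// ltW.
have lb i : 0 <= mu i + s * (n%:R - 1).
  rewrite -lerBlDr sub0r lerNl.
  apply: le_trans (ler_norm _) _; rewrite normrN.
  rewrite -ler_sqr ?nnegrE//; last by rewrite mulr_ge0// ltW.
  rewrite real_normK ?num_real//.
  rewrite -(ler_pM2l N0); apply: le_trans (zero_sum_sqr_le i n1 mu0) _.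
  by rewrite -w2 ws exprMn r2; rewrite le_eqVlt; apply/orP; left; apply/eqP; ring.
have := @sumr_ge0 R 'I_n (index_enum 'I_n) xpredT
  (fun i => (mu i - s) ^+ 2 * (mu i + s * (n%:R - 1)))
  (fun i _ => mulr_ge0 (sqr_ge0 _) (lb i)).
rewrite (eq_bigr (fun i => mu i ^+ 3 + (s * (n%:R - 3) * mu i ^+ 2
   + ((s ^+ 2 - 2 * s ^+ 2 * (n%:R - 1)) * mu i + s ^+ 3 * (n%:R - 1))))) => [|i _]; last by ring.
rewrite !big_split /= -!mulr_sumr mu0 mulr0 add0r sum_const_ord -w2 => H.
rewrite -subr_ge0 opprK; apply: le_trans H _.
rewrite le_eqVlt; apply/orP; left; apply/eqP; congr (_ + _).
have -> : (n%:R - 2) / r * w ^+ 3 = (n%:R - 2) * s * w ^+ 2.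
  by rewrite /s; field; rewrite gt_eqF.
by rewrite ws exprMn r2; ring.
Qed.

(** * Refined Kato inequality, with T c a b the derivative of h_ab in direction c and S the Codazzi
    term *)

Section Kato.
Variables (T S : 'I_n -> 'I_n -> 'I_n -> R) (eps : R).
Hypotheses (n1 : (1 < n)%N) (eps0 : 0 < eps).
Hypothesis Tsym : forall c a b, T c a b = T c b a.
Hypothesis Tcod : forall c a b, T c a b = T a c b + S c a b.
Hypothesis Ttr : forall c, \sum_a T c a a = 0.

(** The difference of the two sides is a perfect square over eps (1 + eps). *)
Lemma sqr_lower (x y b : R) : y = x + b -> y ^+ 2 >= x ^+ 2 / (1 + eps) - b ^+ 2 / eps.
Proof.
move=> ->; have e1 : 0 < 1 + eps by rewrite ltr_wpDl// ltW.
rewrite -subr_ge0.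
have -> : (x + b) ^+ 2 - (x ^+ 2 / (1 + eps) - b ^+ 2 / eps) =
   (eps * x + (1 + eps) * b) ^+ 2 / (eps * (1 + eps)).
  by field; rewrite !gt_eqF.
by rewrite divr_ge0 ?sqr_ge0// mulr_ge0// ltW.
Qed.

Lemma kato : \sum_c \sum_a \sum_b T c a b ^+ 2 >=
  (1 + 2 / (n%:R * (1 + eps))) * (\sum_c \sum_a T c a a ^+ 2)
  - 2 / eps * (\sum_a \sum_b S a b a ^+ 2).
Proof.
have e1 : 0 < 1 + eps by rewrite ltr_wpDl// ltW.
have N0 : 0 < n%:R :> R by rewrite ltr0n (ltn_trans _ n1).
(* Of all components only T c a a, T a a b and T a b a are kept; for b different from a the last two
   are equal and distinct from the first kind, whence the factor 2. *)
have step1 : \sum_c \sum_a T c a a ^+ 2 + 2 * (\sum_a \sum_(b | b != a) T a a b ^+ 2)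
    <= \sum_c \sum_a \sum_b T c a b ^+ 2.
  have -> : 2 * (\sum_a \sum_(b | b != a) T a a b ^+ 2) =
     \sum_c (\sum_(b | b != c) T c c b ^+ 2 + \sum_(a | a != c) T c a c ^+ 2).
    rewrite big_split /= mulrDl mul1r; congr (_ + _).
    by apply: eq_bigr => c _; apply: eq_bigr => b _; rewrite Tsym.
  rewrite -big_split /=; apply: ler_sum => c _.
  rewrite [leRHS](bigD1 c)//= [X in _ <= X + _](bigD1 c)//= [X in X + _ <= _](bigD1 c)//=.
  rewrite -!addrA lerD2l addrCA lerD2l -big_split /=; apply: ler_sum => a ac.
  rewrite (bigD1 a)//= [X in _ <= _ + X](bigD1 c) 1?eq_sym//=.
  rewrite lerD2l lerDl sumr_ge0// => b _; exact: sqr_ge0.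
apply: le_trans step1; rewrite mulrDl mul1r -addrA lerD2l.
(* T a a b = T a b a = T b a a + S a b a: the comparison introduces exactly the curvature components
   of the error term. *)
have step2 : \sum_a \sum_(b | b != a) T a a b ^+ 2 >=
    \sum_a \sum_(b | b != a) (T b a a ^+ 2 / (1 + eps) - S a b a ^+ 2 / eps).
  apply: ler_sum => a _; apply: ler_sum => b _; apply: sqr_lower.
  by rewrite (Tsym a a b) Tcod.
apply: le_trans (ler_wpM2l _ step2); last by [].
under [X in _ <= _ * X]eq_bigr do rewrite sumrB.
rewrite sumrB mulrBr; apply: lerD.
  under [X in _ <= _ * X]eq_bigr do rewrite -mulr_suml.
  rewrite -mulr_suml.
  have -> : 2 / (n%:R * (1 + eps)) * (\sum_c \sum_a T c a a ^+ 2) =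
      2 * ((\sum_c \sum_a T c a a ^+ 2) / n%:R / (1 + eps)).
    by field; rewrite !gt_eqF.
  rewrite ler_wpM2l// ler_wpM2r ?invr_ge0 ?(ltW e1)// ler_pdivrMr//.
  rewrite [X in _ <= X * _](exchange_big_dep xpredT)//= mulr_suml; apply: ler_sum => c _.
  (* The diagonal T c c c is missing from the sum on the right. By tracelessness the full sum over a
     is at most n times the sum over a different from c. *)
  have H := zero_sum_sqr_le c n1 (Ttr c); rewrite (bigD1 c)//= in H.
  rewrite (bigD1 c)//= [X in _ <= X * _](eq_bigl (fun a => a != c)) => [|a]; last by rewrite eq_sym.
  move: H; set p := T c c c ^+ 2; set s := \sum_(a | _) _ => H.
  rewrite -subr_ge0; have -> : s * n%:R - (p + s) = (n%:R - 1) * (p + s) - n%:R * p by ring.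
  by rewrite subr_ge0.
rewrite lerN2.
under [X in _ * X <= _]eq_bigr do rewrite -mulr_suml.
rewrite -mulr_suml -mulrA [X in _ <= _ * X]mulrC.
rewrite ler_wpM2l// ler_wpM2r ?invr_ge0 ?(ltW eps0)//.
apply: ler_sum => a _; rewrite [leRHS](bigD1 a)//= lerDr; exact: sqr_ge0.
Qed.

(** * The inequality in algebraic form: w, d and L stand for |phi|, its gradient and its
    Laplacian *)

Hypothesis wpos : 0 < w.
Variables (H L : R) (N d : 'I_n -> R) (K : 'I_n -> 'I_n -> R) (dR : 'I_n -> 'I_n -> 'I_n -> 'I_n -> R).
Hypothesis H0 : 0 <= H.
Hypothesis Ksym : forall a b, K a b = K b a.
Hypothesis wd : forall k, w * d k = \sum_a mu a * T k a a.
Let lam i := mu i + H.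
Hypothesis wL : w * L + \sum_k d k ^+ 2 = \sum_c \sum_a \sum_b T c a b ^+ 2
  + \sum_i \sum_k mu i * (dR k k i i + dR i k i k + lam k * N i - lam i * N k
      + (lam i - lam k) * (2 * K i k + lam i * lam k)).

(** Cauchy-Schwarz for [wd], obtained by expanding the nonnegative sum over a of (T k a a - d_k mu_a
    / w)^2. *)
Lemma sqr_grad_le : \sum_k d k ^+ 2 <= \sum_c \sum_a T c a a ^+ 2.
Proof.
apply: ler_sum => k _; rewrite -subr_ge0.
have := @sumr_ge0 R 'I_n (index_enum 'I_n) xpredT
  (fun a => (T k a a - d k / w * mu a) ^+ 2) (fun a _ => sqr_ge0 _).
rewrite (eq_bigr (fun a => T k a a ^+ 2 + (- (2 * d k / w) * (mu a * T k a a)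
   + (d k / w) ^+ 2 * mu a ^+ 2))) => [|a _]; last by ring.
rewrite !big_split /= -!mulr_sumr -wd -w2.
have -> : - (2 * d k / w) * (w * d k) + (d k / w) ^+ 2 * w ^+ 2 = - d k ^+ 2.
  by field; rewrite gt_eqF.
by [].
Qed.

Lemma sum2_prod (c : R) (a b : 'I_n -> R) :
  \sum_i \sum_k c * (a i * b k) = c * ((\sum_i a i) * (\sum_k b k)).
Proof.
rewrite big_distrlr mulr_sumr; apply: eq_bigr => i _.
by rewrite mulr_sumr.
Qed.

Lemma sum2D (a b : 'I_n -> 'I_n -> R) :
  \sum_i \sum_k (a i k + b i k) = \sum_i \sum_k a i k + \sum_i \sum_k b i k.
Proof. by rewrite -big_split; apply: eq_bigr => i _; rewrite big_split. Qed.

Lemma reaction_terms :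
  \sum_i \sum_k mu i * (dR k k i i + dR i k i k + lam k * N i - lam i * N k
      + (lam i - lam k) * (2 * K i k + lam i * lam k)) =
  \sum_a \sum_k (mu a * dR a k a k + mu k * dR a a k k)
  + \sum_a \sum_k (2 * (mu a ^+ 2 * K k a) + 2 * (- (mu a * mu k * K k a)))
  + n%:R * H * (\sum_a mu a * N a) - w ^+ 2 * (\sum_a N a)
  + n%:R * H * (\sum_i mu i ^+ 3) + n%:R * H ^+ 2 * w ^+ 2 - w ^+ 4.
Proof.
(* Apart from the terms in [dR] and [K], every summand is brought to the shape c (a_i b_k), so that
   its double sum factors. Factors sum of mu_k vanish, and factors 1 contribute n. *)
transitivity (\sum_i \sum_k (mu i * dR i k i k + (mu i * dR k k i i
  + ((2 * (mu i ^+ 2 * K k i) + 2 * (- (mu i * mu k * K k i)))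
  + (1 * ((mu i * N i) * mu k) + (H * ((mu i * N i) * 1)
  + (-1 * (mu i ^+ 2 * N k) + (- H * (mu i * N k)
  + (1 * (mu i ^+ 3 * mu k) + (H * (mu i ^+ 3 * 1)
  + (H ^+ 2 * (mu i ^+ 2 * 1) + (-1 * (mu i ^+ 2 * mu k ^+ 2)
  + (- H * (mu i * mu k ^+ 2) + - H ^+ 2 * (mu i * mu k)))))))))))))).
  by apply: eq_bigr => i _; apply: eq_bigr => k _; rewrite /lam (Ksym i k); ring.
rewrite !sum2D !sum2_prod mu0 -w2 sum_const_ord.
rewrite [X in _ + (X + _) = _]exchange_big /=; ring.
Qed.

(** Kato's inequality yields (1 + q) times the sum of the T c a a ^+ 2, hence (1 + q) times the
    squared gradient; the 1 pays for the squared gradient in [wL]. Okumura's inequality is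
    multiplied by n H, which is nonnegative. *)
Lemma simons_inequality :
  w * L + w ^+ 4 + n%:R * (n%:R - 2) * H / Num.sqrt (n%:R * (n%:R - 1)) * w ^+ 3
  - n%:R * H ^+ 2 * w ^+ 2 + w ^+ 2 * (\sum_a N a) - n%:R * H * (\sum_a mu a * N a)
  - (\sum_a \sum_k (2 * (mu a ^+ 2 * K k a) + 2 * (- (mu a * mu k * K k a))))
  - (\sum_a \sum_k (mu a * dR a k a k + mu k * dR a a k k))
  >= 2 / (n%:R * (1 + eps)) * (\sum_k d k ^+ 2) - 2 / eps * (\sum_a \sum_b S a b a ^+ 2).
Proof.
have N0 : 0 < n%:R :> R by rewrite ltr0n (ltn_trans _ n1).
have e1 : 0 < 1 + eps by rewrite ltr_wpDl// ltW.
have Ka := kato; have Gr := sqr_grad_le; have Ok := okumura n1.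
have HwL := wL; rewrite reaction_terms in HwL.
set q := 2 / (n%:R * (1 + eps)) in Ka *.
have q0 : 0 <= q by rewrite divr_ge0// mulr_ge0// ltW.
have {}Ok := ler_wpM2l (mulr_ge0 (ltW N0) H0) Ok.
have {}Gr := ler_wpM2l (addr_ge0 ler01 q0) Gr.
have -> : n%:R * (n%:R - 2) * H / Num.sqrt (n%:R * (n%:R - 1)) * w ^+ 3 =
  n%:R * H * ((n%:R - 2) / Num.sqrt (n%:R * (n%:R - 1)) * w ^+ 3) by ring.
rewrite mulrN in Ok; rewrite mulrDl mul1r in Gr; rewrite mulrDl mul1r in Ka.
move: HwL Ka Gr Ok; rewrite [(1 + q) * _]mulrDl mul1r.
lra.
Qed.

End Kato.
End Algebra.

(** * Change of coordinates *)

HB.lock Definition Gam (R : realType) (n : nat) (g : 'rV[R]_n.+1 -> 'M[R]_n.+1)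
    (f : 'rV[R]_n -> 'rV[R]_n.+1) (u v y : 'rV[R]_n) : 'rV[R]_n :=
  nabla_induced g f u (cst v) y.

Section Local.
Variables (R : realType) (n : nat) (V : set 'rV[R]_n.+1) (g : 'rV[R]_n.+1 -> 'M[R]_n.+1).
Hypothesis gm : metric_on V g.
Variables (U : set 'rV[R]_n) (f nu : 'rV[R]_n -> 'rV[R]_n.+1).
Hypotheses (oU : open U) (fV : forall y, U y -> V (f y)) (fs : smooth U f) (nus : smooth U nu).
Local Notation e := basis_vec.
Local Notation G := (first_form g f).
Local Notation h := (sff g f nu).
Hypothesis nu1 : forall y, U y -> ipf g f nu nu y = 1.
Hypothesis nuT : forall y, U y -> forall a, ipf g f nu (tangent f a) y = 0.

Definition first_form_mx y : 'M[R]_n := \matrix_(a, b) G a b y.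
Definition sff_mx y : 'M[R]_n := \matrix_(a, b) h a b y.
Local Notation Gm := first_form_mx.
Local Notation hm := sff_mx.
Local Notation B := (quot_mx Gm hm).
Hypothesis Gu : forall y, U y -> Gm y \in unitmx.

Let gsym y : U y -> (g (f y))^T = g (f y).
Proof. by move=> /fV Vy; case: gm => _ _ + _; apply. Qed.

Lemma induced_metricE y : induced_metric g f y = Gm y.
Proof.
by apply/matrixP => a b; rewrite !mxE /first_form /ipf /tangent iprod.unlock dd.unlock.
Qed.

Lemma first_form_mx_sym y : U y -> (Gm y)^T = Gm y.
Proof. by move=> Uy; apply/matrixP => a b; rewrite !mxE /first_form (ipfC gm fV). Qed.

Lemma sff_mx_sym y : U y -> (hm y)^T = hm y.
Proof. by move=> Uy; apply/matrixP => a b; rewrite !mxE (sff_sym gm nu oU fV fs). Qed.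

Lemma ip_df y u v : U y -> iprod (g (f y)) (dd u f y) (dd v f y) = iprod (Gm y) u v.
Proof.
move=> Uy; have df := smooth_diff fs Uy.
rewrite (dd_dir_basis u df) (dd_dir_basis v df) ip_suml ip_sum2.
apply: eq_bigr => a _; rewrite ip_sumr; apply: eq_bigr => b _.
by rewrite ipZl ipZr mxE /first_form /ipf /tangent; ring.
Qed.

Lemma nu_df y u : U y -> iprod (g (f y)) (nu y) (dd u f y) = 0.
Proof.
move=> Uy; rewrite (dd_dir_basis u (smooth_diff fs Uy)) ip_sumr big1// => a _.
by rewrite ipZr -[iprod _ _ _]/(ipf g f nu (tangent f a) y) nuT// mulr0.
Qed.

Lemma nabla_alongE u X y : nabla_along g f u X y = cov g f u X y.
Proof. by rewrite /cov dd.unlock chr.unlock. Qed.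

Lemma GamE u v y : Gam g f u v y =
  (\row_a iprod (g (f y)) (cov g f u (dd v f) y) (tangent f a y)) *m invmx (Gm y).
Proof.
rewrite Gam.unlock /nabla_induced induced_metricE; congr (_ *m _).
by apply/rowP => a; rewrite !mxE nabla_alongE iprod.unlock /tangent dd.unlock.
Qed.

(** This determines [Gam], the induced metric being nondegenerate, so that its symmetry and
    linearity are inherited from [cov]. *)
Lemma Gam_tangential u v w y : U y ->
  iprod (g (f y)) (dd (Gam g f u v y) f y) (dd w f y) =
  iprod (g (f y)) (cov g f u (dd v f) y) (dd w f y).
Proof.
move=> Uy; rewrite ip_df// GamE ip_mulmx_invmx ?Gu//.
rewrite (dd_dir_basis w (smooth_diff fs Uy)) ip_sumr; apply: eq_bigr => a _.
by rewrite mxE ipZr mulrC.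
Qed.

Let induced_inj y u v : U y ->
  (forall w, iprod (g (f y)) (dd u f y) (dd w f y) = iprod (g (f y)) (dd v f y) (dd w f y)) -> u = v.
Proof. by move=> Uy H; apply: (ip_inj (Gu Uy)) => w; rewrite -!ip_df. Qed.

Lemma Gam_sym u v y : U y ->
  Gam g f u v y = Gam g f v u y.
Proof.
move=> Uy; apply: (induced_inj Uy) => w.
by rewrite !Gam_tangential// (cov_swap gm oU fV fs).
Qed.

Lemma Gam_linl v y : U y -> linear (fun u => Gam g f u v y).
Proof.
move=> Uy a u u'; apply: (induced_inj Uy) => w.
have df := smooth_diff fs Uy; have Vy := fV Uy.
rewrite Gam_tangential// (dd_dirD _ _ df) (dd_dirZ _ _ df) [RHS]ipDl [X in _ = X + _]ipZl !Gam_tangential//.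
have dvf := smooth_diff (smooth_dd v fs) Uy.
rewrite /cov !(dd_dirD _ _ df) !(dd_dirZ _ _ df) !(dd_dirD _ _ dvf) !(dd_dirZ _ _ dvf).
by rewrite (chrDl gm)// (chrZl gm)// !ipDl !ipZl; ring.
Qed.

Lemma Gam_linr u y : U y -> linear (fun v => Gam g f u v y).
Proof.
move=> Uy a v v'; rewrite Gam_sym// Gam_linl//.
by rewrite (Gam_sym _ u Uy) (Gam_sym v' u Uy).
Qed.

(** The tangential correction in [second_form] is orthogonal to [nu] and drops out of the
    pairing. *)
Lemma shape_operatorE y : U y -> shape_operator g f nu y = B y.
Proof.
move=> Uy; rewrite /shape_operator /quot_mx induced_metricE; congr (_ *m _).
apply/matrixP => a b; rewrite !mxE /second_form.
transitivity (iprod (g (f y)) (nu y)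
    (cov g f (e a) (tangent f b) y - dd (Gam g f (e a) (e b) y) f y)).
  by rewrite Gam.unlock -nabla_alongE /tangent dd.unlock iprod.unlock.
by rewrite ipBr nu_df// subr0 (ipC _ _ (gsym Uy)).
Qed.

Hypothesis n_gt0 : (0 < n)%N.
Variable H : R.
Hypothesis cmc : forall y, U y -> mean_curvature g f nu y = H.

Lemma trace_quot_mx y : U y -> \tr (B y) = n%:R * H.
Proof.
move=> Uy; rewrite -(cmc Uy) /mean_curvature shape_operatorE// mulrA mulfV ?mul1r//.
by rewrite pnatr_eq0 -lt0n.
Qed.

Lemma traceless_shapeE y : U y -> traceless_shape g f nu y = B y - H%:M.
Proof. by move=> Uy; rewrite /traceless_shape cmc// shape_operatorE. Qed.

Definition norm_phi2 y := \tr (B y *m B y) - n%:R * H ^+ 2.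

Lemma norm_tracelessE y : U y -> norm_traceless g f nu y = Num.sqrt (norm_phi2 y).
Proof.
move=> Uy; rewrite /norm_traceless induced_metricE traceless_shapeE//; congr Num.sqrt.
(* phi is self-adjoint for the induced metric, so the adjoint in the definition of the norm is phi
   itself. *)
have E : Gm y *m (B y - H%:M)^T = (B y - H%:M) *m Gm y.
  rewrite linearB /= tr_scalar_mx mulmxBr mulmxBl /quot_mx mulmxKV ?Gu//.
  rewrite trmx_mul trmx_inv first_form_mx_sym// sff_mx_sym// mulKVmx ?Gu//.
  by rewrite scalar_mxC.
rewrite E mulmxK ?Gu// mulmxBl !mulmxBr !raddfB /= !mul_scalar_mx !mul_mx_scalar.
rewrite !mxtraceZ mxtrace_scalar trace_quot_mx// /norm_phi2 -mulr_natl; ring.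
Qed.

End Local.

(** * Gradient and Laplacian in an orthonormal frame *)

Section Frame.
Variables (R : realType) (n : nat) (G : 'M[R]_n) (e : 'I_n -> 'rV[R]_n).
Hypothesis ee : forall a b, iprod G (e a) (e b) = (a == b)%:R.
Definition frame_mx : 'M[R]_n := \matrix_a e a.

Lemma mulmx_ip m (A : 'M[R]_n) (J K : 'M[R]_(m, n)) a b :
  (J *m A *m K^T) a b = iprod A (row a J) (row b K).
Proof.
rewrite iprod.unlock /bil tr_row -row_mul mxE [RHS]mxE.
by apply: eq_bigr => c _; congr (_ * _); rewrite [RHS]mxE.
Qed.

Lemma frame_mx_orthonormal : frame_mx *m G *m frame_mx^T = 1%:M.
Proof. by apply/matrixP => a b; rewrite mulmx_ip !rowK ee mxE. Qed.

Lemma frame_mx_unit : frame_mx \in unitmx.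
Proof.
by have := mulmx1_unit frame_mx_orthonormal => -[_]; rewrite unitmx_tr.
Qed.

(** Through this factorization contractions with the inverse metric become sums over the orthonormal
    frame. *)
Lemma invmx_frame : invmx G = frame_mx^T *m frame_mx.
Proof.
have H := mulmx1C frame_mx_orthonormal; rewrite mulmxA in H.
have [_ Gu] := mulmx1_unit H.
by rewrite -[LHS]mul1mx -H mulmxK.
Qed.
End Frame.

Section Operators.
Variables (R : realType) (n : nat) (V : set 'rV[R]_n.+1) (g : 'rV[R]_n.+1 -> 'M[R]_n.+1).
Hypothesis gm : metric_on V g.
Variables (U : set 'rV[R]_n) (f : 'rV[R]_n -> 'rV[R]_n.+1).
Hypotheses (oU : open U) (fV : forall y, U y -> V (f y)) (fs : smooth U f).
Local Notation Gm := (first_form_mx g f).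
Hypothesis Gu : forall y, U y -> Gm y \in unitmx.
Variables (x : 'rV[R]_n) (F : 'rV[R]_n -> R).
Hypotheses (Ux : U x) (Fs : smooth U F).
Variable e : 'I_n -> 'rV[R]_n.
Hypothesis ee : forall a b, iprod (Gm x) (e a) (e b) = (a == b)%:R.

Lemma grad_sqr : bil (induced_metric g f x) (grad g f F x) (grad g f F x) =
  \sum_k dd (e k) F x ^+ 2.
Proof.
rewrite -[LHS]/(bil _ _ _) -[bil]iprod.unlock /grad !induced_metricE ip_mulmx_invmx ?Gu//.
set r := \row_a _; pose P := frame_mx e.
have rP k : (r *m P^T) 0 k = dd (e k) F x.
  rewrite (dd_dir_basis (e k) (smooth_diff Fs Ux)) mxE; apply: eq_bigr => a _.
  by rewrite !mxE ddE mulrC.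
rewrite (invmx_frame ee) mulmxA -/P.
transitivity ((r *m P^T *m (r *m P^T)^T) 0 0).
  rewrite trmx_mul trmxK mulmxA [RHS]mxE; apply: eq_bigr => a _.
  by rewrite mulrC; congr (_ * _); rewrite [RHS]mxE.
by rewrite mxE; apply: eq_bigr => k _; rewrite [X in _ * X]mxE !rP expr2.
Qed.

Definition hess u v := dd u (dd v F) x - dd (Gam g f u v x) F x.

Lemma hess_basis u v : hess u v = \sum_a \sum_b u 0 a * hess (basis_vec a) (basis_vec b) * v 0 b.
Proof.
have dF := smooth_diff Fs Ux.
have E1 : dd u (dd v F) x = \sum_a \sum_b u 0 a * dd (basis_vec a) (dd (basis_vec b) F) x * v 0 b.
  rewrite (dd_dir_basis u (smooth_diff (smooth_dd v Fs) Ux)); apply: eq_bigr => a _.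
  rewrite (@dd_ext _ _ _ _ (fun y => \sum_b v 0 b * dd (basis_vec b) F y) U)//; last first.
    by move=> y Uy; rewrite (dd_dir_basis v (smooth_diff Fs Uy)).
  have dc b : differentiable (fun _ : 'rV[R]_n => v 0 b) x by exact: differentiable_cst.
  have db b : differentiable (dd (basis_vec b) F) x by exact: smooth_diff (smooth_dd _ Fs) Ux.
  rewrite dd_sum => [|b]; last by apply: differentiable_mul.
  rewrite -[LHS]/(_ * _) mulr_sumr; apply: eq_bigr => b _.
  by rewrite (dd_mul _ (dc b) (db b)) dd_cst mul0r add0r; ring.
have E2 : dd (Gam g f u v x) F x =
    \sum_a \sum_b u 0 a * dd (Gam g f (basis_vec a) (basis_vec b) x) F x * v 0 b.
  rewrite (@lin_basis _ _ _ _ _ (fun y u => Gam g f u v y) U (fun y Uy => Gam_linl gm fV fs Gu v Uy) _ _ Ux).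
  rewrite dd_dir_sum//; apply: eq_bigr => a _.
  rewrite (@lin_basis _ _ _ _ _ (fun y v => Gam g f (basis_vec a) v y) U
    (fun y Uy => Gam_linr gm oU fV fs Gu (basis_vec a) Uy) _ _ Ux).
  rewrite dd_dir_sum// -[LHS]/(_ * _) mulr_sumr; apply: eq_bigr => b _.
  by rewrite -[_ *: _]/(_ * _); ring.
rewrite {1}/hess E1 E2 -sumrB; apply: eq_bigr => a _; rewrite -sumrB; apply: eq_bigr => b _.
by rewrite /hess; ring.
Qed.

Lemma laplacian_frame : laplacian g f F x = \sum_k hess (e k) (e k).
Proof.
rewrite /laplacian induced_metricE (invmx_frame ee) mulmxA.
set Hs := \matrix_(a, b) _; set P := frame_mx e.
rewrite mxtrace_mulC mulmxA; apply: eq_bigr => k _.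
rewrite mulmx_ip ip_sum2 hess_basis; apply: eq_bigr => a _; apply: eq_bigr => b _.
rewrite !rowK mxE; congr (_ * _ * _).
by rewrite /hessian /hess Gam.unlock dd.unlock.
Qed.

End Operators.

(** * The quadratic chart and the chain rule *)

Section Quadratic.
Variables (R : realType) (n : nat) (x : 'rV[R]_n) (P : 'M[R]_n) (Q : 'rV[R]_n -> 'rV[R]_n -> 'rV[R]_n).
Hypothesis Q1 : forall v, linear (Q ^~ v).
Hypothesis Q2 : forall u, linear (Q u).
Hypothesis Qsym : forall u v, Q u v = Q v u.

(* A chart around x whose coordinate fields at 0 are the rows of P,
   with second derivatives prescribed by -Q. *)
Definition quad_chart (z : 'rV[R]_n) : 'rV[R]_n :=
  x + z *m P - 2^-1 *: Q (z *m P) (z *m P).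
Local Notation psi := quad_chart.

Let linP z : smooth setT (fun z : 'rV[R]_n => z *m P) /\ forall v, dd v (fun z : 'rV[R]_n => z *m P) z = v *m P.
Proof.
have c : smooth setT (fun _ : 'rV[R]_n => P) by exact: smooth_cst.
split=> [k|v]; first exact: (Ck_mulmx openT (smooth_id setT k) (c k)).
rewrite (dd_mulmx _ (smooth_diff (smooth_id setT) I) (smooth_diff c I)).
by rewrite dd_id dd_cst mulmx0 addr0.
Qed.

Let Qc a b : smooth setT (fun _ : 'rV[R]_n => Q a b). Proof. exact: smooth_cst. Qed.
Let QQ := fun z : 'rV[R]_n => Q (z *m P) (z *m P).

Let smooth_QQ : smooth setT QQ.
Proof.
have [Ps _] := linP 0.
exact: (smooth_family2 (T := fun _ => Q) openT openT (fun _ _ => I) (smooth_id setT)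
  (fun _ _ => Q1) (fun _ _ => Q2) Qc Ps Ps).
Qed.

Let dd_QQ v z : dd v QQ z = 2 *: Q (v *m P) (z *m P).
Proof.
have [Ps dP] := linP z.
rewrite (dd_family2 (T := fun _ => Q) openT openT (fun _ _ => I) (smooth_id setT)
  (fun _ _ => Q1) (fun _ _ => Q2) Qc Ps Ps v I) dd_cst add0r dP.
by rewrite [X in _ + X]Qsym scaler_nat mulr2n.
Qed.

Lemma smooth_quad_chart : smooth setT psi.
Proof.
have [Ps _] := linP 0.
have c : smooth setT (fun _ : 'rV[R]_n => x) by exact: smooth_cst.
apply: (smoothD openT); first exact: (smoothD openT c Ps).
move=> k; under eq_fun do rewrite -scaleNr.
exact: (CkZ (- 2^-1) openT (smooth_QQ k)).
Qed.

Lemma dd_quad_chart v z : dd v psi z = v *m P - Q (v *m P) (z *m P).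
Proof.
have [Ps dP] := linP z.
have dc : differentiable (fun _ : 'rV[R]_n => x) z by exact: differentiable_cst.
have dPz := smooth_diff Ps (I : setT z).
have dh : differentiable (fun _ : 'rV[R]_n => 2^-1 : R) z by exact: differentiable_cst.
have dQ := smooth_diff smooth_QQ (I : setT z).
rewrite (@ddB _ _ _ (fun z : 'rV[R]_n => x + z *m P) (fun z => 2^-1 *: QQ z)).
- rewrite (ddD _ dc dPz) dd_cst add0r dP (dd_scale _ dh dQ) dd_cst scale0r add0r.
  by rewrite dd_QQ scalerA mulVf ?pnatr_eq0// scale1r.
- exact: differentiableD.
- exact: (differentiable_scale dh dQ).
Qed.

Lemma dd_dd_quad_chart u v z : dd u (dd v psi) z = - Q (v *m P) (u *m P).
Proof.
have [Ps dP] := linP z.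
rewrite (@dd_ext _ _ _ _ (fun z : 'rV[R]_n => v *m P - Q (v *m P) (z *m P)) setT)//; last first.
- by move=> y _; exact: dd_quad_chart.
- exact: openT.
have Qs : smooth setT (fun z : 'rV[R]_n => Q (v *m P) (z *m P)).
  exact: (smooth_family2r (T := fun _ => Q) openT openT (fun _ _ => I) (smooth_id setT)
    (fun _ _ => Q2) Qc Ps (v *m P)).
have dc : differentiable (fun _ : 'rV[R]_n => v *m P) z by exact: differentiable_cst.
rewrite (ddB _ dc (smooth_diff Qs I)) dd_cst sub0r; congr (- _).
have dPz := smooth_diff Ps (I : setT z).
rewrite (@dd_apply _ _ _ _ _ (fun _ b => Q (v *m P) b) (fun z : 'rV[R]_n => z *m P) setT)//.
  by rewrite dd_cst add0r dP.
exact: openT.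
Qed.

Lemma quad_chart0 : psi 0 = x.
Proof.
have -> : psi 0 = x + 0 - 2^-1 *: Q 0 0 by rewrite /psi mul0mx.
have := Q1 0 1 0 0; rewrite !scale1r addr0 => E.
have -> : Q 0 0 = 0 by apply: (addrI (Q 0 0)); rewrite addr0 -E.
by rewrite scaler0 subr0 addr0.
Qed.

End Quadratic.

Section Chain.
Variables (R : realType) (k n : nat) (U : set 'rV[R]_k) (U' : set 'rV[R]_n).
Variable psi : 'rV[R]_k -> 'rV[R]_n.
Hypotheses (oU : open U) (oU' : open U') (UU : forall z, U z -> U' (psi z)) (ps : smooth U psi).

Lemma dd_chain (p q : nat) (X : 'rV[R]_n -> 'M[R]_(p, q)) v z : smooth U' X -> U z ->
  dd v (fun z => X (psi z)) z = dd (dd v psi z) X (psi z).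
Proof.
by move=> Xs Uz; apply: dd_comp; [exact: smooth_diff Uz|exact: smooth_diff (UU Uz)].
Qed.

Lemma dd_dd_chain (p q : nat) (X : 'rV[R]_n -> 'M[R]_(p, q)) u v z : smooth U' X -> U z ->
  dd u (dd v (fun z => X (psi z))) z =
  dd (dd u psi z) (dd (dd v psi z) X) (psi z) + dd (dd u (dd v psi) z) X (psi z).
Proof.
move=> Xs Uz.
rewrite (@dd_ext _ _ _ _ (fun z => dd (dd v psi z) X (psi z)) U)//; last first.
  by move=> y Uy; exact: dd_chain.
have L y : U y -> linear (fun a => dd a X (psi y)).
  move=> Uy a b c; have dX := smooth_diff Xs (UU Uy).
  by rewrite dd_dirD// dd_dirZ.
rewrite (@dd_apply _ _ _ _ _ (fun y a => dd a X (psi y)) (dd v psi) U)//; last first.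
- exact: smooth_diff (smooth_dd v ps) Uz.
- move=> a; apply: (smooth_diff _ Uz).
  exact: (smooth_comp_mx oU oU' UU ps (smooth_dd (basis_vec a) Xs)).
congr (_ + _).
apply: (dd_comp _ (smooth_diff ps Uz)).
exact: smooth_diff (smooth_dd _ Xs) (UU Uz).
Qed.

Lemma dd_chain_scalar (F : 'rV[R]_n -> R) v z : smooth U' F -> U z ->
  dd v (fun z => F (psi z)) z = dd (dd v psi z) F (psi z).
Proof.
by move=> Xs Uz; apply: dd_comp; [exact: smooth_diff Uz|exact: smooth_diff (UU Uz)].
Qed.

(** Reduced to the matrix case through 1 x 1 matrices, because [dd_apply] is about matrix values. *)
Lemma dd_dd_chain_scalar (F : 'rV[R]_n -> R) u v z : smooth U' F -> U z ->
  dd u (dd v (fun z => F (psi z))) z =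
  dd (dd u psi z) (dd (dd v psi z) F) (psi z) + dd (dd u (dd v psi) z) F (psi z).
Proof.
move=> Fs Uz; pose X y : 'M[R]_(1, 1) := const_mx (F y).
have Xs : smooth U' X.
  by move=> l; apply/Ck_mxP => // a b; under eq_fun do rewrite mxE; exact: Fs.
have e1 (m : nat) (W : set 'rV[R]_m) (Y : 'rV[R]_m -> 'M[R]_(1, 1)) (H : 'rV[R]_m -> R) w y :
    open W -> smooth W Y -> (forall y, W y -> Y y 0 0 = H y) -> W y -> dd w Y y 0 0 = dd w H y.
  move=> oW Ys YH Wy; rewrite (dd_entry _ _ _ (smooth_diff Ys Wy)).
  exact: dd_ext oW Wy YH.
have XF y : X y 0 0 = F y by rewrite mxE.
have XPs := smooth_comp_mx oU oU' UU ps Xs; have Uz' := UU Uz.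
have := congr1 (fun A : 'M[R]_(1, 1) => A 0 0) (dd_dd_chain u v Xs Uz).
rewrite [RHS]mxE.
rewrite (e1 _ _ _ (dd v (fun z => F (psi z))) _ _ oU (smooth_dd v XPs))//; last first.
  by move=> y Uy; apply: (e1 _ _ _ _ _ _ oU XPs) => // t _; exact: XF.
rewrite (e1 _ _ _ (dd (dd v psi z) F) _ _ oU' (smooth_dd _ Xs))//; last first.
  by move=> y Uy; apply: (e1 _ _ _ _ _ _ oU' Xs).
by rewrite (e1 _ _ _ F _ _ oU' Xs).
Qed.

Lemma smooth_comp_scalar (F : 'rV[R]_n -> R) : smooth U' F -> smooth U (fun z => F (psi z)).
Proof. by move=> Fs l; exact: (Ck_comp oU UU (ps l) (Fs l)). Qed.

Variables (m : nat) (V : set 'rV[R]_m) (g : 'rV[R]_m -> 'M[R]_m) (f : 'rV[R]_n -> 'rV[R]_m).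
Hypotheses (gm : metric_on V g) (fV : forall y, U' y -> V (f y)) (fs : smooth U' f).

Lemma cov_chain v (X : 'rV[R]_n -> 'rV[R]_m) z : smooth U' X -> U z ->
  cov g (fun z => f (psi z)) v (fun z => X (psi z)) z = cov g f (dd v psi z) X (psi z).
Proof. by move=> Xs Uz; rewrite /cov !dd_chain. Qed.

(** The second derivatives of the chart add a tangential vector; prescribing them is what makes the
    tangential part vanish at the origin. *)
Lemma cov_dd_chain u v z : U z ->
  cov g (fun z => f (psi z)) u (dd v (fun z => f (psi z))) z =
  cov g f (dd u psi z) (dd (dd v psi z) f) (psi z) + dd (dd u (dd v psi) z) f (psi z).
Proof. by move=> Uz; rewrite /cov dd_dd_chain// !dd_chain// addrAC. Qed.

End Chain.

Lemma continuous_smooth (R : realType) (V W : normedModType R) (F : V -> W) :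
  smooth setT F -> continuous F.
Proof. by move=> Fs x; apply: differentiable_continuous; exact: smooth_diff Fs I. Qed.

Lemma smooth_norm_phi2 (R : realType) n (V : set 'rV[R]_n.+1) (g : 'rV[R]_n.+1 -> 'M[R]_n.+1)
    (gm : metric_on V g) (U : set 'rV[R]_n) (f nu : 'rV[R]_n -> 'rV[R]_n.+1) (oU : open U)
    (fV : forall y, U y -> V (f y)) (fs : smooth U f) (nus : smooth U nu)
    (Gu : forall y, U y -> first_form_mx g f y \in unitmx) (H : R) :
  smooth U (norm_phi2 g f nu H).
Proof.
have Gs : smooth U (first_form_mx g f).
  move=> k; apply/Ck_mxP => // a b; under eq_fun do rewrite mxE.
  exact (smooth_first_form gm oU fV fs a b k).
have hs : smooth U (sff_mx g f nu).
  move=> k; apply/Ck_mxP => // a b; under eq_fun do rewrite mxE.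
  exact (smooth_sff gm oU fV fs nus a b k).
have Bs := smooth_quot_mx oU Gs hs Gu.
apply: (smoothD oU); last exact: smooth_cst.
by apply: (smooth_trace oU); exact: (smooth_mulmx oU Bs Bs).
Qed.

(** * The inequality at a point where phi does not vanish *)

Section LocalTheorem.
Variables (R : realType) (n : nat) (V : set 'rV[R]_n.+1) (g : 'rV[R]_n.+1 -> 'M[R]_n.+1).
Hypothesis gm : metric_on V g.
Variables (U : set 'rV[R]_n) (f nu : 'rV[R]_n -> 'rV[R]_n.+1).
Hypotheses (oU : open U) (fV : forall y, U y -> V (f y)) (fs : smooth U f) (nus : smooth U nu).
Hypothesis nu1 : forall y, U y -> ipf g f nu nu y = 1.
Hypothesis nuT : forall y, U y -> forall a, ipf g f nu (tangent f a) y = 0.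
Local Notation Gm := (first_form_mx g f).
Local Notation hm := (sff_mx g f nu).
Local Notation B := (quot_mx Gm hm).
Hypothesis Gu : forall y, U y -> Gm y \in unitmx.
Variable H : R.
Hypothesis trB : forall y, U y -> \tr (B y) = n%:R * H.
Local Notation phi2 := (norm_phi2 g f nu H).
Hypothesis phi2_gt0 : forall y, U y -> 0 < phi2 y.
Variables (x : 'rV[R]_n) (e : 'I_n -> 'rV[R]_n) (lam : 'I_n -> R).
Hypothesis Ux : U x.
Hypothesis ee : forall a b, iprod (Gm x) (e a) (e b) = (a == b)%:R.
Hypothesis eB : forall a, e a *m B x = lam a *: e a.

(** Expresses the second form through the derivative of [nu], which involves only first derivatives
    of a change of chart. The transformation law [hmtE] follows without the second derivatives of
    [psi]. *)
Lemma ip_dnormal y u v : U y -> iprod (g (f y)) (cov g f u nu y) (dd v f y) = - iprod (hm y) u v.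
Proof.
move=> Uy; rewrite (row_sum_basis u) (cov_dir_sum gm fV fs _ _ nus Uy).
rewrite (dd_dir_basis v (smooth_diff fs Uy)) -row_sum_basis ip_suml ip_sum2 -sumrN.
apply: eq_bigr => a _; rewrite ip_sumr -sumrN; apply: eq_bigr => b _.
rewrite ipZl ipZr -[iprod _ _ _]/(ipf g f (dnormal g f nu a) (tangent f b) y).
by rewrite (dnormal_tangent gm oU fV fs nus nuT)// mxE; ring.
Qed.

Let hmE y : U y -> hm y = B y *m Gm y.
Proof. by move=> Uy; rewrite /quot_mx mulmxKV// Gu. Qed.

Let P := frame_mx e.
Let Q u v := Gam g f u v x.
Let Q1 v : linear (Q ^~ v). Proof. exact: (Gam_linl gm fV fs Gu v Ux). Qed.
Let Q2 u : linear (Q u). Proof. exact: (Gam_linr gm oU fV fs Gu u Ux). Qed.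
Let Qsym u v : Q u v = Q v u. Proof. exact: (Gam_sym gm oU fV fs Gu u v Ux). Qed.
Let psi := quad_chart x P Q.
Let J z : 'M[R]_n := \matrix_a dd (basis_vec a) psi z.
Let psis : smooth setT psi. Proof. exact: smooth_quad_chart. Qed.
Let psi0 : psi 0 = x. Proof. exact: quad_chart0. Qed.
(** Where the Jacobian is invertible the transported first form is invertible too, so the results of
    the previous parts apply to f o psi on this set. *)
Let Ut := (psi @^-1` U) `&` [set z | \det (J z) != 0].

Let eP a : basis_vec a *m P = e a.
Proof. by rewrite /basis_vec -rowE rowK. Qed.

Let dpsi0 a : dd (basis_vec a) psi 0 = e a.
Proof.
rewrite /psi (dd_quad_chart _ _ Q1 Q2 Qsym) mul0mx eP.
have := Q2 (e a) 1 0 0; rewrite !scale1r addr0 => E.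
have -> : Q (e a) 0 = 0 by apply: (addrI (Q (e a) 0)); rewrite addr0 -E.
by rewrite subr0.
Qed.

Let ddpsi a b : dd (basis_vec a) (dd (basis_vec b) psi) 0 = - Q (e b) (e a).
Proof. by rewrite /psi (dd_dd_quad_chart _ _ Q1 Q2 Qsym) !eP. Qed.

Let oUt : open Ut.
Proof.
apply: openI.
  by apply: open_comp => // z _; exact: continuous_smooth psis z.
have Js : smooth setT (fun z => \det (J z)).
  move=> k; apply: Ck_det; first exact: openT.
  apply/Ck_mxP; first exact: openT.
  move=> a b; under eq_fun do rewrite mxE.
  exact: ((Ck_mxP k (dd (basis_vec a) psi) openT).1 (smooth_dd _ psis k) 0 b).
apply: (@open_comp _ _ (fun z => \det (J z)) [set r | r != 0]).
  by move=> z _; exact: continuous_smooth Js z.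
exact: open_neq.
Qed.

Let Ut0 : Ut 0.
Proof.
split=> /=; first by rewrite psi0.
have -> : J 0 = P by apply/row_matrixP => a; rewrite !rowK dpsi0.
by rewrite -unitfE -unitmxE; exact: frame_mx_unit ee.
Qed.

Let UtU z : Ut z -> U (psi z). Proof. by case. Qed.
Let Ju z : Ut z -> J z \in unitmx. Proof. by case=> _ /=; rewrite unitmxE unitfE. Qed.
Let pst : smooth Ut psi. Proof. by move=> k; exact: Ck_sub (psis k). Qed.
Let ft z := f (psi z).
Let nt z := nu (psi z).
Let fts : smooth Ut ft. Proof. exact: (smooth_comp_mx oUt oU UtU pst fs). Qed.
Let nts : smooth Ut nt. Proof. exact: (smooth_comp_mx oUt oU UtU pst nus). Qed.
Let ftV z : Ut z -> V (ft z). Proof. by move=> /UtU/fV. Qed.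
Let tangentE a z : Ut z -> tangent ft a z = dd (row a (J z)) f (psi z).
Proof. by move=> Uz; rewrite rowK; exact: (dd_chain UtU pst _ fs Uz). Qed.

Let nt1 z : Ut z -> ipf g ft nt nt z = 1. Proof. by move=> /UtU/nu1. Qed.
Let ntT z : Ut z -> forall a, ipf g ft nt (tangent ft a) z = 0.
Proof. by move=> Uz a; rewrite /ipf tangentE//; exact: (nu_df fs nuT _ (UtU Uz)). Qed.

Let GmtE z : Ut z -> first_form_mx g ft z = J z *m Gm (psi z) *m (J z)^T.
Proof.
move=> Uz; apply/matrixP => a b; rewrite mulmx_ip mxE /first_form /ipf !tangentE//.
exact: (ip_df g fs _ _ (UtU Uz)).
Qed.

Let hmtE z : Ut z -> sff_mx g ft nt z = J z *m hm (psi z) *m (J z)^T.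
Proof.
move=> Uz; apply/matrixP => a b; rewrite mulmx_ip mxE.
apply: oppr_inj; rewrite -(dnormal_tangent gm oUt ftV fts nts ntT a b Uz).
rewrite -(ip_dnormal _ _ (UtU Uz)) /ipf tangentE//; congr (iprod _ _ _).
by rewrite rowK; exact: (cov_chain UtU pst g fs _ nus Uz).
Qed.

Let Gut z : Ut z -> first_form_mx g ft z \in unitmx.
Proof. by move=> Uz; rewrite GmtE// !unitmx_mul unitmx_tr Ju// Gu//; exact: UtU. Qed.

(** The shape operator changes by conjugation, so its trace and the trace of its square are those of
    the original chart. *)
Let BtE z : Ut z -> quot_mx (first_form_mx g ft) (sff_mx g ft nt) z =
  J z *m B (psi z) *m invmx (J z).
Proof.
move=> Uz; have Gz := Gut Uz; rewrite /quot_mx; apply: (canLR (mulmxK Gz)).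
by rewrite hmtE// GmtE// /quot_mx !mulmxA (mulmxKV (Ju Uz)) (mulmxKV (Gu (UtU Uz))).
Qed.

Let trBt z : Ut z -> \tr (sff_mx g ft nt z *m invmx (first_form_mx g ft z)) = n%:R * H.
Proof.
move=> Uz; rewrite -[_ *m _]/(quot_mx _ _ z) BtE// mxtrace_mulC mulmxA mulVmx ?Ju// mul1mx.
exact: trB (UtU Uz).
Qed.

Let normE z : Ut z -> norm_sff2 g ft nt z - n%:R * H ^+ 2 = phi2 (psi z).
Proof.
move=> Uz; rewrite /norm_phi2; congr (_ - _).
rewrite -[LHS]/(\tr (quot_mx (first_form_mx g ft) (sff_mx g ft nt) z
  *m quot_mx (first_form_mx g ft) (sff_mx g ft nt) z)).
rewrite BtE// -!mulmxA (mulmxA (invmx _) (J z)) mulVmx ?Ju// mul1mx mxtrace_mulC.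
by rewrite !mulmxA mulmxKV// ?Ju.
Qed.

Let E a := dd (e a) f x.
Let tangent0 a : tangent ft a 0 = E a.
Proof. by rewrite tangentE// rowK dpsi0 psi0. Qed.

Let Gt0 a b : first_form g ft a b 0 = (a == b)%:R.
Proof. by rewrite /first_form /ipf !tangent0 /ft psi0 (ip_df g fs _ _ Ux) ee. Qed.

(** The tangential part of the covariant second derivative is given by the Christoffel vector [Q],
    and the second derivative of [psi] is minus the same vector. *)
Let Tt0 a b c : ipf g ft (hess_map g ft a b) (tangent ft c) 0 = 0.
Proof.
rewrite /ipf tangent0 /hess_map /tangent (cov_dd_chain oUt oU UtU pst g fs _ _ Ut0).
rewrite !dpsi0 ddpsi /ft psi0 -scaleN1r (dd_dirZ _ _ (smooth_diff fs Ux)) scaleN1r ipDl ipNl.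
rewrite Qsym [X in _ - X](Gam_tangential fs Gu _ _ _ Ux).
exact: subrr.
Qed.

Let ht0 a b : sff g ft nt a b 0 = (a == b)%:R * lam a.
Proof.
have -> : sff g ft nt a b 0 = sff_mx g ft nt 0 a b by rewrite mxE.
rewrite hmtE// mulmx_ip !rowK !dpsi0 psi0 (hmE Ux) -ee mulrC -ipZl -eB.
by rewrite iprod.unlock /bil !mulmxA.
Qed.

Variable eps : R.
Hypotheses (H_ge0 : 0 <= H) (eps_gt0 : 0 < eps).
Local Notation F := (fun y => Num.sqrt (phi2 y)).
Let y := f x.
Let Nu := nu x.
Let w := F x.
Let mu a := lam a - H.
Let K a b := iprod (g y) (Rm g y (E a) (E b) (E b)) (E a).
Let N a := iprod (g y) (Rm g y Nu (E a) (E a)) Nu.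
Let dR d c a b := iprod (g y) (dRm g y (E d) (E c) (E a) (E b)) Nu.

Let phi2s : smooth U phi2. Proof. exact: (smooth_norm_phi2 gm oU fV fs nus Gu H). Qed.

Lemma smooth_norm_phi : smooth U F.
Proof. by move=> k; exact: Ck_sqrt. Qed.

Let Fs := smooth_norm_phi.
Let W z := F (psi z).
Let Ws : smooth Ut W. Proof. exact: (smooth_comp_scalar oUt UtU pst Fs). Qed.

Let W2 z : Ut z -> norm_sff2 g ft nt z = W z * W z + n%:R * H ^+ 2.
Proof.
move=> Uz; rewrite -[W z * W z]expr2 sqr_sqrtr ?(ltW (phi2_gt0 (UtU Uz)))//.
by rewrite -normE// subrK.
Qed.

Let dd_norm z v : Ut z -> dd v (norm_sff2 g ft nt) z = 2 * (W z * dd v W z).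
Proof.
move=> Uz; have dW := smooth_diff Ws Uz.
have dc : differentiable (fun _ : 'rV[R]_n => n%:R * H ^+ 2 : R) z by exact: differentiable_cst.
rewrite (dd_ext v oUt Uz W2) (ddD _ (differentiable_mul dW dW) dc) dd_cst addr0.
by rewrite (dd_mul _ dW dW); ring.
Qed.

Let dd_dd_norm v : dd v (dd v (norm_sff2 g ft nt)) 0 = 2 * (dd v W 0 ^+ 2 + W 0 * dd v (dd v W) 0).
Proof.
have dW := smooth_diff Ws Ut0; have ddW := smooth_diff (smooth_dd v Ws) Ut0.
have dc : differentiable (fun _ : 'rV[R]_n => 2 : R) 0 by exact: differentiable_cst.
rewrite (dd_ext v oUt Ut0 (fun z Uz => dd_norm v Uz)).
rewrite (dd_mul _ dc (differentiable_mul dW ddW)) dd_cst mul0r add0r.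
by rewrite (dd_mul _ dW ddW) expr2.
Qed.

Let W0 : W 0 = w. Proof. by rewrite /W psi0. Qed.
Let dW0 k : dd (basis_vec k) W 0 = dd (e k) F x.
Proof.
by rewrite (dd_chain_scalar UtU pst (basis_vec k) Fs Ut0) dpsi0 psi0.
Qed.
(** The second derivative of [psi] supplies exactly the Christoffel term of the Hessian on M, so
    plain second derivatives in this chart suffice. *)
Let ddW0 k : dd (basis_vec k) (dd (basis_vec k) W) 0 = hess g f x F (e k) (e k).
Proof.
rewrite (dd_dd_chain_scalar oUt oU UtU pst (basis_vec k) (basis_vec k) Fs Ut0).
rewrite dpsi0 psi0 ddpsi -scaleN1r (dd_dirZ _ _ (smooth_diff Fs Ux)) scaleN1r.
by [].
Qed.

Theorem local_inequality :
  w * (\sum_k hess g f x F (e k) (e k)) + w ^+ 4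
  + n%:R * (n%:R - 2) * H / Num.sqrt (n%:R * (n%:R - 1)) * w ^+ 3
  - n%:R * H ^+ 2 * w ^+ 2 + w ^+ 2 * (\sum_a N a) - n%:R * H * (\sum_a mu a * N a)
  - (\sum_a \sum_k (2 * (mu a ^+ 2 * K k a) + 2 * (- (mu a * mu k * K k a))))
  - (\sum_a \sum_k (mu a * dR a k a k + mu k * dR a a k k))
  >= 2 / (n%:R * (1 + eps)) * (\sum_k dd (e k) F x ^+ 2)
     - 2 / eps * (\sum_a \sum_b iprod (g y) (Rm g y (E a) (E b) (E a)) Nu ^+ 2).
Proof.
have lamE a : lam a = mu a + H by rewrite subrK.
have w_gt0 : 0 < w by rewrite sqrtr_gt0 phi2_gt0.
have sl : \sum_a lam a = n%:R * H := trace_at Ut0 Gt0 ht0 trBt.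
have mu0 : \sum_a mu a = 0 by rewrite sumrB sl sum_const_ord subrr.
have w2 : w ^+ 2 = \sum_a mu a ^+ 2.
  rewrite sqr_sqrtr ?(ltW (phi2_gt0 Ux))// -psi0 -(normE Ut0) (norm_sff2_at Gt0 ht0).
  rewrite (eq_bigr (fun a => mu a ^+ 2 + (2 * H * mu a + H ^+ 2))) => [|a _]; last by rewrite lamE; ring.
  by rewrite !big_split /= -mulr_sumr mu0 mulr0 add0r sum_const_ord addrK.
(* With at most one principal value, the zero sum would force phi = 0, against [w_gt0]. *)
have n1 : (1 < n)%N.
  case: (ltnP 1 n) => // n1; have : 0 < w ^+ 2 by rewrite exprn_gt0.
  rewrite w2 big1 ?ltxx// => a _; have aa b : b = a.
    by apply: ord_inj; have := ltn_ord a; have := ltn_ord b; case: n n1 a b => [|[|]] //= _ [[]]//= _ [[]].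
  have := mu0; rewrite (bigD1 a)//= big1 ?addr0 => [-> |b]; first by rewrite expr0n.
  by rewrite (aa b) eqxx.
pose T c a b := dd (basis_vec c) (sff g ft nt a b) 0.
pose S c a b := codazzi_term g ft nt c a b 0.
have Tsym c a b : T c a b = T c b a.
  by apply: (dd_ext _ oUt Ut0) => z Uz; exact (sff_sym gm nt oUt ftV fts a b Uz).
have Tcod c a b : T c a b = T a c b + S c a b.
  exact: (codazzi_at gm oUt ftV fts nts nt1 ntT Ut0 Gt0 Tt0 ht0).
have Ttr c : \sum_a T c a a = 0.
  exact: (dd_trace_zero gm oUt ftV fts nts Ut0 Gt0 Tt0 Gut trBt).
(* Two expressions of the gradient of |A|^2 are compared: one from |phi|^2 + n H^2, the other from
   the diagonal of h. The shift by H contributes H times a vanishing trace. *)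
have wd k : w * dd (e k) F x = \sum_a mu a * T k a a.
  have := dd_norm (basis_vec k) Ut0; rewrite W0 dW0.
  rewrite (dd_norm_sff2 gm oUt ftV fts nts Ut0 Gt0 Tt0 ht0 Gut) => E2.
  have two0 : (2 : R) != 0 by rewrite pnatr_eq0.
  rewrite -(mulfI two0 E2).
  rewrite (eq_bigr (fun a => mu a * T k a a + H * T k a a)) => [|a _].
    by rewrite big_split /= -mulr_sumr Ttr mulr0 addr0.
  by rewrite -mulrDl -lamE.
have y0 : ft 0 = y by rewrite /ft psi0.
have nu0 : nt 0 = Nu by rewrite /nt psi0.
(* [simons] with m = H, where half the second derivative of W^2 is split into (dW)^2 + W ddW. *)
have wL : w * (\sum_k hess g f x F (e k) (e k)) + \sum_k dd (e k) F x ^+ 2 =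
    \sum_c \sum_a \sum_b T c a b ^+ 2
    + \sum_i \sum_k mu i * (dR k k i i + dR i k i k + (mu k + H) * N i - (mu i + H) * N k
      + (mu i + H - (mu k + H)) * (2 * K i k + (mu i + H) * (mu k + H))).
  rewrite mulr_sumr -big_split /=.
  rewrite (eq_bigr (fun k => 2^-1 * dd (basis_vec k) (dd (basis_vec k) (norm_sff2 g ft nt)) 0)) => [|k _].
    rewrite -mulr_sumr (simons gm oUt ftV fts nts nt1 ntT Ut0 Gt0 Tt0 ht0 Gut trBt H).
    congr (_ + _); apply: eq_bigr => i _; apply: eq_bigr => k _.
    by rewrite /sec_curv /sec_normal /dRm_normal !tangent0 y0 nu0 -!lamE.
  by rewrite dd_dd_norm dW0 ddW0 W0 addrC mulrA mulVf ?pnatr_eq0// mul1r.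
have SE a b : S a b a = iprod (g y) (Rm g y (E a) (E b) (E a)) Nu.
  by rewrite /S /codazzi_term /ipf !tangent0 y0 nu0.
have Vy : V y := fV Ux.
have Ksym a b : K a b = K b a.
  by rewrite /K (Rm_anti gm _ _ _ Vy) ipNl (Rm_skew gm Vy) opprK.
have := simons_inequality mu0 (ltW w_gt0) w2 n1 eps_gt0 Tsym Tcod Ttr w_gt0 H_ge0 Ksym wd wL.
by under [X in _ - _ * X <= _]eq_bigr do under eq_bigr do rewrite SE.
Qed.
End LocalTheorem.

(** * Positive definite matrices, derivatives at a minimum, traces *)

Lemma posdef_unitmx (R : realType) n (G : 'M[R]_n) :
  (forall u, u != 0 -> 0 < iprod G u u) -> G \in unitmx.
Proof.
move=> Gp; rewrite -row_free_unit -kermx_eq0; apply/rowV0P => u /sub_kermxP uG.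
apply/eqP/negP => /negP /Gp; rewrite iprod.unlock /bil uG mul0mx mxE ltxx.
by [].
Qed.

(* No differentiability is assumed: where the limit does not exist, ['D_v F x] is 0. *)
Lemma derive_at_min (R : realType) (V : normedModType R) (F : V -> R) x v :
  (forall y, F x <= F y) -> 'D_v F x = 0.
Proof.
move=> Fmin; rewrite /derive.
set q := fun t : R => _.
have [qc|qd] := pselect (cvg (q @ 0^')); last by rewrite dvgP.
set l := lim _.
have qpos t : 0 < t -> 0 <= q t.
  by move=> t0; rewrite /q -[_ *: _]/(_ * _) mulr_ge0 ?invr_ge0 ?(ltW t0)// subr_ge0 Fmin.
have qneg t : t < 0 -> q t <= 0.
  by move=> t0; rewrite /q -[_ *: _]/(_ * _) mulr_le0_ge0 ?invr_le0 ?(ltW t0)// subr_ge0 Fmin.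
apply/eqP; rewrite eq_le; apply/andP; split; rewrite leNgt; apply/negP => l0.
  have : \forall t \near 0^', 0 < q t by apply: (cvgr_gt l).
  move=> /nbhs_ballP[d /= d0] /(_ (- (d / 2))).
  have d2 : 0 < d / 2 by rewrite divr_gt0.
  rewrite -ball_normE /= sub0r opprK gtr0_norm// ltr_pdivrMr// ltr_pMr// ltr1n.
  have dn : - (d / 2) != 0 by rewrite oppr_eq0 gt_eqF.
  by move=> /(_ isT dn); rewrite ltNge qneg// oppr_lt0.
have : \forall t \near 0^', q t < 0 by apply: (cvgr_lt l).
move=> /nbhs_ballP[d /= d0] /(_ (d / 2)).
have d2 : 0 < d / 2 by rewrite divr_gt0.
rewrite -ball_normE /= sub0r normrN gtr0_norm// ltr_pdivrMr// ltr_pMr// ltr1n.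
have dn : d / 2 != 0 by rewrite gt_eqF.
by move=> /(_ isT dn); rewrite ltNge qpos.
Qed.

Section Trace.
Variables (R : realType) (n : nat) (G : 'M[R]_n) (E : 'I_n -> 'rV[R]_n).
Hypothesis EE : forall a b, iprod G (E a) (E b) = (a == b)%:R.

Lemma trace_orthonormal (L : 'rV[R]_n -> 'rV[R]_n) : linear L ->
  \sum_a L (basis_vec a) 0 a = \sum_i iprod G (L (E i)) (E i).
Proof.
move=> Ll; pose M : 'M[R]_n := \matrix_a L (basis_vec a).
have LM u : L u = u *m M.
  rewrite mulmx_sum_row (@lin_basis _ _ _ _ _ (fun _ : R => L) setT _ 0)//.
  by apply: eq_bigr => a _; rewrite rowK.
have -> : \sum_a L (basis_vec a) 0 a = \tr M by apply: eq_bigr => a _; rewrite mxE.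
have P1 := frame_mx_orthonormal EE; rewrite -mulmxA in P1.
rewrite -[M]mulmx1 -(mulmx1C P1) mulmxA mxtrace_mulC !mulmxA.
apply: eq_bigr => i _; rewrite mulmx_ip rowK row_mul rowK.
by rewrite LM.
Qed.

End Trace.

(** * The inequality in a given pair of charts *)

Section ChartInequality.
Variables (R : realType) (n : nat) (V : set 'rV[R]_n.+1) (g : 'rV[R]_n.+1 -> 'M[R]_n.+1).
Hypothesis gm : metric_on V g.
Variables (U : set 'rV[R]_n) (f nu : 'rV[R]_n -> 'rV[R]_n.+1).
Hypotheses (oU : open U) (fV : forall y, U y -> V (f y)) (fs : smooth U f) (nus : smooth U nu).
Hypothesis nu1 : forall y, U y -> ipf g f nu nu y = 1.
Hypothesis nuT : forall y, U y -> forall a, ipf g f nu (tangent f a) y = 0.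
Local Notation Gm := (first_form_mx g f).
Local Notation hm := (sff_mx g f nu).
Local Notation B := (quot_mx Gm hm).
Hypothesis Gu : forall y, U y -> Gm y \in unitmx.
Hypothesis n_gt0 : (0 < n)%N.
Variable H : R.
Hypothesis cmc : forall y, U y -> mean_curvature g f nu y = H.
Variables (x : 'rV[R]_n) (e : 'I_n -> 'rV[R]_n) (mu : 'I_n -> R) (eps : R).
Hypotheses (Ux : U x) (H_ge0 : 0 <= H) (eps_gt0 : 0 < eps).
Hypothesis ee : forall a b, iprod (Gm x) (e a) (e b) = (a == b)%:R.
Local Notation phi := (traceless_shape g f nu x).
Hypothesis ephi : forall a, e a *m phi = mu a *: e a.

Let y := f x.
Let Nu := nu x.
Let Vy : V y := fV Ux.
Let nrm := norm_traceless g f nu.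
Let lam a := mu a + H.
Local Notation phi2 := (norm_phi2 g f nu H).
Local Notation F := (fun y => Num.sqrt (phi2 y)).
Let E a := dd (e a) f x.
Let K a b := iprod (g y) (Rm g y (E a) (E b) (E b)) (E a).
Let N a := iprod (g y) (Rm g y Nu (E a) (E a)) Nu.
Let dR d c a b := iprod (g y) (dRm g y (E d) (E c) (E a) (E b)) Nu.

Let eB a : e a *m B x = lam a *: e a.
Proof.
have := ephi a; rewrite (traceless_shapeE gm fV fs nuT cmc Ux) mulmxBr mul_mx_scalar => /eqP.
by rewrite subr_eq => /eqP ->; rewrite -scalerDl.
Qed.

Let PB : frame_mx e *m B x = diag_mx (\row_a lam a) *m frame_mx e.
Proof.
apply/row_matrixP => a; rewrite row_mul rowK eB.
by apply/rowP => c; rewrite mul_diag_mx !mxE.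
Qed.

Let phi2E : phi2 x = \sum_a mu a ^+ 2.
Proof.
have Pu := frame_mx_unit ee; have trH := trace_quot_mx gm fV fs nuT n_gt0 cmc Ux.
have BE : B x = invmx (frame_mx e) *m diag_mx (\row_a lam a) *m frame_mx e.
  by rewrite -mulmxA -PB mulKmx.
have sl : \sum_a lam a = n%:R * H.
  rewrite -trH BE -mulmxA mxtrace_mulC mulmxK// mxtrace_diag.
  by apply: eq_bigr => a _; rewrite mxE.
have mu0 : \sum_a mu a = 0.
  apply: (addIr (n%:R * H)); rewrite add0r -[RHS]sl -sum_const_ord -big_split /=.
  by apply: eq_bigr.
rewrite /norm_phi2 BE -!mulmxA (mulmxA (frame_mx e)) mulmxV// mul1mx mxtrace_mulC -!mulmxA mulmxV// mulmx1.
rewrite mulmx_diag mxtrace_diag (eq_bigr (fun a => mu a ^+ 2 + (2 * H * mu a + H ^+ 2))) => [|a _].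
  by rewrite !big_split /= -mulr_sumr mu0 mulr0 add0r sum_const_ord addrK.
by rewrite !mxE /lam; ring.
Qed.

Let nrmE z : U z -> nrm z = F z.
Proof. exact: (norm_tracelessE gm oU fV fs nuT Gu n_gt0 cmc). Qed.

Let EE a b : iprod (g y) (E a) (E b) = (a == b)%:R.
Proof. by rewrite (ip_df g fs _ _ Ux). Qed.
Let NuE a : iprod (g y) Nu (E a) = 0.
Proof. exact: (nu_df fs nuT _ Ux). Qed.
Let gsym : (g y)^T = g y. Proof. by case: gm => _ _ + _; apply. Qed.

(** The Ricci trace is taken over the tangent frame completed by the normal, whose own term vanishes
    by skew symmetry. *)
Let ricciE : ricci g y Nu Nu = \sum_a N a.
Proof.
have L : linear (fun u => Rm g y u Nu Nu) := Rm_lin1 gm Nu Nu Vy.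
have := trace_orthonormal (ext_frame_orthonormal gsym EE (nu1 Ux) NuE) L.
rewrite [X in _ = X]big_ord_recl ext_frame0 (Rm_anti gm _ _ _ Vy).
have Z : iprod (g y) (- Rm g y Nu Nu Nu) Nu = 0.
  have := Rm_skew gm Vy Nu Nu Nu Nu; rewrite ipNl; lra.
rewrite Z add0r => T.
transitivity (\sum_a (Rm g y (basis_vec a) Nu Nu) 0 a).
  by rewrite /ricci Rm.unlock.
rewrite T; apply: eq_bigr => a _; rewrite ext_frame_lift.
by rewrite (Rm_anti gm _ _ _ Vy) ipNl (Rm_skew gm Vy) opprK.
Qed.

Let phiE a : 'D_(e a *m phi) f x = mu a *: E a.
Proof. by rewrite ephi ddE (dd_dirZ _ _ (smooth_diff fs Ux)). Qed.

Let riemE u v w z : riem g y u v w z = iprod (g y) (Rm g y u v z) w.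
Proof. by rewrite iprod.unlock Rm.unlock. Qed.

(** The images of the frame enter as variables with defining equations, so that rewriting does not
    meet the derivatives they stand for. *)
Theorem chart_inequality (E0 phiE0 : 'I_n -> 'rV[R]_n.+1)
  (E0_def : forall a, E0 a = 'D_(e a) f x) (phiE0_def : forall a, phiE0 a = 'D_(e a *m phi) f x) :
  nrm x * laplacian g f nrm x
  + nrm x ^+ 4
  + n%:R * (n%:R - 2) * H / Num.sqrt (n%:R * (n%:R - 1)) * nrm x ^+ 3
  - n%:R * H ^+ 2 * nrm x ^+ 2
  + nrm x ^+ 2 * ricci g y Nu Nu
  - n%:R * H * (\sum_a riem g y Nu (E0 a) Nu (phiE0 a))
  - (\sum_a \sum_k (2 * riem g y (E0 k) (phiE0 a) (E0 k) (phiE0 a)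
                    + 2 * riem g y (E0 k) (E0 a) (phiE0 a) (phiE0 k)))
  - (\sum_a \sum_k (bil (g y) (nabla_curv g y (E0 a) (E0 k) (phiE0 a) (E0 k)) Nu
                    + bil (g y) (nabla_curv g y (E0 a) (E0 a) (phiE0 k) (E0 k)) Nu))
  >= 2 / (n%:R * (1 + eps)) *
       bil (induced_metric g f x) (grad g f nrm x) (grad g f nrm x)
     - 2 / eps * (\sum_a \sum_b riem g y Nu (E0 a) (E0 a) (E0 b) ^+ 2).
Proof.
have EqE a : E0 a = E a by rewrite E0_def ddE.
have PhE a : phiE0 a = mu a *: E a by rewrite phiE0_def phiE.
have s1 : \sum_a riem g y Nu (E0 a) Nu (phiE0 a) = \sum_a mu a * N a.
  apply: eq_bigr => a _.
  by rewrite riemE PhE EqE (RmZ3 gm Vy) ipZl.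
have s2 : \sum_a \sum_k (2 * riem g y (E0 k) (phiE0 a) (E0 k) (phiE0 a)
      + 2 * riem g y (E0 k) (E0 a) (phiE0 a) (phiE0 k)) =
    \sum_a \sum_k (2 * (mu a ^+ 2 * K k a) + 2 * (- (mu a * mu k * K k a))).
  apply: eq_bigr => a _; apply: eq_bigr => k _.
  rewrite !riemE !PhE !EqE !(RmZ3 gm Vy) (RmZ2 gm Vy) !ipZl ipZr.
  by rewrite [X in _ + 2 * (_ * (_ * X))](Rm_skew gm Vy) /K; ring.
have s3 : \sum_a \sum_k (bil (g y) (nabla_curv g y (E0 a) (E0 k) (phiE0 a) (E0 k)) Nu
      + bil (g y) (nabla_curv g y (E0 a) (E0 a) (phiE0 k) (E0 k)) Nu) =
    \sum_a \sum_k (mu a * dR a k a k + mu k * dR a a k k).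
  apply: eq_bigr => a _; apply: eq_bigr => k _.
  rewrite -[bil]iprod.unlock -[nabla_curv]dRm.unlock !PhE !EqE.
  by rewrite !(dRmZ3 gm _ _ _ _ _ Vy) !ipZl.
(* Pair symmetry turns R(nu, e_a, e_a, e_b) into the Codazzi term S a b a, up to a sign that the
   square ignores. *)
have s4 : \sum_a \sum_b riem g y Nu (E0 a) (E0 a) (E0 b) ^+ 2 =
    \sum_a \sum_b iprod (g y) (Rm g y (E a) (E b) (E a)) Nu ^+ 2.
  apply: eq_bigr => a _; apply: eq_bigr => b _; rewrite riemE !EqE.
  congr (_ ^+ 2); rewrite (Rm_pair gm Vy (E a) (E b) (E a) Nu) (Rm_anti gm (E a) Nu _ Vy).
  by rewrite ipNl (Rm_skew gm Vy Nu (E a) (E a) (E b)) opprK.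
rewrite s1 s2 s3 s4 ricciE.
have [phi2_gt0|phi2_le0] := ltrP 0 (phi2 x); last first.
  have mu0 a : mu a = 0.
    apply/eqP; rewrite -sqrf_eq0 eq_le sqr_ge0 andbT; apply: le_trans phi2_le0.
    by rewrite phi2E (bigD1 a)//= lerDl sumr_ge0// => b _; exact: sqr_ge0.
  have nrm0 : nrm x = 0 by rewrite nrmE// ler0_sqrtr.
  have grad0 : grad g f nrm x = 0.
    rewrite /grad (_ : \row_a _ = 0) ?mul0mx//; apply/rowP => a; rewrite !mxE.
    (* [nrm] is a square root, hence nonnegative on the whole coordinate space and not only on [U]:
       its zero is a global minimum. *)
    by apply: derive_at_min => z; rewrite nrm0 sqrtr_ge0.
  have z1 : \sum_a mu a * N a = 0 by rewrite big1// => a _; rewrite mu0 mul0r.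
  have z2 : \sum_a \sum_k (2 * (mu a ^+ 2 * K k a) + 2 * (- (mu a * mu k * K k a))) = 0.
    by rewrite big1// => a _; rewrite big1// => k _; rewrite !mu0; ring.
  have z3 : \sum_a \sum_k (mu a * dR a k a k + mu k * dR a a k k) = 0.
    by rewrite big1// => a _; rewrite big1// => k _; rewrite !mu0; ring.
  (* What is left states that minus 2/eps times a sum of squares is at most 0. *)
  rewrite nrm0 grad0 z1 z2 z3 -[bil]iprod.unlock ip0l !expr0n /= !(mul0r, mulr0).
  rewrite !(addr0, subr0, oppr0, add0r) oppr_le0 mulr_ge0 ?divr_ge0 ?(ltW eps_gt0)//.
  by rewrite sumr_ge0// => a _; rewrite sumr_ge0// => b _; exact: sqr_ge0.
(* On this smaller neighbourhood the square root stays away from 0, so |phi| is smooth there. *)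
pose U' := U `&` [set z | 0 < phi2 z].
have phi2s := smooth_norm_phi2 gm oU fV fs nus Gu H.
have oU' : open U'.
  rewrite openE => z [Uz pz]; apply: filterI; first exact: open_nbhs_nbhs.
  have := differentiable_continuous (smooth_diff phi2s Uz).
  by move=> /(_ [set r | 0 < r]); apply; apply: open_nbhs_nbhs; split=> //; exact: open_gt.
have U'U z : U' z -> U z by case.
have sub (X : normedModType R) (Y : 'rV[R]_n -> X) : smooth U Y -> smooth U' Y.
  by move=> Ys k; exact: Ck_sub (Ys k).
have U'x : U' x by [].
have Fs : smooth U' F.
  by move=> k; apply: Ck_sqrt => //; [move=> z []|exact: sub].
have nrms : smooth U' nrm.
  by apply: (smooth_ext oU' _ Fs) => z /U'U/nrmE.
have fV' z : U' z -> V (f z) by move=> /U'U/fV.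
have Gu' z : U' z -> Gm z \in unitmx by move=> /U'U/Gu.
have ddnrm v z : U' z -> dd v nrm z = dd v F z.
  by move=> Uz; apply: (dd_ext _ oU' Uz) => t /U'U/nrmE.
rewrite (grad_sqr Gu' U'x nrms ee).
rewrite (laplacian_frame gm oU' fV' (sub _ _ fs) Gu' U'x nrms ee) nrmE//.
under eq_bigr do rewrite ddnrm//.
have -> : \sum_k hess g f x nrm (e k) (e k) = \sum_k hess g f x F (e k) (e k).
  apply: eq_bigr => k _; rewrite /hess ddnrm//; congr (_ - _).
  by apply: (dd_ext _ oU' U'x) => z; exact: ddnrm.
have trB z : U' z -> \tr (B z) = n%:R * H.
  by move=> /U'U; exact: (trace_quot_mx gm fV fs nuT n_gt0 cmc).
have := @local_inequality R n V g gm U' f nu oU' fV' (sub _ _ fs) (sub _ _ nus)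
  (fun z Uz => nu1 (U'U z Uz)) (fun z Uz => nuT (U'U z Uz)) Gu' H trB (fun z => @proj2 _ _)
  x e lam U'x ee eB eps H_ge0 eps_gt0.
have muE a : lam a - H = mu a by rewrite addrK.
under [X in _ - _ * X - _ - _]eq_bigr do rewrite muE.
under [X in _ - X - _]eq_bigr do under eq_bigr do rewrite !muE.
under [X in _ - X]eq_bigr do under eq_bigr do rewrite !muE.
by [].
Qed.

End ChartInequality.

(** * From manifolds to charts *)

Section Manifold.
Variables (R : realType) (m : nat) (N : manifold R m) (gN : riemannian_metric N) (j : chart N).

Lemma metric_on_chart : metric_on (chart_map j @` chart_dom j) (gmx gN j).
Proof.
split.
- exact: img_open.
- by apply/smooth_onP; exact: gmx_smooth.
- by move=> _ [p pj <-]; exact: gmx_sym.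
- move=> _ [p pj <-]; apply: posdef_unitmx => u u0.
  by rewrite iprod.unlock; exact: gmx_pos.
Qed.
End Manifold.

Section ImmersionChart.
Variables (R : realType) (n : nat) (M : manifold R n) (N : manifold R n.+1).
Variables (F : M -> N) (i : chart M) (j : chart N).
Definition local_dom : set 'rV[R]_n := chart_map i @` (chart_dom i `&` F @^-1` chart_dom j).

(** The preimage under [chart_inv] may contain points outside the image of the chart, where
    [chart_inv] is arbitrary. It is therefore intersected with that image, itself a neighbourhood,
    on which [chart_inv] inverts [chart_map]. *)
Lemma open_local_dom : continuous F -> open local_dom.
Proof.
move=> Fc; rewrite openE => _ [p [pi pj] <-].
have oD : open (chart_dom i `&` F @^-1` chart_dom j).
  apply: openI; first exact: dom_open.
  by apply: open_comp => [? _|]; [exact: Fc|exact: dom_open].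
have n1 : nbhs (chart_map i p) (chart_map i @` chart_dom i).
  by apply: open_nbhs_nbhs; split; [exact: img_open|exists p].
have n2 : nbhs (chart_map i p) (chart_inv i @^-1` (chart_dom i `&` F @^-1` chart_dom j)).
  apply: (chart_inv_continuous pi); apply: open_nbhs_nbhs; split=> //=.
  by rewrite chart_mapK.
apply: filterS2 n1 n2 => _ [q qi <-] /=; rewrite chart_mapK// => -[_ qj].
by exists q.
Qed.
End ImmersionChart.

Theorem proposition3p2 (R : realType) (n : nat) (n_gt0 : (0 < n)%N)
  (N : manifold R n.+1) (N_orientable : orientable N) (gN : riemannian_metric N)
  (N_bounded_sec : bounded_sectional_curvature gN)
  (N_bounded_nabla : bounded_nabla_curvature gN)
  (M : manifold R n) (M_orientable : orientable M)
  (F : M -> N) (F_immersion : immersion F)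
  (nu : chart N -> M -> 'rV[R]_n.+1) (nu_normal : unit_normal gN F nu)
  (H : R) (H_ge0 : 0 <= H) (cmc : constant_mean_curvature gN F nu H)
  (p : M) (eps : R) (eps_gt0 : 0 < eps)
  (i : chart M) (ip : chart_dom i p) (j : chart N) (jp : chart_dom j (F p)) :
  let x := chart_map i p in
  let y := chart_map j (F p) in
  let g := gmx gN j in
  let f := local_map F i j in
  let nuf := nu j \o chart_inv i in
  let df (u : 'rV[R]_n) := 'D_u f x in
  let nrm := norm_traceless g f nuf in
  let Nu := nu j p in
  forall e : 'I_n -> 'rV[R]_n,
  (forall a b, bil (induced_metric g f x) (e a) (e b) = (a == b)%:R) ->
  (* the frame diagonalizes phi at p: the right-hand side depends on the frame *)
  (forall a, exists l : R, e a *m traceless_shape g f nuf x = l *: e a) ->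
  let E a := df (e a) in
  let phiE a := df (e a *m traceless_shape g f nuf x) in
  nrm x * laplacian g f nrm x
  + nrm x ^+ 4
  + n%:R * (n%:R - 2) * H / Num.sqrt (n%:R * (n%:R - 1)) * nrm x ^+ 3
  - n%:R * H ^+ 2 * nrm x ^+ 2
  + nrm x ^+ 2 * ricci g y Nu Nu
  - n%:R * H * (\sum_a riem g y Nu (E a) Nu (phiE a))
  - (\sum_a \sum_k (2 * riem g y (E k) (phiE a) (E k) (phiE a)
                    + 2 * riem g y (E k) (E a) (phiE a) (phiE k)))
  - (\sum_a \sum_k (bil (g y) (nabla_curv g y (E a) (E k) (phiE a) (E k)) Nu
                    + bil (g y) (nabla_curv g y (E a) (E a) (phiE k) (E k)) Nu))
  >= 2 / (n%:R * (1 + eps)) *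
       bil (induced_metric g f x) (grad g f nrm x) (grad g f nrm x)
     - 2 / eps * (\sum_a \sum_b riem g y Nu (E a) (E a) (E b) ^+ 2).
Proof.
move=> x y g f nuf df nrm Nu e ee eigen.
pose E a := df (e a); pose phiE a := df (e a *m traceless_shape g f nuf x).
have [mu mue] := choice eigen.
have [Fc Fi] := F_immersion; have [_ nu_smooth nu_unit nu_tan] := nu_normal.
have gm : metric_on (chart_map j @` chart_dom j) g := metric_on_chart gN j.
pose U := local_dom F i j.
have oU : open U by exact: open_local_dom.
have fE q : chart_dom i q -> f (chart_map i q) = chart_map j (F q).
  by move=> qi; rewrite /f /local_map /= chart_mapK.
have nuE q : chart_dom i q -> nuf (chart_map i q) = nu j q.
  by move=> qi; rewrite /nuf /= chart_mapK.
have fV z : U z -> (chart_map j @` chart_dom j) (f z).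
  by move=> [q [qi qj] <-]; rewrite fE//; exists (F q).
have fs : smooth U f by apply/smooth_onP; exact: (Fi i j).1.
have nus : smooth U nuf by apply/smooth_onP; exact: nu_smooth.
have nu1 z : U z -> ipf g f nuf nuf z = 1.
  by move=> [q [qi qj] <-]; rewrite /ipf fE// nuE// iprod.unlock; exact: nu_unit.
have nuT z : U z -> forall a, ipf g f nuf (tangent f a) z = 0.
  move=> [q [qi qj] <-] a; rewrite /ipf fE// nuE// /tangent iprod.unlock dd.unlock.
  exact: nu_tan.
(* The induced metric is positive definite: the differential of an immersion is injective and the
   ambient metric is positive. *)
have Gu z : U z -> first_form_mx g f z \in unitmx.
  move=> Uz; apply: posdef_unitmx => u u0; rewrite -(ip_df g fs _ _ Uz).
  case: Uz => q [qi qj] <-; rewrite fE// iprod.unlock; apply: gmx_pos => //.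
  by apply: contra_neq u0; rewrite dd.unlock; exact: (Fi i j).2.
have cmc' z : U z -> mean_curvature g f nuf z = H.
  by move=> [q [qi qj] <-]; exact: cmc.
have Ux : U x by exists p.
have ee' a b : iprod (first_form_mx g f x) (e a) (e b) = (a == b)%:R.
  by rewrite -ee induced_metricE iprod.unlock.
have := @chart_inequality R n _ g gm U f nuf oU fV fs nus nu1 nuT Gu n_gt0 H cmc' x e mu eps
  Ux H_ge0 eps_gt0 ee' mue E phiE (fun=> erefl) (fun=> erefl).
by rewrite (fE p)// (nuE p).
Qed.
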